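(* Let $\lambda,\omega,\mathcal T>0$ be such that $\frac{2\pi}{\mathcal T}/\omega\notin\mathbb Q$, and let $\mathbb T=\mathbb R/\mathcal T\mathbb Z$. Consider the system $$ \partial_tu+\omega\,\mathcal R u-\Delta u-\lambda\partial_1u+\nabla\mathfrak p=f,\qquad \operatorname{div}u=0\qquad\text{in }\mathbb T\times\mathbb R^3. \tag{$*$} $$ (i) There is $f\in A(\mathbb T;L^2(\mathbb R^3)^3)$ such that there exists no time-periodic solution $(u,\mathfrak p)\in L^1_{\mathrm{loc}}(\mathbb T\times\mathbb R^3)^{3+1}$ to $( * )$ with $\partial_tu+\omega\mathcal R u,\ \nabla^2u,\ \partial_1u\in A(\mathbb T;L^2(\mathbb R^3))$. (ii) There is $f\in L^2(\mathbb T\times\mathbb R^3)^3$ such that there exists no time-periodic solution $(u,\mathfrak p)\in L^1_{\mathrm{loc}}(\mathbb T\times\mathbb R^3)^{3+1}$ to $( * )$ with $\partial_tu+\omega\mathcal R u,\ \nabla^2u,\ \partial_1u\in L^2(\mathbb T\times\mathbb R^3)$.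
   Context: Functions are complex valued; functions on $\mathbb T=\mathbb R/\mathcal T\mathbb Z$ are $\mathcal T$-periodic functions of time. Solutions and derivatives are understood in the sense of distributions. $e_1=(1,0,0)$, $\wedge$ is the vector product in $\mathbb R^3$, and $$\mathcal R u:=e_1\wedge u-(e_1\wedge x)\cdot\nabla u,\qquad (e_1\wedge x)\cdot\nabla u=\sum_{j=1}^3(e_1\wedge x)_j\,\partial_ju .$$ $\nabla$, $\operatorname{div}$, $\Delta$ and $\nabla^2$ (all second-order derivatives) act in space only; membership of vector- or tensor-valued functions in a space is meant componentwise. For a normed space $X$, $$A(\mathbb T;X)=\Big\{f:\mathbb T\to X\ :\ f(t)=\sum_{k\in\mathbb Z}f_k e^{i\frac{2\pi}{\mathcal T}kt},\ f_k\in X,\ \sum_{k\in\mathbb Z}\|f_k\|_X<\infty\Big\},\qquad \|f\|_{A(\mathbb T;X)}=\sum_{k\in\mathbb Z}\|f_k\|_X .$$ *)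

(* Defs.v *)
From HB Require Import structures.
From mathcomp Require Import all_boot all_order all_algebra.
From mathcomp Require Import complex.
From mathcomp Require Import all_classical all_reals all_analysis.
Set Implicit Arguments.
Unset Strict Implicit.
Unset Printing Implicit Defensive.
Import Order.TTheory GRing.Theory Num.Theory numFieldNormedType.Exports.
Local Open Scope classical_set_scope.
Local Open Scope ring_scope.

(* [m1 \x m2] with its sigma-finite structure: the product operator of the
   library is first tied to subprobability measures, so that sigma-finiteness
   of [m1 \x m2] is not inferred in general. *)
Section ProductMeasure.
Context d1 d2 (T1 : measurableType d1) (T2 : measurableType d2) (R : realType).
Variables (m1 : {sigma_finite_measure set T1 -> \bar R})
          (m2 : {sigma_finite_measure set T2 -> \bar R}).

Definition sf_product : set (T1 * T2) -> \bar R := (m1 \x m2)%E.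

HB.instance Definition _ := Measure.on sf_product.

Let sf_product_sigma_finite : sigma_finite setT sf_product.
Proof.
have /sigma_finiteP[F [TF ndF Foo]] := sigma_finiteT m1.
have /sigma_finiteP[G [TG ndG Goo]] := sigma_finiteT m2.
exists (fun n => F n `*` G n).
  rewrite -setXTT TF TG predeqE => -[x y]; split.
    move=> [/= [n _ Fnx] [k _ Gky]]; exists (maxn n k) => //; split.
    - by move: x Fnx; exact/subsetPset/ndF/leq_maxl.
    - by move: y Gky; exact/subsetPset/ndG/leq_maxr.
  by move=> [n _ []/= ? ?]; split; exists n.
move=> k; have [? ?] := Foo k; have [? ?] := Goo k.
split; first exact: measurableX.
by rewrite /sf_product product_measure1E// lte_mul_pinfty// ge0_fin_numE.
Qed.

HB.instance Definition _ :=
  Measure_isSigmaFinite.Build _ _ _ sf_product sf_product_sigma_finite.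

End ProductMeasure.

(* Points of space and of space-time.  Functions on the torus R/TZ times R^3
   are functions on [spacetime R] that are T-periodic in the first variable.
   Coordinates and vector components are indexed by 'I_3 = {0, 1, 2}. *)
Notation space3 R := (R * R * R)%type.
Notation spacetime R := (R * space3 R)%type.

Section Geometry.
Variable R : realType.

Definition coordinate (x : space3 R) (j : 'I_3) : R :=
  tnth [tuple x.1.1; x.1.2; x.2] j.

Definition basis_vector (j : 'I_3) : space3 R :=
  ((j == 0)%:R, (j == 1)%:R, (j == 2)%:R).

(* The index arithmetic is modulo 3. *)
Definition cross (K : pzRingType) (V : lmodType K)
    (a : 'I_3 -> K) (b : 'I_3 -> V) (j : 'I_3) : V :=
  a (j + 1) *: b (j + 2) - a (j + 2) *: b (j + 1).

Definition e1 (K : pzRingType) (j : 'I_3) : K := (j == 0)%:R.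

Local Notation L := (@lebesgue_measure R).

Definition leb_space : {sigma_finite_measure set _ -> \bar R} :=
  sf_product (sf_product L L) L.

Definition leb_spacetime : {sigma_finite_measure set _ -> \bar R} :=
  sf_product L leb_space.

End Geometry.

Section FunctionSpaces.
Variable R : realType.
Local Notation C := R[i].
Local Notation normc := (@Normc.normc R).

Definition cmeasurable d (E : measurableType d) (g : E -> C) :=
  measurable_fun setT (fun z => complex.Re (g z)) /\
  measurable_fun setT (fun z => complex.Im (g z)).

Definition L2norm (g : space3 R -> C) : \bar R :=
  ('N[leb_space R]_(2%:E)[EFin \o (fun x => normc (g x))])%E.

Definition L2_space : set (space3 R -> C) :=
  [set g | cmeasurable g /\ (L2norm g < +oo)%E].

Section Periodic.
Variable T : R.

Definition periodic (A : Type) (g : spacetime R -> A) :=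
  forall t x, g (t + T, x) = g (t, x).

Definition fourier_char (k : int) (t : R) : C :=
  Complex (cos (2 * pi / T * k%:~R * t)) (sin (2 * pi / T * k%:~R * t)).

(* A(T; X), where X is a set of functions on E with (semi)norm N: elements of
   X are represented by functions, and the identity
   f(t) = \sum_k f_k e^{i 2 pi k t / T} is convergence in the norm of X of the
   symmetric partial sums. *)
Definition A_space (E : Type) (X : set (E -> C)) (N : (E -> C) -> \bar R)
    : set (R -> E -> C) :=
  [set f | exists fk : int -> E -> C,
    [/\ forall k, X (fk k),
        (\esum_(k in [set: int]) N (fk k) < +oo)%E,
        forall t, X (f t) &
        forall t, (fun n : nat =>
          N (f t - \sum_(i < n.*2.+1)
                     fourier_char ((i : nat)%:Z - n%:Z) t
                       *: fk ((i : nat)%:Z - n%:Z)))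
          @ \oo --> 0%E]].

(* Joint measurability selects a representative in the space-time variables;
   one always exists, since \sum_k |f_k| is finite almost everywhere. *)
Definition A_L2 : set (spacetime R -> C) :=
  [set g | [/\ periodic g, cmeasurable g &
    A_space L2_space L2norm (fun t x => g (t, x))]].

Definition period_domain (K : set (space3 R)) : set (spacetime R) :=
  `[0, T] `*` K.

Definition L2_spacetime : set (spacetime R -> C) :=
  [set g | [/\ periodic g, cmeasurable g &
    (\int[leb_spacetime R]_(z in period_domain setT)
       ((normc (g z)) ^+ 2)%:E < +oo)%E]].

Definition L1loc : set (spacetime R -> C) :=
  [set g | [/\ periodic g, cmeasurable g &
    forall K : set (space3 R), compact K ->
    (\int[leb_spacetime R]_(z in period_domain K) (normc (g z))%:E < +oo)%E]].

End Periodic.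
End FunctionSpaces.

Section Distributions.
Variables (R : realType) (T : R).
Local Notation C := R[i].

Definition dt (phi : spacetime R -> R) : spacetime R -> R :=
  fun z => 'D_((1, 0) : spacetime R) phi z.

Definition dx (j : 'I_3) (phi : spacetime R -> R) : spacetime R -> R :=
  fun z => 'D_((0, basis_vector R j) : spacetime R) phi z.

(* [None] stands for the time variable. *)
Definition direction (i : option 'I_3) : spacetime R :=
  if i is Some j then (0, basis_vector R j) else (1, 0).

Definition partial (i : option 'I_3) (phi : spacetime R -> R) :=
  if i is Some j then dx j phi else dt phi.

Definition smooth (phi : spacetime R -> R) :=
  forall s : seq (option 'I_3),
    continuous (foldr partial phi s) /\
    forall i z, derivable (foldr partial phi s) z (direction i).

Definition test_function (phi : spacetime R -> R) :=
  [/\ smooth phi, periodic T phi &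
      exists2 K : set (space3 R), compact K &
        forall t x, ~ K x -> phi (t, x) = 0].

(* A complex distribution on the torus times R^3 is given by its values on
   real test functions; its values at other functions are irrelevant, see
   [eq_distrib]. *)
Definition distrib := (spacetime R -> R) -> C.

Definition eq_distrib (S S' : distrib) :=
  forall phi, test_function phi -> S phi = S' phi.

Definition regular_distrib (g : spacetime R -> C) : distrib := fun phi =>
  Complex
   (\int[leb_spacetime R]_(z in period_domain T setT)
      (complex.Re (g z) * phi z))
   (\int[leb_spacetime R]_(z in period_domain T setT)
      (complex.Im (g z) * phi z)).

Definition Dt (S : distrib) : distrib := fun phi => - S (dt phi).

Definition Dx (j : 'I_3) (S : distrib) : distrib :=
  fun phi => - S (dx j phi).

Definition mulD (a : space3 R -> R) (S : distrib) : distrib :=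
  fun phi => S (fun z => a z.2 * phi z).

Definition laplacian (S : distrib) : distrib :=
  \sum_(j < 3) Dx j (Dx j S).

Definition divergence (U : 'I_3 -> distrib) : distrib :=
  \sum_(j < 3) Dx j (U j).

Definition e1_cross_x (j : 'I_3) (x : space3 R) : R :=
  cross (e1 R) (coordinate x : 'I_3 -> R^o) j.

Definition rotation (U : 'I_3 -> distrib) (j : 'I_3) : distrib :=
  cross (e1 C) (U : 'I_3 -> ((spacetime R -> R) -> C)) j
  - \sum_(k < 3) mulD (e1_cross_x k) (Dx k (U j)).

Definition belongs (X : set (spacetime R -> C)) (S : distrib) :=
  exists2 g, X g & eq_distrib S (regular_distrib g).

Definition is_solution (lambda omega : R) (f u : 'I_3 -> spacetime R -> C)
    (p : spacetime R -> C) :=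
  let U j := regular_distrib (u j) in
  (forall j, eq_distrib
     (Dt (U j) + omega%:C%C *: rotation U j - laplacian (U j)
      - lambda%:C%C *: Dx 0 (U j) + Dx j (regular_distrib p))
     (regular_distrib (f j))) /\
  eq_distrib (divergence U) 0.

Definition regularity (X : set (spacetime R -> C)) (omega : R)
    (u : 'I_3 -> spacetime R -> C) :=
  let U j := regular_distrib (u j) in
  [/\ forall j, belongs X (Dt (U j) + omega%:C%C *: rotation U j),
      forall j k l, belongs X (Dx k (Dx l (U j))) &
      forall j, belongs X (Dx 0 (U j))].

End Distributions.

(* Main.v *)
Require Import Defs.
From HB Require Import structures.
From mathcomp Require Import all_boot all_order all_algebra.
From mathcomp Require Import complex.
From mathcomp Require Import all_classical all_reals all_analysis.
From mathcomp Require Import measurable_realfun ring lra.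
Set Implicit Arguments.
Unset Strict Implicit.
Unset Printing Implicit Defensive.
Import Order.TTheory GRing.Theory Num.Theory numFieldNormedType.Exports.
Local Open Scope classical_set_scope.
Local Open Scope ring_scope.


(** Small divisors make the system unsolvable.  In what follows the coordinates are [x_0, x_1, x_2],
  the rotation axis is the [x_0]-axis, and [kappa = 2 pi / T].

  For a profile [b] on the line and a real radial profile [rho], the potential
    [S (t, x) = e^(i kappa k t) b(x_0) (x_1 + i x_2)^(n+1) rho(x_1^2 + x_2^2)]
  is an eigenfunction of the transport operator [L = - d_t + omega (x_1 d_2 - x_2 d_1)]: one has
  [L S = - i theta S] with the detuning [theta = kappa k - omega (n+1)].  Since [kappa / omega] is
  irrational, [theta] never vanishes, but by the pigeonhole principle it takes arbitrarily small
  values.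

  Test the momentum equation with the field [(0, d_2 Q, - d_1 Q)].  It is divergence free, so the
  pressure disappears, and the transposed operators map rotated gradients to rotated gradients: with
  [B = - Laplacian + lambda d_0] and [a = d_t u + omega R u], integration by parts gives
    [<f, grad^perp Q> = <u, grad^perp (L Q + B Q)>] and [<a, grad^perp X> = <u, grad^perp L X>].
  Hence [<f, grad^perp Q> = <a, grad^perp X>] as soon as [L X = L Q + B Q] ([gpair_duality],
  [solution_duality]); the unknown [u] is gone, and all that is needed of it is that [a] is square
  integrable.  For [Q = S] the eigenvalue equation provides [X = S + (i / theta) B S]
  ([transport_corrector]).

  A priori [X] is huge, because of the factor [1 / theta].  But one can choose
  [b(x_0) = e^(i xi x_0) beta((x_0 - tau) / M)] with [xi = theta / lambda]: the main part
  [(i / theta) lambda b' = - b + ...] of the correction cancels [S], and what is left is of size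
  [xi^2 / theta] once [M] is large and [rho] is spread out enough.  So
  [|grad^perp X| <= (4 / lambda^2) |theta| |grad^perp S|] in [L^2] ([wave_packet]).

  Finally take packets [S_k], one per time frequency [k], normalized and supported in disjoint slabs
  of the variable [x_0], and put [f = sum_k c_k grad^perp S_k] with [c] summable.  Then [f] lies in
  [A(T; L^2)], hence also in [L^2], and a solution would give, for all [k],
    [c_k T = <f, grad^perp S_k> = <a, grad^perp X_k> <= A |theta_k|]
  ([solution_bound]).  This is absurd if [c] is chosen so that [c_k / |theta_k|] is unbounded
  ([resonance_sequence]).  The same [f] serves for both function spaces, because
  [A(T; L^2)] is contained in [L^2]. *)

(** * A class of smooth functions closed under differentiation *)

(** The directional derivative.  Locking it keeps unification from unfolding it to a limit. *)
HB.lock Definition dird (R : realType) (V : normedModType R) (v : V) (f : V -> R)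
  : V -> R := 'D_v f.

Section SmoothFunctions.
Variable R : realType.

(** Smoothness of a function of one variable, in the form of its sequence of derivatives. *)
Definition derivable_sequence (g : R -> R) :=
  exists2 G : nat -> R -> R, G 0%N = g &
    forall n x, is_derive x (1 : R) (G n) (G n.+1 x).

Section Class.
Variables (V : normedModType R) (I : Type) (crd : I -> V -> R).

(** A syntactic class of smooth functions: everything that is generated by the coordinates [crd]
  under the ring operations and composition with smooth functions of one variable.  It contains all
  test functions that occur below.  Stability under differentiation, the symmetry of second
  derivatives and measurability then follow by induction on the generation. *)
Inductive sm : (V -> R) -> Prop :=
| sm_crd i : sm (crd i)
| sm_cst c : sm (fun=> c)
| sm_add f g : sm f -> sm g -> sm (fun z => f z + g z)
| sm_mul f g : sm f -> sm g -> sm (fun z => f z * g z)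
| sm_comp g f : derivable_sequence g -> sm f -> sm (fun z => g (f z)).

Definition linear_chart :=
  forall i, (forall a x y, crd i (a *: x + y) = a * crd i x + crd i y) /\
            continuous (crd i).

Hypothesis crdP : linear_chart.

Lemma chart_differentiable i z : differentiable (crd i) z /\
  forall v, 'D_v (crd i) z = crd i v.
Proof.
have [lin cont] := crdP i.
pose linM := GRing.isLinear.Build R V R^o *:%R (crd i) lin.
pose L : {linear V -> R^o} := HB.pack (crd i) linM.
have dL : differentiable (L : V -> R^o) z by exact: linear_differentiable.
split; first exact: dL.
by move=> v; rewrite deriveE//; rewrite -[crd i]/(L : V -> R^o) diff_lin.
Qed.

Lemma derivable_seq_differentiable g x : derivable_sequence g -> differentiable g x.
Proof.
move=> [G <- dG]; apply/derivable1_diffP; by have [] := dG 0%N x.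
Qed.

Lemma derivable_seq_derive1 g : derivable_sequence g -> derivable_sequence (derive1 g).
Proof.
move=> [G <- dG]; exists (fun n => G n.+1) => //.
apply/funext => x; rewrite derive1E; have := dG 0%N x => h; rewrite derive_val//.
Qed.

Lemma sm_differentiable f z : sm f -> differentiable f z.
Proof.
elim=> {f}.
- by move=> i; exact: (chart_differentiable i _).1.
- by move=> c; exact: differentiable_cst.
- by move=> f g _ df _ dg; exact: differentiableD.
- by move=> f g _ df _ dg; exact: differentiableM.
- move=> g f sg _ df; apply: differentiable_comp => //.
  exact: derivable_seq_differentiable.
Qed.

Lemma sm_derivable f z v : sm f -> derivable f z v.
Proof. by move=> sf; apply: diff_derivable; exact: sm_differentiable. Qed.

Lemma dird_comp v g f : derivable_sequence g -> sm f ->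
  dird v (fun z => g (f z)) = fun z => derive1 g (f z) * dird v f z.
Proof.
move=> sg sf; rewrite dird.unlock; apply/funext => z.
have df := sm_differentiable z sf.
have dg := derivable_seq_differentiable (f z) sg.
rewrite deriveE; last exact: differentiable_comp.
rewrite (_ : (fun z => _) = g \o f)// diff_comp//= deriv1E; last exact/derivable1_diffP.
by rewrite -deriveE// mulrC.
Qed.

Lemma dirdM v f g : sm f -> sm g ->
  dird v (fun z => f z * g z) = fun z => f z * dird v g z + g z * dird v f z.
Proof.
move=> sf sg; rewrite dird.unlock; apply/funext => z.
by rewrite (@deriveM _ _ f g)//; exact: sm_derivable.
Qed.

Lemma dirdD v f g : sm f -> sm g ->
  dird v (fun z => f z + g z) = fun z => dird v f z + dird v g z.
Proof.
move=> sf sg; rewrite dird.unlock; apply/funext => z.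
by rewrite (@deriveD _ _ _ f g)//; exact: sm_derivable.
Qed.

Lemma dird_cst v c : dird v (fun _ : V => c) = fun=> 0.
Proof. by rewrite dird.unlock; apply/funext => z; exact: (@derive_cst _ V R c v z). Qed.

Lemma dird_crd v i : dird v (crd i) = fun=> crd i v.
Proof.
rewrite dird.unlock; apply/funext => z; exact: (chart_differentiable i z).2.
Qed.

Lemma sm_dird f v : sm f -> sm (dird v f).
Proof.
elim=> {f}.
- by move=> i; rewrite dird_crd; exact: sm_cst.
- by move=> c; rewrite dird_cst; exact: sm_cst.
- by move=> f g sf sdf sg sdg; rewrite dirdD//; exact: sm_add.
- move=> f g sf sdf sg sdg; rewrite dirdM//.
  by apply: sm_add; exact: sm_mul.
- move=> g f sg sf sdf; rewrite dird_comp//.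
  by apply: sm_mul => //; apply: sm_comp => //; exact: derivable_seq_derive1.
Qed.

Lemma sm_is_derive f z v : sm f -> is_derive z v f (dird v f z).
Proof.
by move=> sf; rewrite dird.unlock; apply: derivableP; exact: sm_derivable.
Qed.

(** Symmetry of second derivatives: trivial on the generators, and preserved by the closure
  operations because the product and chain rules are symmetric in the two directions. *)
Lemma dirdC f v w : sm f -> dird v (dird w f) = dird w (dird v f).
Proof.
elim=> {f}.
- by move=> i; rewrite !dird_crd !dird_cst.
- by move=> c; rewrite !dird_cst.
- move=> f g sf ef sg eg.
  by rewrite !dirdD ?ef ?eg//; exact: sm_dird.
- move=> f g sf ef sg eg.
  have sv := sm_dird v; have sw := sm_dird w.
  rewrite (dirdM w sf sg) (dirdM v sf sg) !dirdD ?dirdM ?ef ?eg//; auto; try by apply: sm_mul; auto.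
  apply/funext => z; ring.
- move=> g f sg sf ef.
  have sg' := derivable_seq_derive1 sg.
  have sv := sm_dird v; have sw := sm_dird w.
  have sgf := sm_comp sg' sf.
  rewrite (dird_comp w sg sf) (dird_comp v sg sf) !dirdM ?dird_comp ?ef//; auto.
  by apply/funext => z; ring.
Qed.

End Class.

End SmoothFunctions.

(** * The line and space-time *)

Section Charts.
Variable R : realType.

Definition line_chart (_ : unit) (x : R) := x.

Lemma line_chartP : linear_chart line_chart.
Proof. by move=> i; split => // x; exact: cvg_id. Qed.

Definition spacetime_chart (i : option 'I_3) (z : spacetime R) :=
  if i is Some j then coordinate z.2 j else z.1.

Lemma ord3_ind (P : 'I_3 -> Prop) : P 0 -> P 1 -> P 2 -> forall j, P j.
Proof.
move=> P0 P1 P2 [[|[|[|//]]] h].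
- by rewrite (_ : Ordinal h = 0)//; exact: val_inj.
- by rewrite (_ : Ordinal h = 1)//; exact: val_inj.
- by rewrite (_ : Ordinal h = 2)//; exact: val_inj.
Qed.

Lemma spacetime_chartP : linear_chart spacetime_chart.
Proof.
have c1 (U W : topologicalType) : continuous (@fst U W) by move=> z; exact: cvg_fst.
have c2 (U W : topologicalType) : continuous (@snd U W) by move=> z; exact: cvg_snd.
case=> [j|]; last first.
  by split => // z; exact: c1.
elim/ord3_ind : j; split => //.
- by move=> z; apply: (@continuous_comp _ _ _ snd (fun x : space3 R => x.1.1)); [exact: c2|];
    apply: (@continuous_comp _ _ _ fst fst); exact: c1.
- by move=> z; apply: (@continuous_comp _ _ _ snd (fun x : space3 R => x.1.2)); [exact: c2|];
    apply: (@continuous_comp _ _ _ fst snd); [exact: c1|exact: c2].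
- by move=> z; apply: (@continuous_comp _ _ _ snd (fun x : space3 R => x.2)); exact: c2.
Qed.

Notation sm1 := (sm line_chart).
Notation sm4 := (sm spacetime_chart).

Lemma sm1_derivable_sequence f : sm1 f -> derivable_sequence f.
Proof.
move=> sf; exists (fun n => iter n (dird (1 : R)) f) => // n x.
have sfn : sm1 (iter n (dird (1 : R)) f).
  by elim: n => //= n ih; apply: sm_dird => //; exact: line_chartP.
by apply: sm_is_derive sfn; exact: line_chartP.
Qed.

Lemma derivable_sequence_sm1 f : derivable_sequence f -> sm1 f.
Proof. by move=> df; apply: sm_comp => //; exact: (sm_crd _ tt). Qed.

Lemma dird1E (f : R -> R) : derive1 f = dird (1 : R) f.
Proof. by apply/funext => x; rewrite derive1E dird.unlock. Qed.

Lemma sm_of_sm1 (V : normedModType R) (I : Type) (crd : I -> V -> R) g f :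
  sm1 g -> sm crd f -> sm crd (fun z => g (f z)).
Proof. by move=> sg sf; apply: sm_comp => //; exact: sm1_derivable_sequence. Qed.

(** Differentiation acts on the span of [cos] and [sin] by a rotation of the coefficients, which
  gives the whole sequence of derivatives at once. *)
Lemma derivable_sequence_trigo a b :
  derivable_sequence (fun x : R => a * cos x + b * sin x).
Proof.
pose ab n := iter n (fun p : R * R => (p.2, - p.1)) (a, b).
exists (fun n x => (ab n).1 * cos x + (ab n).2 * sin x) => // n x /=.
rewrite (_ : _ + _ = (ab n).1 *: - sin x + (ab n).2 *: cos x); last first.
  by rewrite /GRing.scale/=; ring.
exact: is_deriveD.
Qed.

Lemma sm1_cos : sm1 (@cos R).
Proof.
rewrite (_ : cos = fun x : R => 1 * cos x + 0 * sin x).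
  exact/derivable_sequence_sm1/derivable_sequence_trigo.
by apply/funext => x; rewrite mul1r mul0r addr0.
Qed.

Lemma sm1_sin : sm1 (@sin R).
Proof.
rewrite (_ : sin = fun x : R => 0 * cos x + 1 * sin x).
  exact/derivable_sequence_sm1/derivable_sequence_trigo.
by apply/funext => x; rewrite mul1r mul0r add0r.
Qed.

Lemma sm4_smooth f : sm4 f -> smooth f.
Proof.
have E i (g : spacetime R -> R) : partial i g = dird (direction R i) g.
  by rewrite dird.unlock; case: i.
move=> sf s; have : sm4 (foldr (@partial R) f s).
  elim: s => //= i s ih; rewrite E; apply: sm_dird => //; exact: spacetime_chartP.
move: (foldr _ _ _) => g sg; split.
- by move=> z; apply/differentiable_continuous/(sm_differentiable _ _ sg)/spacetime_chartP.
- by move=> i z; apply: sm_derivable sg; exact: spacetime_chartP.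
Qed.

Lemma sm4_measurable f : sm4 f -> measurable_fun [set: spacetime R] f.
Proof.
elim=> {f}.
- case=> [j|]; last exact: measurable_fst.
  have s2 : measurable_fun setT (@snd R (space3 R)) by exact: measurable_snd.
  have f1 : measurable_fun setT (@fst (R * R)%type R) by exact: measurable_fst.
  have f2 : measurable_fun setT (@fst R R) by exact: measurable_fst.
  have f3 : measurable_fun setT (@snd R R) by exact: measurable_snd.
  have f4 : measurable_fun setT (@snd (R * R)%type R) by exact: measurable_snd.
  elim/ord3_ind : j.
  + exact: measurableT_comp f2 (measurableT_comp f1 s2).
  + exact: measurableT_comp f3 (measurableT_comp f1 s2).
  + exact: measurableT_comp f4 s2.
- by move=> c; exact: measurable_cst.
- by move=> f g _ mf _ mg; exact: measurable_realfun.measurable_funD.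
- by move=> f g _ mf _ mg; exact: measurable_realfun.measurable_funM.
- move=> g f sg _ mf; apply: (@measurableT_comp _ _ _ _ _ _ g setT f) => //.
  apply: continuous_measurable_fun => x.
  by apply/differentiable_continuous/derivable_seq_differentiable.
Qed.

End Charts.

(** * A bump function *)

Section Bump.
Variable R : realType.

Lemma horner_le_norm (p : {poly R}) (y : R) : 1 <= y ->
  `|p.[y]| <= (\sum_(i < size p) `|p`_i|) * y ^+ size p.
Proof.
move=> y1; rewrite horner_coef (le_trans (ler_norm_sum _ _ _))// mulr_suml.
apply: ler_sum => i _; rewrite normrM ler_wpM2l// ger0_norm; last first.
  by rewrite exprn_ge0// (le_trans _ y1).
by rewrite ler_weXn2l// ltnW.
Qed.

(** The exponential decay beats the pole: the bound by [x ^+ 2] is what differentiability at [0]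
  requires. *)
Lemma horner_expRN_le (p : {poly R}) : exists2 C : R, 0 <= C &
  forall x, 0 < x -> x <= 1 -> `|p.[x^-1] * expR (- x^-1)| <= C * x ^+ 2.
Proof.
set n := size p; set S := \sum_(i < n) `|p`_i|.
have S0 : 0 <= S by exact: sumr_ge0.
exists (S * (n.+2)`!%:R) => [|x x0 x1]; first by rewrite mulr_ge0.
have y1 : 1 <= x^-1 by rewrite invf_ge1.
rewrite normrM [X in _ * X]ger0_norm ?expR_ge0//.
rewrite (le_trans (ler_wpM2r (expR_ge0 _) (horner_le_norm p y1)))// -/n -/S.
rewrite -!mulrA ler_wpM2l// expRN ler_pdivrMr ?expR_gt0//.
have fn0 : (0 : R) < (n.+2)`!%:R by rewrite ltr0n fact_gt0.
have := expR_ge1Dxn n.+1 (ltW (lt_le_trans ltr01 y1)).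
move=> /(le_trans _) -/(_ (x^-1 ^+ n.+2 / (n.+2)`!%:R)).
rewrite lerDr ler01 => /(_ isT) le1.
rewrite (_ : x^-1 ^+ n = (n.+2)`!%:R * x ^+ 2 * (x^-1 ^+ n.+2 / (n.+2)`!%:R)).
  by rewrite ler_wpM2l// mulr_ge0// ?exprn_ge0// ltW.
rewrite -[n.+2]addn2 exprD; set a := x^-1 ^+ n.
by field; rewrite !gt_eqF// addn2.
Qed.

Lemma is_derive_quadratic (f : R -> R) (C : R) : f 0 = 0 ->
  (forall x, `|x| <= 1 -> `|f x| <= C * x ^+ 2) -> is_derive (0 : R) (1 : R) f 0.
Proof.
move=> f0 fC.
have C0 : 0 <= C by have := fC 1; rewrite normr1 expr1n mulr1 => /(_ (lexx _)); exact: le_trans.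
suff h : h^-1 *: (f (h *: 1 + 0) - f 0) @[h --> (0 : R)^'] --> (0 : R).
  by split; [apply/cvg_ex; exists 0 | exact: (cvg_lim _ h)].
have cvgl : C * `|h| @[h --> (0 : R)^'] --> (0 : R).
  have n0 : `|h| @[h --> (0 : R)^'] --> `|0 : R|.
    by apply: cvg_within_filter; apply: cvg_norm; exact: cvg_id.
  have h := cvgM (cvg_cst C) n0; rewrite normr0 mulr0 in h; exact: h.
have cvgNl : - (C * `|h|) @[h --> (0 : R)^'] --> (0 : R).
  have h := cvgN cvgl; rewrite oppr0 in h; exact: h.
apply: (squeeze_cvgr _ cvgNl cvgl).
near=> h.
have h0 : h != 0 by near: h; exact: nbhs_dnbhs_neq.
have h1 : `|h| <= 1 by near: h; exact: dnbhs0_le.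
rewrite -ler_norml f0 subr0 addr0 /GRing.scale/= mulr1 normrM normfV ler_pdivrMl ?normr_gt0//.
by rewrite (le_trans (fC _ h1))// [leRHS]mulrCA ler_wpM2l// -normrM -expr2 normrX real_normK ?num_real//.
Unshelve. all: by end_near. Qed.

(** The family of all these functions is closed under differentiation, which is why a polynomial
  in [x^-1] is kept in front of [expR (- x^-1)]. *)
Definition flat (p : {poly R}) (x : R) : R :=
  if 0 < x then p.[x^-1] * expR (- x^-1) else 0.

Lemma is_derive_flat p x : is_derive x (1 : R) (flat p) (flat ('X^2 * (p - p^`())) x).
Proof.
have [x0|x0|->] := ltgtP x 0.
- rewrite {2}/flat ltNge (ltW x0)/=.
  apply: (@near_eq_is_derive _ _ _ (fun=> 0)).
  by near=> y; rewrite /flat ltNge ltW//=; near: y; exact: lt_nbhsl.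
- rewrite {2}/flat x0.
  apply: (@near_eq_is_derive R R R (fun x : R => p.[x^-1] * expR (- x^-1))).
    by near=> y; rewrite /flat ifT//; near: y; exact: lt_nbhsr.
  have xn0 : x != 0 by rewrite gt_eqF.
  have dV : is_derive x (1 : R) (fun y : R => y^-1) (- x ^- 2).
    have := @is_deriveV R id x 1 1 xn0 (is_derive_id _ _).
    by rewrite /GRing.scale/= mulr1.
  have dp := is_derive1_comp (is_derive_poly p x^-1) dV.
  have dNV : is_derive x (1 : R) (fun y : R => - y^-1) (- - x ^- 2) by exact: is_deriveN.
  have de := @is_derive1_comp _ expR (fun y : R => - y^-1) _ _ _ (is_derive_expR (- x^-1)) dNV.
  have := is_deriveM dp de.
  move=> h; apply: (is_derive_eq h).
  rewrite /GRing.scale/= hornerM hornerD hornerN hornerXn; field; exact: xn0.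
- rewrite {2}/flat ltxx.
  have [C C0 HC] := horner_expRN_le p.
  apply: (@is_derive_quadratic _ C); first by rewrite /flat ltxx.
  move=> y y1; rewrite /flat; case: ifPn => [y0|_].
    by apply: HC => //; rewrite -(ger0_norm (ltW y0)).
  by rewrite normr0 mulr_ge0// sqr_ge0.
Unshelve. all: by end_near. Qed.

Lemma sm1_flat p : sm (@line_chart R) (flat p).
Proof.
apply: derivable_sequence_sm1.
by exists (fun n => flat (iter n (fun q => 'X^2 * (q - q^`())) p)) => // n x; exact: is_derive_flat.
Qed.

Definition bump (x : R) := flat 1 x * flat 1 (1 - x).

Lemma sm1_bump : sm (@line_chart R) bump.
Proof.
have s1 : sm (@line_chart R) (fun x => 1 - x).
  rewrite (_ : (fun x => 1 - x) = fun x : R => 1 + (-1) * line_chart tt x); last first.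
    by apply/funext => x; rewrite mulN1r.
  apply: sm_add; first exact: sm_cst.
  by apply: sm_mul; [exact: sm_cst|exact: sm_crd].
exact: sm_mul (sm1_flat 1) (sm_of_sm1 (sm1_flat 1) s1).
Qed.

Lemma bump_out x : (x <= 0) || (1 <= x) -> bump x = 0.
Proof.
rewrite /bump /flat; case/orP => h.
  by rewrite ltNge h/= mul0r.
by rewrite subr_gt0 [X in _ * (if X then _ else _)]ltNge h/= mulr0.
Qed.

(** A lower bound on an interval is what makes the energies of the profiles positive. *)
Lemma bump_gt0 : exists2 d : R, 0 < d & forall x, 4^-1 <= x -> x <= 1 - 4^-1 -> d <= bump x.
Proof.
have e0 : 0 < expR (- 4 : R) by exact: expR_gt0.
have key x : 4^-1 <= x -> expR (- 4 : R) <= flat 1 x.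
  move=> hx; have x0 : 0 < x by rewrite (lt_le_trans _ hx)// invr_gt0.
  rewrite /flat x0 hornerC mul1r ler_expR lerN2 -[leRHS]invrK lef_pV2// posrE.
  by rewrite invr_gt0.
exists (expR (- 4) * expR (- 4)) => [|x x1 x2]; first exact: mulr_gt0.
rewrite /bump ler_pM ?(ltW e0)//; first exact: key.
by apply: key; rewrite lerBrDl -lerBrDr.
Qed.

End Bump.

(** * Complex-valued smooth functions *)

Section ComplexParts.
Variable R : realType.
Implicit Types x y : R[i].

Lemma ReD x y : complex.Re (x + y) = complex.Re x + complex.Re y.
Proof. by case: x y => ? ? [? ?]. Qed.
Lemma ImD x y : complex.Im (x + y) = complex.Im x + complex.Im y.
Proof. by case: x y => ? ? [? ?]. Qed.
Lemma ReN x : complex.Re (- x) = - complex.Re x.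
Proof. by case: x. Qed.
Lemma ImN x : complex.Im (- x) = - complex.Im x.
Proof. by case: x. Qed.
Lemma ReM x y : complex.Re (x * y) =
  complex.Re x * complex.Re y - complex.Im x * complex.Im y.
Proof. by case: x y => ? ? [? ?]. Qed.
Lemma ImM x y : complex.Im (x * y) =
  complex.Re x * complex.Im y + complex.Im x * complex.Re y.
Proof. by case: x y => ? ? [? ?]. Qed.
Lemma complex_ext x y : complex.Re x = complex.Re y -> complex.Im x = complex.Im y -> x = y.
Proof. by case: x y => ? ? [? ?] /= -> ->. Qed.

Definition sqn x : R := complex.Re x ^+ 2 + complex.Im x ^+ 2.

Lemma sqn_ge0 x : 0 <= sqn x. Proof. by rewrite addr_ge0 ?sqr_ge0. Qed.
Lemma sqnM x y : sqn (x * y) = sqn x * sqn y.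
Proof. by rewrite /sqn ReM ImM; ring. Qed.
Lemma sqn_real (a : R) : sqn a%:C%C = a ^+ 2.
Proof. by rewrite /sqn /= expr0n addr0. Qed.
Lemma sqn0 : sqn 0 = 0. Proof. by rewrite /sqn/= expr0n addr0. Qed.
Lemma sqnX x n : sqn (x ^+ n) = sqn x ^+ n.
Proof. by elim: n => [|n ih]; rewrite ?expr0 ?sqn_real ?expr1n ?exprS ?sqnM ?ih//; rewrite /sqn/= expr1n expr0n addr0. Qed.
Lemma sqnD_le x y : sqn (x + y) <= 2 * sqn x + 2 * sqn y.
Proof.
rewrite /sqn ReD ImD -subr_ge0.
set a := complex.Re x; set b := complex.Re y; set c := complex.Im x; set d := complex.Im y.
rewrite (_ : _ - _ = (a - b) ^+ 2 + (c - d) ^+ 2); last by ring.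
by rewrite addr_ge0 ?sqr_ge0.
Qed.
Lemma sqn_normc x : sqn x = Normc.normc x ^+ 2.
Proof. by case: x => a b; rewrite /sqn/= sqr_sqrtr// addr_ge0 ?sqr_ge0. Qed.

End ComplexParts.

Section ComplexSmooth.
Variables (R : realType) (V : normedModType R) (I : Type) (crd : I -> V -> R).
Hypothesis crdP : linear_chart crd.
Local Notation C := R[i].
Implicit Types F G : V -> C.

Definition csm F :=
  sm crd (fun z => complex.Re (F z)) /\ sm crd (fun z => complex.Im (F z)).

Definition cdir (v : V) F : V -> C := fun z =>
  Complex (dird v (fun z => complex.Re (F z)) z) (dird v (fun z => complex.Im (F z)) z).

Lemma sm_opp f : sm crd f -> sm crd (fun z => - f z).
Proof.
move=> sf; rewrite (_ : (fun z => - f z) = fun z => (-1) * f z).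
  by apply: sm_mul => //; exact: sm_cst.
by apply/funext => z; rewrite mulN1r.
Qed.

Lemma sm_sub f g : sm crd f -> sm crd g -> sm crd (fun z => f z - g z).
Proof. by move=> sf sg; apply: sm_add => //; exact: sm_opp. Qed.

Lemma dirdN v f : sm crd f -> dird v (fun z => - f z) = fun z => - dird v f z.
Proof.
move=> sf; rewrite (_ : (fun z => - f z) = fun z => (-1) * f z); last first.
  by apply/funext => z; rewrite mulN1r.
rewrite (dirdM crdP)//; last exact: sm_cst.
by rewrite dird_cst; apply/funext => z; ring.
Qed.

Lemma dirdB v f g : sm crd f -> sm crd g ->
  dird v (fun z => f z - g z) = fun z => dird v f z - dird v g z.
Proof.
move=> sf sg; rewrite (dirdD crdP) ?dirdN//; exact: sm_opp.
Qed.

Lemma csm_cst c : csm (fun=> c).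
Proof. by split; exact: sm_cst. Qed.

Lemma csm_real f : sm crd f -> csm (fun z => (f z)%:C%C).
Proof. by move=> sf; split => //=; exact: sm_cst. Qed.

Lemma csmD F G : csm F -> csm G -> csm (fun z => F z + G z).
Proof.
move=> [F1 F2] [G1 G2]; split.
- by under eq_fun do rewrite ReD; exact: sm_add.
- by under eq_fun do rewrite ImD; exact: sm_add.
Qed.

Lemma csmM F G : csm F -> csm G -> csm (fun z => F z * G z).
Proof.
move=> [F1 F2] [G1 G2]; split.
- by under eq_fun do rewrite ReM; apply: sm_sub; exact: sm_mul.
- by under eq_fun do rewrite ImM; apply: sm_add; exact: sm_mul.
Qed.

Lemma csmX F n : csm F -> csm (fun z => F z ^+ n).
Proof.
move=> sF; elim: n => [|n ih].
  by under eq_fun do rewrite expr0; exact: csm_cst.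
by under eq_fun do rewrite exprS; exact: csmM.
Qed.

Lemma csm_cdir v F : csm F -> csm (cdir v F).
Proof. by move=> [F1 F2]; split; exact: sm_dird. Qed.

Lemma cdir_cst v c : cdir v (fun=> c) = fun=> 0.
Proof. by apply/funext => z; rewrite /cdir !dird_cst. Qed.

Lemma cdir_real v f : sm crd f -> cdir v (fun z => (f z)%:C%C) = fun z => (dird v f z)%:C%C.
Proof. by move=> sf; apply/funext => z; rewrite /cdir/= !dird_cst. Qed.

Lemma cdirD v F G : csm F -> csm G ->
  cdir v (fun z => F z + G z) = fun z => cdir v F z + cdir v G z.
Proof.
move=> [F1 F2] [G1 G2]; apply/funext => z; apply: complex_ext; rewrite ?ReD ?ImD /cdir/=.
- by under eq_fun do rewrite ReD; rewrite (dirdD crdP).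
- by under eq_fun do rewrite ImD; rewrite (dirdD crdP).
Qed.

Lemma cdirM v F G : csm F -> csm G ->
  cdir v (fun z => F z * G z) = fun z => F z * cdir v G z + cdir v F z * G z.
Proof.
move=> [F1 F2] [G1 G2]; apply/funext => z; apply: complex_ext.
- rewrite ReD !ReM /cdir/=; under eq_fun do rewrite ReM.
  by rewrite dirdB ?(dirdM crdP)//; [ring|exact: sm_mul|exact: sm_mul].
- rewrite ImD !ImM /cdir/=; under eq_fun do rewrite ImM.
  by rewrite (dirdD crdP) ?(dirdM crdP)//; [ring|exact: sm_mul|exact: sm_mul].
Qed.

Lemma cdirZ v c F : csm F -> cdir v (fun z => c * F z) = fun z => c * cdir v F z.
Proof.
move=> sF; rewrite cdirM//; last exact: csm_cst.
by rewrite cdir_cst; apply/funext => z; ring.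
Qed.

Lemma cdirX v F n : csm F ->
  cdir v (fun z => F z ^+ n) = fun z => n%:R * F z ^+ n.-1 * cdir v F z.
Proof.
move=> sF; elim: n => [|n ih].
  by under eq_fun do rewrite expr0; rewrite cdir_cst; apply/funext => z; ring.
under eq_fun do rewrite exprS; rewrite cdirM ?ih//; last exact: csmX.
apply/funext => z; case: n {ih} => [|n] /=.
  by rewrite expr0; ring.
by rewrite exprS; ring.
Qed.

End ComplexSmooth.

Section ComplexComposition.
Variables (R : realType) (V : normedModType R) (I : Type) (crd : I -> V -> R).
Hypothesis crdP : linear_chart crd.

Lemma csm_comp (b : R -> R[i]) f : csm (@line_chart R) b -> sm crd f ->
  csm crd (fun z => b (f z)).
Proof.
move=> [b1 b2] sf; split; first exact: (sm_of_sm1 b1 sf).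
exact: (sm_of_sm1 b2 sf).
Qed.

Lemma cdir_comp v (b : R -> R[i]) f : csm (@line_chart R) b -> sm crd f ->
  cdir v (fun z => b (f z)) = fun z => cdir (1 : R) b (f z) * (dird v f z)%:C%C.
Proof.
move=> [b1 b2] sf; apply/funext => z; apply: complex_ext; rewrite ?ReM ?ImM /cdir/=.
- rewrite (dird_comp crdP v (sm1_derivable_sequence b1) sf) dird1E; ring.
- rewrite (dird_comp crdP v (sm1_derivable_sequence b2) sf) dird1E; ring.
Qed.

End ComplexComposition.

(** * Potentials with one time frequency and one angular frequency *)

Section Potentials.
Variables (R : realType) (T : R) (k : int).
Local Notation C := R[i].
Local Notation csm1 := (csm (@line_chart R)).
Local Notation csm4 := (csm (@spacetime_chart R)).
Local Notation sm4 := (sm (@spacetime_chart R)).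
Local Notation i := (Complex (0 : R) 1).
Let crdP := @spacetime_chartP R.
Let lineP := @line_chartP R.

Definition frequency : R := 2 * pi / T * k%:~R.

Definition D1 (b : R -> C) : R -> C := cdir (1 : R) b.
Definition Dt4 (F : spacetime R -> C) := cdir (direction R None) F.
Definition Dx4 (j : 'I_3) (F : spacetime R -> C) := cdir (direction R (Some j)) F.

Lemma dird_coordinate j l :
  dird (direction R (Some j)) (spacetime_chart (Some l)) = fun=> (j == l)%:R.
Proof.
rewrite (dird_crd crdP); apply/funext => z /=.
by elim/ord3_ind : j; elim/ord3_ind : l.
Qed.

Lemma dird_coordinate_t l :
  dird (direction R None) (spacetime_chart (Some l)) = fun=> 0.
Proof. by rewrite (dird_crd crdP); apply/funext => z /=; elim/ord3_ind : l. Qed.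

Lemma dird_time : dird (direction R None) (@spacetime_chart R None) = fun=> 1.
Proof. by rewrite (dird_crd crdP). Qed.

Lemma dird_time_x j : dird (direction R (Some j)) (@spacetime_chart R None) = fun=> 0.
Proof. by rewrite (dird_crd crdP). Qed.

Lemma csm1_wave (a : R) : csm1 (fun t => Complex (cos (a * t)) (sin (a * t))).
Proof.
have s : sm (@line_chart R) (fun t => a * t).
  by apply: sm_mul; [exact: sm_cst | exact: (sm_crd _ tt)].
by split => /=; apply: sm_of_sm1 s; [exact: sm1_cos | exact: sm1_sin].
Qed.

Lemma derive1_cos (x : R) : derive1 cos x = - sin x.
Proof. by rewrite derive1E derive_val. Qed.
Lemma derive1_sin (x : R) : derive1 sin x = cos x.
Proof. by rewrite derive1E derive_val. Qed.

Lemma D1_wave (a : R) : D1 (fun t => Complex (cos (a * t)) (sin (a * t))) =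
  fun t => i * a%:C%C * Complex (cos (a * t)) (sin (a * t)).
Proof.
have s : sm (@line_chart R) (fun t => a * t).
  by apply: sm_mul; [exact: sm_cst | exact: (sm_crd _ tt)].
have ds : dird (1 : R) (fun t => a * t) = fun=> a.
  rewrite (@dirdM _ _ _ _ lineP 1 (fun=> a) (@line_chart R tt)).
  - by rewrite dird_cst (dird_crd lineP); apply/funext => t; rewrite /line_chart; ring.
  - exact: sm_cst.
  - exact: sm_crd.
have dc := dird_comp lineP 1 (sm1_derivable_sequence (sm1_cos R)) s.
have dn := dird_comp lineP 1 (sm1_derivable_sequence (sm1_sin R)) s.
apply/funext => t; apply: complex_ext; rewrite /D1 /cdir/=.
- by rewrite dc ds derive1_cos; ring.
- by rewrite dn ds derive1_sin; ring.
Qed.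

Lemma sqn_wave (a t : R) : sqn (Complex (cos (a * t)) (sin (a * t))) = 1.
Proof. by rewrite /sqn/= cos2Dsin2. Qed.

Definition time_char : R -> C := fourier_char T k.

Lemma csm1_time_char : csm1 time_char. Proof. exact: csm1_wave. Qed.
Lemma D1_time_char : D1 time_char = fun t => i * frequency%:C%C * time_char t.
Proof. exact: D1_wave. Qed.
Lemma sqn_time_char t : sqn (time_char t) = 1. Proof. exact: sqn_wave. Qed.

Definition x0 (z : spacetime R) : R := spacetime_chart (Some 0) z.
Definition x1 (z : spacetime R) : R := spacetime_chart (Some 1) z.
Definition x2 (z : spacetime R) : R := spacetime_chart (Some 2) z.
Definition planar (z : spacetime R) : C := Complex (x1 z) (x2 z).
Definition rsq (z : spacetime R) : R := x1 z ^+ 2 + x2 z ^+ 2.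

Lemma sm4_x j : sm4 (spacetime_chart (Some j)). Proof. exact: sm_crd. Qed.
Lemma csm4_planar : csm4 planar. Proof. by split; exact: sm4_x. Qed.
Lemma sm4_rsq : sm4 rsq.
Proof. by apply: sm_add; apply: sm_mul; exact: sm4_x. Qed.

Lemma dird_rsq j : dird (direction R (Some j)) rsq =
  fun z => 2 * ((j == 1)%:R * x1 z + (j == 2)%:R * x2 z).
Proof.
have h l := @dirdM _ _ _ _ crdP (direction R (Some j)) _ _ (sm4_x l) (sm4_x l).
rewrite /rsq (@dirdD _ _ _ _ crdP _ (fun z => x1 z ^+ 2) (fun z => x2 z ^+ 2)); try by apply: sm_mul; exact: sm4_x.
rewrite (h 1) (h 2) !dird_coordinate; apply/funext => z; rewrite /x1 /x2; ring.
Qed.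

Lemma dird_rsq_t : dird (direction R None) rsq = fun=> 0.
Proof.
have h l := @dirdM _ _ _ _ crdP (direction R None) _ _ (sm4_x l) (sm4_x l).
rewrite /rsq (@dirdD _ _ _ _ crdP _ (fun z => x1 z ^+ 2) (fun z => x2 z ^+ 2)); try by apply: sm_mul; exact: sm4_x.
rewrite (h 1) (h 2) !dird_coordinate_t; apply/funext => z; rewrite /x1 /x2; ring.
Qed.

Lemma cdir_planar j : Dx4 j planar =
  fun=> Complex ((j == 1)%:R) ((j == 2)%:R).
Proof. by apply/funext => z; rewrite /Dx4 /cdir/= !dird_coordinate. Qed.
Lemma cdir_planar_t : Dt4 planar = fun=> 0.
Proof. by apply/funext => z; rewrite /Dt4 /cdir/= !dird_coordinate_t. Qed.

(** The potential [e^(i kappa k t) b(x_0) (x_1 + i x_2)^m g(x_1^2 + x_2^2)].  Using the polynomial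
  [(x_1 + i x_2)^m] and the squared radius instead of polar coordinates keeps it smooth across the
  axis. *)
Definition pot (m : nat) (b g : R -> C) (z : spacetime R) : C :=
  time_char z.1 * b (x0 z) * (planar z ^+ m * g (rsq z)).

Section Smooth.
Variables (m : nat) (b g : R -> C).
Hypotheses (sb : csm1 b) (sg : csm1 g).

Lemma csm4_time : csm4 (fun z => time_char z.1).
Proof. exact: csm_comp csm1_time_char (sm_crd _ None). Qed.
Lemma csm4_axial (c : R -> C) : csm1 c -> csm4 (fun z => c (x0 z)).
Proof. by move=> sc; exact: csm_comp sc (sm4_x 0). Qed.
Lemma csm4_radial (c : R -> C) : csm1 c -> csm4 (fun z => c (rsq z)).
Proof. by move=> sc; exact: csm_comp sc sm4_rsq. Qed.
Lemma csm4_planarX n : csm4 (fun z => planar z ^+ n).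
Proof. exact: csmX csm4_planar. Qed.

Lemma csm4_pot : csm4 (pot m b g).
Proof.
apply: csmM; apply: csmM; [exact: csm4_time|exact: csm4_axial|exact: csm4_planarX|exact: csm4_radial].
Qed.

Let cdir_axial v (c : R -> C) : csm1 c -> cdir v (fun z => c (x0 z)) = fun z => D1 c (x0 z) * (dird v x0 z)%:C%C.
Proof. move=> sc; exact: (cdir_comp crdP v sc (sm4_x 0)). Qed.
Let cdir_radial v (c : R -> C) : csm1 c -> cdir v (fun z => c (rsq z)) = fun z => D1 c (rsq z) * (dird v rsq z)%:C%C.
Proof. move=> sc; exact: (cdir_comp crdP v sc sm4_rsq). Qed.
Let cdir_time v : cdir v (fun z : spacetime R => time_char z.1) = fun z => i * frequency%:C%C * time_char z.1 * (dird v (@spacetime_chart R None) z)%:C%C.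
Proof. by rewrite (cdir_comp crdP v csm1_time_char (sm_crd _ None)) -/(D1 _) D1_time_char. Qed.

Let cdir_pot v : cdir v (pot m b g) = fun z =>
  time_char z.1 * b (x0 z) *
    (planar z ^+ m * (D1 g (rsq z) * (dird v rsq z)%:C%C) + m%:R * planar z ^+ m.-1 * cdir v planar z * g (rsq z)) +
  (time_char z.1 * (D1 b (x0 z) * (dird v x0 z)%:C%C) + i * frequency%:C%C * time_char z.1 * (dird v (@spacetime_chart R None) z)%:C%C * b (x0 z)) *
    (planar z ^+ m * g (rsq z)).
Proof.
have s1 := csm4_time; have s2 := csm4_axial sb; have s3 := csm4_planarX m; have s4 := csm4_radial sg.
rewrite /pot (cdirM crdP v (csmM s1 s2) (csmM s3 s4)).
rewrite (cdirM crdP v s1 s2) (cdirM crdP v s3 s4) cdir_axial// cdir_radial// cdir_time.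
by rewrite (cdirX crdP v m csm4_planar).
Qed.

Lemma pot_dt : Dt4 (pot m b g) = fun z => i * frequency%:C%C * pot m b g z.
Proof.
rewrite /Dt4 cdir_pot dird_rsq_t dird_time dird_coordinate_t -/(Dt4 planar) cdir_planar_t.
by apply/funext => z; rewrite /pot; ring.
Qed.

Lemma pot_d0 : Dx4 0 (pot m b g) = pot m (D1 b) g.
Proof.
rewrite /Dx4 cdir_pot dird_rsq dird_time_x dird_coordinate -/(Dx4 _ planar) cdir_planar.
apply/funext => z; rewrite /pot/= !mul0r addr0 mulr0.
by rewrite (_ : Complex 0 0 = 0)//; ring.
Qed.

Lemma pot_d1 : Dx4 1 (pot m b g) =
  fun z => m%:R * pot m.-1 b g z + 2 * (x1 z)%:C%C * pot m b (D1 g) z.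
Proof.
rewrite /Dx4 cdir_pot dird_rsq dird_time_x dird_coordinate -/(Dx4 _ planar) cdir_planar.
apply/funext => z; rewrite /pot/= mul0r addr0 mul1r.
by rewrite (_ : Complex 1 0 = 1)//; ring.
Qed.

Lemma pot_d2 : Dx4 2 (pot m b g) =
  fun z => m%:R * i * pot m.-1 b g z + 2 * (x2 z)%:C%C * pot m b (D1 g) z.
Proof.
rewrite /Dx4 cdir_pot dird_rsq dird_time_x dird_coordinate -/(Dx4 _ planar) cdir_planar.
apply/funext => z; rewrite /pot/= mul0r add0r mul1r.
by rewrite -/i; ring.
Qed.

End Smooth.

Lemma csm1_D1 b : csm1 b -> csm1 (D1 b).
Proof. by move=> sb; apply: csm_cdir. Qed.

Lemma potMplanar m b g z : planar z * pot m b g z = pot m.+1 b g z.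
Proof. by rewrite /pot exprS; ring. Qed.

Lemma planarE z : planar z = (x1 z)%:C%C + i * (x2 z)%:C%C.
Proof. by apply: complex_ext; rewrite ?ReD ?ImD ?ReM ?ImM /=; ring. Qed.

Lemma ii : i * i + 1 = 0 :> C.
Proof. by apply: complex_ext; rewrite ?ReD ?ImD ?ReM ?ImM/=; ring. Qed.

(** The angular derivative: the factor [g] is invariant under rotations about the axis and
  [(x_1 + i x_2)^m] is [r^m e^(i m alpha)] in polar coordinates. *)
Lemma pot_angular m b g z : csm1 b -> csm1 g ->
  (x1 z)%:C%C * Dx4 2 (pot m b g) z - (x2 z)%:C%C * Dx4 1 (pot m b g) z =
  m%:R * i * pot m b g z.
Proof.
move=> sb sg; rewrite pot_d1// pot_d2//; case: m => [|m] /=; first by ring.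
rewrite -(potMplanar m b g) planarE.
have := ii; set P := pot _ _ _ _; set Q := pot _ _ _ _; move: (i) (x1 z)%:C%C (x2 z)%:C%C => j y w hj.
apply/eqP; rewrite -subr_eq0 (_ : _ - _ = - (m.+1%:R * w * P) * (j * j + 1)); last by ring.
by rewrite hj mulr0.
Qed.

(** The planar Laplacian preserves the form [(x_1 + i x_2)^m g(q)], [q = x_1^2 + x_2^2], and acts
  on [g] by this second-order operator in [q]. *)
Definition radial_laplacian (m : nat) (g : R -> C) : R -> C :=
  fun q => 4 * m.+1%:R * D1 g q + 4 * q%:C%C * D1 (D1 g) q.

Lemma csm1_radial_laplacian m g : csm1 g -> csm1 (radial_laplacian m g).
Proof.
move=> sg; have s1 := csm1_D1 sg; have s2 := csm1_D1 s1.
apply: csmD; apply: csmM => //; first exact: csm_cst.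
apply: csmM; first exact: csm_cst.
by apply: csm_real; exact: (sm_crd _ tt).
Qed.

Lemma pot_laplacian m b g z : csm1 b -> csm1 g ->
  Dx4 0 (Dx4 0 (pot m b g)) z + Dx4 1 (Dx4 1 (pot m b g)) z
   + Dx4 2 (Dx4 2 (pot m b g)) z =
  pot m (D1 (D1 b)) g z + pot m b (radial_laplacian m g) z.
Proof.
move=> sb sg; have sb1 := csm1_D1 sb; have sg1 := csm1_D1 sg.
have sp n (c : R -> C) : csm1 c -> csm4 (pot n b c) by move=> sc; exact: csm4_pot.
have sx j : csm4 (fun z => 2 * (spacetime_chart (Some j) z)%:C%C).
  by apply: csmM; [exact: csm_cst|exact/csm_real/sm4_x].
have dx j l : Dx4 j (fun z => 2 * (spacetime_chart (Some l) z)%:C%C) = fun=> 2 * ((j == l)%:R)%:C%C.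
  rewrite /Dx4 (cdirZ crdP); last exact/csm_real/sm4_x.
  by rewrite (cdir_real _ (sm4_x l)) dird_coordinate.
rewrite pot_d0// pot_d0// pot_d1// pot_d2//.
have e1 : Dx4 1 (fun z => m%:R * pot m.-1 b g z + 2 * (x1 z)%:C%C * pot m b (D1 g) z) =
   fun z => m%:R * Dx4 1 (pot m.-1 b g) z + (2 * (x1 z)%:C%C * Dx4 1 (pot m b (D1 g)) z + 2 * pot m b (D1 g) z).
  rewrite /Dx4 (cdirD crdP); [|by apply: csmM; [exact: csm_cst|exact: sp]|by apply: csmM; [exact: sx|exact: sp]].
  rewrite (cdirZ crdP _ _ (sp _ _ sg)) (cdirM crdP _ (sx 1) (sp _ _ sg1)).
  by rewrite -/(Dx4 1 (fun z => 2 * (spacetime_chart (Some 1) z)%:C%C)) dx; apply/funext => w /=; rewrite mulr1.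
have e2 : Dx4 2 (fun z => m%:R * i * pot m.-1 b g z + 2 * (x2 z)%:C%C * pot m b (D1 g) z) =
   fun z => m%:R * i * Dx4 2 (pot m.-1 b g) z + (2 * (x2 z)%:C%C * Dx4 2 (pot m b (D1 g)) z + 2 * pot m b (D1 g) z).
  rewrite /Dx4 (cdirD crdP); [|by apply: csmM; [exact: csm_cst|exact: sp]|by apply: csmM; [exact: sx|exact: sp]].
  rewrite (cdirZ crdP _ _ (sp _ _ sg)) (cdirM crdP _ (sx 2) (sp _ _ sg1)).
  by rewrite -/(Dx4 2 (fun z => 2 * (spacetime_chart (Some 2) z)%:C%C)) dx; apply/funext => w /=; rewrite mulr1.
rewrite e1 e2 !pot_d1// !pot_d2//.
have -> : pot m b (radial_laplacian m g) z =
    4 * m.+1%:R * pot m b (D1 g) z + 4 * (rsq z)%:C%C * pot m b (D1 (D1 g)) z.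
  by rewrite /pot /radial_laplacian; ring.
have -> : (rsq z)%:C%C = (x1 z)%:C%C ^+ 2 + (x2 z)%:C%C ^+ 2 by rewrite /rsq; ring.
case: m sp e1 e2 => [|m] _ _ _ /=; first by ring.
rewrite -(potMplanar m b (D1 g)) planarE -addn1 natrD.
have := ii; set P1 := pot m.-1 b g z.
move: (i) (x1 z)%:C%C (x2 z)%:C%C => j y w hj.
apply/eqP; rewrite -subr_eq0.
rewrite (_ : _ - _ = (m + 1)%:R * m%:R * P1 * (j * j + 1)); last by ring.
by rewrite hj mulr0.
Qed.
End Potentials.

(** * Smooth compactly supported periodic test functions *)

Section MeasurableModulus.
Context d (E : measurableType d) (R : realType).

Lemma measurable_sqn (g : E -> R[i]) : cmeasurable g ->
  measurable_fun setT (fun z => sqn (g z)).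
Proof. by move=> [m1 m2]; apply: measurable_funD; exact: measurable_funX. Qed.

Lemma normcE (x : R[i]) : Normc.normc x = Num.sqrt (sqn x).
Proof. by case: x. Qed.

Lemma measurable_normc (g : E -> R[i]) : cmeasurable g ->
  measurable_fun setT (fun z => Normc.normc (g z)).
Proof.
move=> mg; under eq_fun do rewrite normcE.
have ms : measurable_fun setT (@Num.sqrt R).
  exact: continuous_measurable_fun (@sqrt_continuous R).
exact: measurableT_comp ms (measurable_sqn mg).
Qed.

End MeasurableModulus.

Section TestFunctions.
Variables (R : realType) (T : R).
Hypothesis T_gt0 : 0 < T.
Local Notation sm4 := (sm (@spacetime_chart R)).
Let crdP := @spacetime_chartP R.

Definition box (r : R) : set (space3 R) := [set x | forall j, `|coordinate x j| <= r].

Lemma boxE r : box r = `[- r, r] `*` `[- r, r] `*` `[- r, r].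
Proof.
apply/seteqP; split => [x h|[[a b] c] [[/= h1 h2] h3] j].
  by split; [split|]; rewrite /= in_itv/= -ler_norml; [exact: (h 0)|exact: (h 1)|exact: (h 2)].
by elim/ord3_ind : j; rewrite ler_norml -[_ && _]/(_ \in `[- r, r]).
Qed.

Lemma compact_box r : compact (box r).
Proof.
by rewrite boxE; apply: compact_setX; [apply: compact_setX|]; exact: segment_compact.
Qed.

Lemma measurable_box r : measurable (box r).
Proof. by rewrite boxE; apply: measurableX => //; exact: measurableX. Qed.

Definition bounded_support (Q : spacetime R -> R) :=
  exists r, forall t x, ~ box r x -> Q (t, x) = 0.

Definition smooth_test (Q : spacetime R -> R) :=
  [/\ sm4 Q, Defs.periodic T Q & bounded_support Q].

Lemma smooth_test_test_function Q : smooth_test Q -> test_function T Q.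
Proof.
move=> [sQ pQ [r Qr]]; split => //; first exact: sm4_smooth.
by exists (box r) => //; exact: compact_box.
Qed.

(** Derivatives keep the support because each point outside the box has a neighbourhood outside
  the box. *)
Lemma smooth_test_dird v Q : smooth_test Q -> smooth_test (dird v Q).
Proof.
move=> [sQ pQ [r Qr]]; split; first exact: sm_dird.
- move=> t x; rewrite dird.unlock /derive.
  suff -> : (fun h : R => h^-1 *: ((Q \o shift (t + T, x)) (h *: v) - Q (t + T, x))) =
            (fun h : R => h^-1 *: ((Q \o shift (t, x)) (h *: v) - Q (t, x))) by [].
  apply/funext => h /=; congr (_ *: (_ - _)); last exact: pQ.
  by rewrite -[RHS]pQ; congr Q; congr pair; exact: addrA.
- exists r => t x xr; rewrite dird.unlock.
  have [j xj] : exists j, r < `|coordinate x j|.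
    by apply/not_existsP => h; apply: xr => j; rewrite leNgt; apply/negP/h.
  have cj : continuous (spacetime_chart (Some j)) := (crdP (Some j)).2.
  have : \forall z \near ((t, x) : spacetime R), r < `|spacetime_chart (Some j) z|.
    have := @cvg_norm _ _ _ _ _ _ _ (cj (t, x)).
    by move=> /(_ _) h; apply: (cvgr_gt _ h); exact: xj.
  move=> hn; rewrite (@near_eq_derive _ _ _ Q (fun=> 0) _ v); last first.
    near=> z.
    have : r < `|spacetime_chart (Some j) z| by near: z.
    by move=> ry; rewrite [z]surjective_pairing Qr// => /(_ j); rewrite leNgt ry.
  exact: (@derive_cst _ _ R 0 v).
Unshelve. all: by end_near. Qed.

Lemma smooth_test_chart j Q : smooth_test Q ->
  smooth_test (fun z => spacetime_chart (Some j) z * Q z).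
Proof.
move=> [sQ pQ [r Qr]]; split; first by apply: sm_mul => //; exact: sm_crd.
- by move=> t x /=; rewrite pQ.
- by exists r => t x xr; rewrite Qr ?mulr0.
Qed.

Lemma smooth_testZ c Q : smooth_test Q -> smooth_test (fun z => c * Q z).
Proof.
move=> [sQ pQ [r Qr]]; split; first by apply: sm_mul => //; exact: sm_cst.
- by move=> t x /=; rewrite pQ.
- by exists r => t x xr; rewrite Qr ?mulr0.
Qed.

Lemma smooth_testN Q : smooth_test Q -> smooth_test (fun z => - Q z).
Proof.
by move=> /(smooth_testZ (-1)); under eq_fun do rewrite mulN1r.
Qed.

Lemma box_sub r s x : r <= s -> box r x -> box s x.
Proof. by move=> rs h j; apply: le_trans rs. Qed.

Lemma smooth_testD P Q : smooth_test P -> smooth_test Q ->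
  smooth_test (fun z => P z + Q z).
Proof.
move=> [sP pP [r Pr]] [sQ pQ [s Qs]]; split; first exact: sm_add.
- by move=> t x /=; rewrite pP pQ.
- exists (Num.max r s) => t x xr; rewrite Pr ?Qs ?addr0//.
  + by apply: contra_not xr; apply: box_sub; rewrite le_max lexx orbT.
  + by apply: contra_not xr; apply: box_sub; rewrite le_max lexx.
Qed.

Lemma smooth_testB P Q : smooth_test P -> smooth_test Q ->
  smooth_test (fun z => P z - Q z).
Proof. by move=> tP tQ; apply: smooth_testD => //; exact: smooth_testN. Qed.

Let D : set (spacetime R) := period_domain T setT.

Lemma measurable_period K : measurable K -> measurable (period_domain T K).
Proof. by move=> mK; exact: measurableX. Qed.

Lemma smooth_test_bounded Q : smooth_test Q ->
  exists r C, [/\ 0 <= C, forall t x, ~ box r x -> Q (t, x) = 0 &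
    forall z, D z -> `|Q z| <= C].
Proof.
move=> [sQ pQ [r Qr]].
pose s := Num.max r 0.
have Qs t x : ~ box s x -> Q (t, x) = 0.
  by move=> h; apply: Qr; apply: contra_not h; apply: box_sub; rewrite le_max lexx.
have cA : compact (`[0, T] `*` box s).
  by apply: compact_setX; [exact: segment_compact|exact: compact_box].
have A0 : (`[0, T] `*` box s) !=set0.
  exists (0, ((0, 0), 0)); split => /=; first by rewrite in_itv/= lexx ltW.
  by move=> j; elim/ord3_ind : j; rewrite normr0 le_max lexx orbT.
have cQ : continuous (fun z => `|Q z|).
  move=> z; apply: cvg_norm.
  exact/differentiable_continuous/(sm_differentiable crdP _ sQ).
have [c _ hc] := compact_EVT_max A0 cA (continuous_subspaceT cQ).
exists s, `|Q c|; split => // -[t x] [/= tT _].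
have [bx|nbx] := pselect (box s x); last by rewrite Qs// normr0.
by apply: hc; rewrite inE.
Qed.

(** Integrability on bounded boxes over one period, which is all that pairing with test functions
  requires. *)
Definition loc_integrable (v : spacetime R -> R) :=
  measurable_fun setT v /\ forall r,
    (\int[leb_spacetime R]_(z in period_domain T (box r)) (`|v z|)%:E < +oo)%E.

Lemma L1loc_ReIm u : L1loc T u ->
  loc_integrable (fun z => complex.Re (u z)) /\ loc_integrable (fun z => complex.Im (u z)).
Proof.
move=> [pu [m1 m2] iu].
have mn := measurable_normc (conj m1 m2).
have key (v : spacetime R -> R) : measurable_fun setT v ->
    (forall z, `|v z| <= Normc.normc (u z)) -> loc_integrable v.
  move=> mv vu; split => // r; apply: (le_lt_trans _ (iu _ (compact_box (r:=r)))).
  apply: ge0_le_integral => //.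
  - exact (measurable_period (measurable_box r)).
  - by apply/measurable_EFinP; apply: measurable_funTS; apply: measurableT_comp.
  - by apply/measurable_EFinP; apply: measurable_funTS.
  - by move=> z _; rewrite lee_fin.
split; apply: key => // z; case: (u z) => a b /=; rewrite -sqrtr_sqr ler_sqrt ?addr_ge0 ?sqr_ge0//.
- by rewrite lerDl sqr_ge0.
- by rewrite lerDr sqr_ge0.
Qed.

Lemma loc_integrable_test v Q : loc_integrable v -> smooth_test Q ->
  (leb_spacetime R).-integrable D (EFin \o (fun z => v z * Q z)).
Proof.
move=> [mv iv] tQ; have [r [C [C0 Qr QC]]] := smooth_test_bounded tQ.
have mD : measurable D by exact: measurable_period.
have mB : measurable (period_domain T (box r)) by exact (measurable_period (measurable_box r)).
have mQ : measurable_fun setT Q by case: tQ => sQ _ _; exact: sm4_measurable.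
have iB : (leb_spacetime R).-integrable (period_domain T (box r)) (EFin \o (fun z => C * v z)).
  rewrite (_ : EFin \o _ = (fun z => C%:E * (EFin \o v) z)%E); last first.
    by apply/funext => z /=; rewrite EFinM.
  apply: integrableZl => //; apply/integrableP; split.
    by apply/measurable_EFinP; exact: measurable_funTS.
  exact: iv.
have DB : D `&` period_domain T (box r) = period_domain T (box r).
  by apply/seteqP; split => [z []//|z [h1 h2]]; split.
apply: (@le_integrable _ _ _ (leb_spacetime R) D _ _ ((EFin \o (fun z => C * v z)) \_ (period_domain T (box r)))).
- exact mD.
- by apply/measurable_EFinP; apply: measurable_funTS; exact: measurable_funM.
- move=> [t x] Dz; rewrite patchE; case: ifPn => h /=.
    by rewrite lee_fin !normrM mulrC ler_wpM2r// (le_trans (QC _ Dz))// ler_norm.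
  rewrite Qr ?mulr0 ?normr0//; move: h; rewrite notin_setE; apply: contra_not => bx.
  by case: Dz => Dt _; split.
- apply: (proj1 (@integrable_restrict _ _ _ (leb_spacetime R) _ mB _ mD _)).
  by rewrite DB.
Qed.

Definition pair_int (v Q : spacetime R -> R) : R :=
  \int[leb_spacetime R]_(z in D) (v z * Q z).

Lemma pair_intD v P Q : loc_integrable v -> smooth_test P -> smooth_test Q ->
  pair_int v (fun z => P z + Q z) = pair_int v P + pair_int v Q.
Proof.
move=> iv tP tQ; rewrite /pair_int; under eq_Rintegral do rewrite mulrDr.
by apply: RintegralD; [exact: measurable_period|exact: loc_integrable_test|exact: loc_integrable_test].
Qed.

Lemma pair_intZ v c Q : loc_integrable v -> smooth_test Q ->
  pair_int v (fun z => c * Q z) = c * pair_int v Q.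
Proof.
move=> iv tQ; rewrite /pair_int; under eq_Rintegral do rewrite mulrCA.
by apply: RintegralZl; [exact: measurable_period|exact: loc_integrable_test].
Qed.

Lemma pair_intN v Q : loc_integrable v -> smooth_test Q ->
  pair_int v (fun z => - Q z) = - pair_int v Q.
Proof.
by move=> iv tQ; rewrite -mulN1r -pair_intZ//; under eq_fun do rewrite -mulN1r.
Qed.

End TestFunctions.

(** * Eliminating the pressure and the velocity *)

Section Duality.
Variables (R : realType) (T lambda omega : R).
Hypothesis T_gt0 : 0 < T.
Local Notation C := R[i].
Let crdP := @spacetime_chartP R.
Local Notation ds j := (dird (direction R (Some j))).
Local Notation dtime := (dird (direction R None)).
Local Notation test := (smooth_test T).
Local Notation "<| v , Q |>" := (pair_int T v Q) (at level 0, v at level 60).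

Definition angular (Q : spacetime R -> R) : spacetime R -> R :=
  fun z => x1 z * ds 2 Q z - x2 z * ds 1 Q z.

(** The transpose of [d_t + omega R] on scalar potentials; [oseen] is the transpose of the
  remaining terms [- Laplacian - lambda d_0] of the system. *)
Definition transport (Q : spacetime R -> R) : spacetime R -> R :=
  fun z => - dtime Q z + omega * angular Q z.

Definition oseen (Q : spacetime R -> R) : spacetime R -> R :=
  fun z => - (ds 0 (ds 0 Q) z + ds 1 (ds 1 Q) z + ds 2 (ds 2 Q) z) + lambda * ds 0 Q z.

Lemma test_angular Q : test Q -> test (angular Q).
Proof.
by move=> tQ; apply: smooth_testB; apply: smooth_test_chart => //; exact: smooth_test_dird.
Qed.

Lemma test_transport Q : test Q -> test (transport Q).
Proof.
move=> tQ; apply: smooth_testD; first by apply/smooth_testN/smooth_test_dird.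
by apply: smooth_testZ; exact: test_angular.
Qed.

Lemma test_oseen Q : test Q -> test (oseen Q).
Proof.
move=> tQ; have td v P : test P -> test (dird v P) := @smooth_test_dird R T v P.
apply: smooth_testD; last by apply: smooth_testZ; auto.
by apply: smooth_testN; apply: smooth_testD; [apply: smooth_testD|]; auto.
Qed.

Lemma test_sm Q : test Q -> sm (@spacetime_chart R) Q. Proof. by case. Qed.

Lemma dird_chartM j l Q : test Q -> ds j (fun z => spacetime_chart (Some l) z * Q z) =
  fun z => spacetime_chart (Some l) z * ds j Q z + (j == l)%:R * Q z.
Proof.
move=> tQ; rewrite (dirdM crdP _ (sm4_x R l) (test_sm tQ)) dird_coordinate.
by apply/funext => z; ring.
Qed.

(** In divergence form the angular derivative differentiates the weighted test functions
  [- x_2 Q] and [x_1 Q]; the weights do not depend on the variable of differentiation. *)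
Lemma pair_angular v Q : loc_integrable T v -> test Q ->
  <| v, ds 1 (fun z => - x2 z * Q z) |> + <| v, ds 2 (fun z => x1 z * Q z) |> = <| v, angular Q |>.
Proof.
move=> iv tQ; have td w P : test P -> test (dird w P) := @smooth_test_dird R T w P.
have tx l P : test P -> test (fun z => spacetime_chart (Some l) z * P z) := @smooth_test_chart _ _ l P.
rewrite -(pair_intD T_gt0 iv); [|apply: td|apply: td]; first last.
- exact: tx.
- by under eq_fun do rewrite mulNr; apply: smooth_testN; exact: tx.
congr pair_int; apply/funext => z.
rewrite [in X in X + _](_ : (fun z => - x2 z * Q z) = fun z => - (spacetime_chart (Some 2) z * Q z)); last first.
  by apply/funext => w; rewrite mulNr.
rewrite (dirdN crdP); last exact/test_sm/tx.
rewrite (dird_chartM 1 2 tQ) (dird_chartM 2 1 tQ) /angular /x1 /x2 /=; ring.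
Qed.

(** The pairing of the field [(v0, v1, v2)] with the rotated gradient [(0, d_2 Q, - d_1 Q)]. *)
Definition gpair (v1 v2 Q : spacetime R -> R) : R :=
  <| v1, ds 2 Q |> - <| v2, ds 1 Q |>.

Section RealSystem.
Variables (u1 u2 p f1 f2 a1 a2 : spacetime R -> R).
Hypotheses (iu1 : loc_integrable T u1) (iu2 : loc_integrable T u2).
Hypothesis ha1 : forall Q, test Q ->
  <| a1, Q |> = <| u1, transport Q |> - omega * <| u2, Q |>.
Hypothesis ha2 : forall Q, test Q ->
  <| a2, Q |> = <| u2, transport Q |> + omega * <| u1, Q |>.
Hypothesis hf1 : forall Q, test Q ->
  <| f1, Q |> = <| a1, Q |> + <| u1, oseen Q |> - <| p, ds 1 Q |>.
Hypothesis hf2 : forall Q, test Q ->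
  <| f2, Q |> = <| a2, Q |> + <| u2, oseen Q |> - <| p, ds 2 Q |>.

Let td w P : test P -> test (dird w P) := @smooth_test_dird R T w P.
Let tx l P : test P -> test (fun z => spacetime_chart (Some l) z * P z) := @smooth_test_chart _ _ l P.

Let dD v P Q : test P -> test Q -> dird v (fun z => P z + Q z) = fun z => dird v P z + dird v Q z.
Proof. by move=> tP tQ; exact (dirdD crdP v (test_sm tP) (test_sm tQ)). Qed.
Let dN v P : test P -> dird v (fun z => - P z) = fun z => - dird v P z.
Proof. by move=> tP; exact (dirdN crdP v (test_sm tP)). Qed.
Let dZ v c P : test P -> dird v (fun z => c * P z) = fun z => c * dird v P z.
Proof.
move=> tP; rewrite (dirdM crdP v (sm_cst _ c) (test_sm tP)) dird_cst.
by apply/funext => z; ring.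
Qed.
Let dC v w Q : test Q -> dird v (dird w Q) = dird w (dird v Q).
Proof. by move=> tQ; exact (dirdC crdP v w (test_sm tQ)). Qed.

Let ds_angular j Q : test Q ->
  ds j (angular Q) = fun z => angular (ds j Q) z + (j == 1)%:R * ds 2 Q z - (j == 2)%:R * ds 1 Q z.
Proof.
move=> tQ; have t1 := td (direction R (Some 1)) tQ; have t2 := td (direction R (Some 2)) tQ.
rewrite /angular dD ?dN; [|exact: tx|exact: tx|exact/smooth_testN/tx].
rewrite (dird_chartM j 1 t2) (dird_chartM j 2 t1) (dC _ _ tQ) (dC _ (direction R (Some 1)) tQ).
by apply/funext => z; ring.
Qed.

Let ds_transport j Q : test Q ->
  ds j (transport Q) = fun z => transport (ds j Q) z + omega * ((j == 1)%:R * ds 2 Q z - (j == 2)%:R * ds 1 Q z).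
Proof.
move=> tQ; have tA := test_angular tQ; have tT := td (direction R None) tQ.
rewrite {1}/transport dD; [|exact: smooth_testN|exact: smooth_testZ].
rewrite dN// dZ// ds_angular// (dC _ _ tQ); apply/funext => z; rewrite /transport; ring.
Qed.

Let ds_oseen j Q : test Q -> ds j (oseen Q) = oseen (ds j Q).
Proof.
move=> tQ; have d2 l : test (ds l (ds l Q)) by auto.
rewrite /oseen dD; [|by apply: smooth_testN; apply: smooth_testD => //; exact: smooth_testD|by apply: smooth_testZ; auto].
rewrite dN; last by apply: smooth_testD => //; exact: smooth_testD.
rewrite dD//; last exact: smooth_testD.
rewrite dD// dZ; last by auto.
have e l : ds j (ds l (ds l Q)) = ds l (ds l (ds j Q)).
  by rewrite (dC (direction R (Some j))) 1?(dC (direction R (Some j)) (direction R (Some l)) tQ); auto.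
by rewrite !e (dC (direction R (Some j)) (direction R (Some 0)) tQ).
Qed.

(** The zero-order part [e_1 /\ u] of the rotation compensates for the commutators of the
  planar derivatives with the angular derivative: rotations preserve the rotated gradient. *)
Lemma gpair_transport Q : test Q -> gpair a1 a2 Q = gpair u1 u2 (transport Q).
Proof.
move=> tQ; have t1 := td (direction R (Some 1)) tQ; have t2 := td (direction R (Some 2)) tQ.
rewrite /gpair ha1// ha2// !ds_transport//.
rewrite (_ : (fun z => transport (ds 2 Q) z + _) = fun z => transport (ds 2 Q) z + (- omega) * ds 1 Q z); last first.
  by apply/funext => z /=; ring.
rewrite (_ : (fun z => transport (ds 1 Q) z + _) = fun z => transport (ds 1 Q) z + omega * ds 2 Q z); last first.
  by apply/funext => z /=; ring.
rewrite (pair_intD T_gt0 iu1 (test_transport t2) (smooth_testZ _ t1)).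
rewrite (pair_intD T_gt0 iu2 (test_transport t1) (smooth_testZ _ t2)).
by rewrite (pair_intZ T_gt0 _ iu1 t1) (pair_intZ T_gt0 _ iu2 t2); ring.
Qed.

(** The pressure drops out because the second derivatives commute, and [u] because both sides are
  the pairing of [u] with the rotated gradient of the same function. *)
Lemma gpair_duality Q X : test Q -> test X ->
  (forall z, transport X z = transport Q z + oseen Q z) ->
  gpair f1 f2 Q = gpair a1 a2 X.
Proof.
move=> tQ tX e.
have t1 := td (direction R (Some 1)) tQ; have t2 := td (direction R (Some 2)) tQ.
rewrite (gpair_transport tX) (_ : transport X = fun z => transport Q z + oseen Q z); last exact/funext.
have -> : gpair f1 f2 Q = gpair a1 a2 Q + gpair u1 u2 (oseen Q).
  rewrite /gpair hf1// hf2// !ds_oseen//.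
  by rewrite (dC (direction R (Some 1)) (direction R (Some 2)) tQ); ring.
have tT := test_transport tQ; have tO := test_oseen tQ.
rewrite gpair_transport// /gpair !(dD _ tT tO).
rewrite (pair_intD T_gt0 iu1 (td _ tT) (td _ tO)) (pair_intD T_gt0 iu2 (td _ tT) (td _ tO)).
ring.
Qed.

End RealSystem.
End Duality.

(** * Testing the distributional system *)

Lemma sum3 (V : nmodType) (F : 'I_3 -> V) : \sum_(j < 3) F j = F 0 + F 1 + F 2.
Proof.
rewrite !big_ord_recl big_ord0 addr0 addrA.
by congr (F _ + F _ + F _); exact: val_inj.
Qed.

Lemma crossE (K : pzRingType) (V : lmodType K) (b : 'I_3 -> V) :
  (cross (e1 K) b 0 = 0) * (cross (e1 K) b 1 = - b 2) * (cross (e1 K) b 2 = b 1).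
Proof.
have e01 : 0 + 1 = 1 :> 'I_3 by exact: val_inj.
have e02 : 0 + 2 = 2 :> 'I_3 by exact: val_inj.
have e11 : 1 + 1 = 2 :> 'I_3 by exact: val_inj.
have e12 : 1 + 2 = 0 :> 'I_3 by exact: val_inj.
have e21 : 2 + 1 = 0 :> 'I_3 by exact: val_inj.
have e22 : 2 + 2 = 1 :> 'I_3 by exact: val_inj.
split; [split|]; rewrite /cross /e1 ?(e01, e02, e11, e12, e21, e22).
- by rewrite !scale0r subr0.
- by rewrite scale0r scale1r sub0r.
- by rewrite scale0r scale1r subr0.
Qed.

Section Equations.
Variables (R : realType) (T lambda omega : R).
Hypothesis T_gt0 : 0 < T.
Local Notation C := R[i].
Local Notation ds j := (dird (direction R (Some j))).
Local Notation dtime := (dird (direction R None)).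
Local Notation test := (smooth_test T).
Local Notation "<| v , Q |>" := (pair_int T v Q) (at level 0, v at level 60).
Local Notation rd := (regular_distrib T).
Variables (f u a : 'I_3 -> spacetime R -> C) (p : spacetime R -> C).
Let U j := rd (u j).

Lemma dtE (Q : spacetime R -> R) : dt Q = dtime Q.
Proof. by rewrite dird.unlock. Qed.
Lemma dxE j (Q : spacetime R -> R) : dx j Q = ds j Q.
Proof. by rewrite dird.unlock. Qed.

Lemma laplacian_eval S Q :
  laplacian S Q = S (ds 0 (ds 0 Q)) + S (ds 1 (ds 1 Q)) + S (ds 2 (ds 2 Q)) :> C.
Proof.
have h j : Dx j (Dx j S) Q = S (ds j (ds j Q)) by rewrite /Dx opprK !dxE.
rewrite /laplacian sum3.
transitivity (Dx 0 (Dx 0 S) Q + Dx 1 (Dx 1 S) Q + Dx 2 (Dx 2 S) Q); first by [].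
by rewrite (h 0) (h 1) (h 2).
Qed.

Lemma e1_cross_xE (x : space3 R) :
  (e1_cross_x 0 x = 0) * (e1_cross_x 1 x = - x.2) * (e1_cross_x 2 x = x.1.2).
Proof. by rewrite /e1_cross_x !crossE. Qed.

Lemma angular_eval j Q :
  (\sum_(k < 3) mulD (@e1_cross_x R k) (Dx k (U j))) Q =
  - (U j (ds 0 (fun=> 0)) + U j (ds 1 (fun z => - x2 z * Q z)) + U j (ds 2 (fun z => x1 z * Q z))).
Proof.
have h k (c : spacetime R -> R) : (fun z => e1_cross_x k z.2 * Q z) = c ->
    mulD (@e1_cross_x R k) (Dx k (U j)) Q = - U j (ds k c).
  by move=> <-; rewrite /mulD /Dx dxE.
rewrite sum3.
transitivity (mulD (@e1_cross_x R 0) (Dx 0 (U j)) Q + mulD (@e1_cross_x R 1) (Dx 1 (U j)) Q + mulD (@e1_cross_x R 2) (Dx 2 (U j)) Q); first by [].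
rewrite (h 0 (fun=> 0)) ?(h 1 (fun z => - x2 z * Q z)) ?(h 2 (fun z => x1 z * Q z)) ?opprD//.
- by apply/funext => z; rewrite e1_cross_xE.
- by apply/funext => z; rewrite e1_cross_xE.
- by apply/funext => z; rewrite e1_cross_xE mul0r.
Qed.

Lemma rotation_eval1 Q :
  rotation U 1 Q = - U 2 Q + (U 1 (ds 0 (fun=> 0)) + U 1 (ds 1 (fun z => - x2 z * Q z))
    + U 1 (ds 2 (fun z => x1 z * Q z))).
Proof.
rewrite -[X in _ = _ + X]opprK -angular_eval.
rewrite /rotation; set A := \sum_(k < 3) _.
transitivity (cross (e1 C) (U : 'I_3 -> ((spacetime R -> R) -> C)) 1 Q - A Q); first by [].
by rewrite crossE.
Qed.

Lemma rotation_eval2 Q :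
  rotation U 2 Q = U 1 Q + (U 2 (ds 0 (fun=> 0)) + U 2 (ds 1 (fun z => - x2 z * Q z))
    + U 2 (ds 2 (fun z => x1 z * Q z))).
Proof.
rewrite -[X in _ = _ + X]opprK -angular_eval.
rewrite /rotation; set A := \sum_(k < 3) _.
transitivity (cross (e1 C) (U : 'I_3 -> ((spacetime R -> R) -> C)) 2 Q - A Q); first by [].
by rewrite crossE.
Qed.

Lemma Re_scale (c : R) (z : C) : complex.Re (c%:C%C * z) = c * complex.Re z.
Proof. by rewrite ReM /=; ring. Qed.
Lemma Im_scale (c : R) (z : C) : complex.Im (c%:C%C * z) = c * complex.Im z.
Proof. by rewrite ImM /=; ring. Qed.

Lemma pair_int0 v : loc_integrable T v -> <| v, fun=> 0 |> = 0.
Proof.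
move=> iv; rewrite /pair_int; under eq_Rintegral do rewrite mulr0.
by rewrite Rintegral_cst ?mul0r//; exact: measurable_period.
Qed.

(** In the system the derivative along the axis enters with the weight [0], hence the pairing with
  the derivative of a zero function. *)
Lemma pair_transport v Q : loc_integrable T v -> test Q ->
  - <| v, dtime Q |> + omega * (<| v, ds 0 (fun=> 0) |> + <| v, ds 1 (fun z => - x2 z * Q z) |>
    + <| v, ds 2 (fun z => x1 z * Q z) |>) = <| v, transport omega Q |>.
Proof.
move=> iv tQ; have tA := test_angular tQ; have tT := smooth_test_dird (direction R None) tQ.
rewrite dird_cst pair_int0// add0r pair_angular// /transport.
rewrite (pair_intD T_gt0 iv (smooth_testN tT) (smooth_testZ omega tA)).
by rewrite (pair_intZ T_gt0 _ iv tA) (pair_intN T_gt0 iv tT).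
Qed.

Lemma pair_oseen v Q : loc_integrable T v -> test Q ->
  - (<| v, ds 0 (ds 0 Q) |> + <| v, ds 1 (ds 1 Q) |> + <| v, ds 2 (ds 2 Q) |>)
   + lambda * <| v, ds 0 Q |> = <| v, oseen lambda Q |>.
Proof.
move=> iv tQ; have td w P : test P -> test (dird w P) := @smooth_test_dird R T w P.
have d2 l : test (ds l (ds l Q)) by auto.
have t0 := td (direction R (Some 0)) _ tQ.
rewrite /oseen (pair_intD T_gt0 iv (smooth_testN (smooth_testD (smooth_testD (d2 0) (d2 1)) (d2 2))) (smooth_testZ _ t0)).
rewrite (pair_intN T_gt0 iv (smooth_testD (smooth_testD (d2 0) (d2 1)) (d2 2))).
rewrite (pair_intD T_gt0 iv (smooth_testD (d2 0) (d2 1)) (d2 2)) (pair_intD T_gt0 iv (d2 0) (d2 1)).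
by rewrite (pair_intZ T_gt0 _ iv t0).
Qed.

Hypothesis u_loc : forall j, L1loc T (u j).
Hypothesis sol : is_solution T lambda omega f u p.
Hypothesis reg : forall j,
  eq_distrib T (Dt (U j) + omega%:C%C *: rotation U j) (rd (a j)).

Let iRe j := (L1loc_ReIm (u_loc j)).1.
Let iIm j := (L1loc_ReIm (u_loc j)).2.
Let tt Q : test Q -> test_function T Q := @smooth_test_test_function R T Q.

Let reg_eval j Q : test Q ->
  rd (a j) Q = - U j (dtime Q) + omega%:C%C * rotation U j Q.
Proof. by move=> tQ; rewrite -(reg j (tt tQ)) -dtE. Qed.

Let sol_eval j Q : test Q ->
  rd (f j) Q = rd (a j) Q - (U j (ds 0 (ds 0 Q)) + U j (ds 1 (ds 1 Q)) + U j (ds 2 (ds 2 Q)))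
    + lambda%:C%C * U j (ds 0 Q) - rd p (ds j Q).
Proof.
move=> tQ; rewrite -(sol.1 j _ (tt tQ)) -(reg j (tt tQ)) -laplacian_eval -!dxE.
transitivity ((Dt (U j) + omega%:C%C *: rotation U j) Q - laplacian (U j) Q
   - lambda%:C%C * Dx 0 (U j) Q + Dx j (rd p) Q); first by [].
by rewrite /Dx mulrN opprK.
Qed.

(** The system decouples into its real and imaginary parts, to each of which [gpair_duality]
  applies. *)
Lemma solution_duality Q X : test Q -> test X ->
  (forall z, transport omega X z = transport omega Q z + oseen lambda Q z) ->
  gpair T (fun z => complex.Re (f 1 z)) (fun z => complex.Re (f 2 z)) Q =
  gpair T (fun z => complex.Re (a 1 z)) (fun z => complex.Re (a 2 z)) X /\
  gpair T (fun z => complex.Im (f 1 z)) (fun z => complex.Im (f 2 z)) Q =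
  gpair T (fun z => complex.Im (a 1 z)) (fun z => complex.Im (a 2 z)) X.
Proof.
move=> tQ tX e; split.
- apply: (@gpair_duality R T lambda omega T_gt0 (fun z => complex.Re (u 1 z)) (fun z => complex.Re (u 2 z))
    (fun z => complex.Re (p z))) e => // P tP.
  + have /(congr1 (@complex.Re R)) := reg_eval 1 tP.
    rewrite rotation_eval1 ReD ReN Re_scale !ReD ReN -[complex.Re _]/(<| _ , P |>) => ->.
    rewrite -pair_transport// /U /regular_distrib/= -!/(pair_int _ _ _); ring.
  + have /(congr1 (@complex.Re R)) := reg_eval 2 tP.
    rewrite rotation_eval2 ReD ReN Re_scale !ReD -[complex.Re _]/(<| _ , P |>) => ->.
    rewrite -pair_transport// /U /regular_distrib/= -!/(pair_int _ _ _); ring.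
  + have /(congr1 (@complex.Re R)) := sol_eval 1 tP.
    rewrite !(ReD, ReN, Re_scale) -[complex.Re _]/(<| _ , P |>) => ->.
    rewrite -pair_oseen// /U /regular_distrib/= -!/(pair_int _ _ _); ring.
  + have /(congr1 (@complex.Re R)) := sol_eval 2 tP.
    rewrite !(ReD, ReN, Re_scale) -[complex.Re _]/(<| _ , P |>) => ->.
    rewrite -pair_oseen// /U /regular_distrib/= -!/(pair_int _ _ _); ring.
- apply: (@gpair_duality R T lambda omega T_gt0 (fun z => complex.Im (u 1 z)) (fun z => complex.Im (u 2 z))
    (fun z => complex.Im (p z))) e => // P tP.
  + have /(congr1 (@complex.Im R)) := reg_eval 1 tP.
    rewrite rotation_eval1 ImD ImN Im_scale !ImD ImN -[complex.Im _]/(<| _ , P |>) => ->.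
    rewrite -pair_transport// /U /regular_distrib/= -!/(pair_int _ _ _); ring.
  + have /(congr1 (@complex.Im R)) := reg_eval 2 tP.
    rewrite rotation_eval2 ImD ImN Im_scale !ImD -[complex.Im _]/(<| _ , P |>) => ->.
    rewrite -pair_transport// /U /regular_distrib/= -!/(pair_int _ _ _); ring.
  + have /(congr1 (@complex.Im R)) := sol_eval 1 tP.
    rewrite !(ImD, ImN, Im_scale) -[complex.Im _]/(<| _ , P |>) => ->.
    rewrite -pair_oseen// /U /regular_distrib/= -!/(pair_int _ _ _); ring.
  + have /(congr1 (@complex.Im R)) := sol_eval 2 tP.
    rewrite !(ImD, ImN, Im_scale) -[complex.Im _]/(<| _ , P |>) => ->.
    rewrite -pair_oseen// /U /regular_distrib/= -!/(pair_int _ _ _); ring.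
Qed.

End Equations.

(** * The corrector of a potential *)

Section PotentialDuality.
Variables (R : realType) (T lambda omega : R) (k : int) (m : nat).
Hypothesis T_gt0 : 0 < T.
Local Notation C := R[i].
Local Notation csm1 := (csm (@line_chart R)).
Local Notation i := (Complex (0 : R) 1).
Local Notation test := (smooth_test T).
Local Notation potk := (pot T k).
Let theta := frequency T k - omega * m%:R.
Hypothesis theta_neq0 : theta != 0.

Definition compact_supp (b : R -> C) := exists r, forall x, r < `|x| -> b x = 0.

Lemma periodicz (f : R -> R) P : periodic f P -> forall (n : int) a, f (a + P * n%:~R) = f a.
Proof.
move=> pf [n|n] a; first by rewrite -pmulrn mulr_natr periodicn.
rewrite NegzE mulrNz -pmulrn mulrN mulr_natr.
by rewrite -(periodicn pf n.+1) subrK.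
Qed.

Lemma time_char_periodic t : time_char T k (t + T) = time_char T k t.
Proof.
rewrite /time_char /fourier_char.
have Tn0 : T != 0 by rewrite gt_eqF.
have -> : 2 * pi / T * k%:~R * (t + T) = 2 * pi / T * k%:~R * t + pi *+ 2 * k%:~R.
  by rewrite mulr2n; field.
by rewrite (periodicz (@cosD2pi R)) (periodicz (@sinD2pi R)).
Qed.

Lemma test_pot b g : csm1 b -> csm1 g -> compact_supp b -> compact_supp g ->
  test (fun z => complex.Re (potk m b g z)) /\ test (fun z => complex.Im (potk m b g z)).
Proof.
move=> sb sg [rb hb] [rg hg].
have [s1 s2] := csm4_pot T k m sb sg.
have per t x : potk m b g (t + T, x) = potk m b g (t, x) by rewrite /pot /= time_char_periodic.
pose s := Num.max (Num.max rb rg) 1.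
have rbs : rb <= s by rewrite !le_max lexx.
have rgs : rg <= s by rewrite !le_max lexx orbT.
have s_ge1 : 1 <= s by rewrite le_max lexx orbT.
have out t x : ~ box s x -> potk m b g (t, x) = 0.
  move=> nb; have [j xj] : exists j, s < `|coordinate x j|.
    by apply/not_existsP => h; apply: nb => j; rewrite leNgt; apply/negP/h.
  have rgsq (y : R) : s < `|y| -> rg < y ^+ 2.
    move=> sy; rewrite -real_normK ?num_real// (le_lt_trans rgs)// (lt_le_trans sy)//.
    by rewrite expr2 ler_peMl// (le_trans s_ge1)// ltW.
  rewrite /pot; elim/ord3_ind : j xj => xj.
  - by rewrite hb ?mulr0 ?mul0r// (le_lt_trans rbs).
  - rewrite hg ?mulr0//; have y0 := rgsq _ xj.
    by rewrite ger0_norm ?addr_ge0 ?sqr_ge0// (lt_le_trans y0)// lerDl sqr_ge0.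
  - rewrite hg ?mulr0//; have y0 := rgsq _ xj.
    by rewrite ger0_norm ?addr_ge0 ?sqr_ge0// (lt_le_trans y0)// lerDr sqr_ge0.
split; split => //.
- by move=> t x; rewrite per.
- by exists s => t x nb; rewrite out.
- by move=> t x; rewrite per.
- by exists s => t x nb; rewrite out.
Qed.

Definition corrected_axial (b : R -> C) : R -> C := fun x =>
  b x + i * (theta^-1)%:C%C * (lambda%:C%C * D1 b x - D1 (D1 b) x).
Definition corrected_radial (g : R -> C) : R -> C := fun q =>
  - (i * (theta^-1)%:C%C) * radial_laplacian m g q.
(** With [S] the potential of [b] and [g] and [B] the Oseen operator, this is
  [S + (i / theta) B S] (see [correctorE]), grouped so that the axial part acts on [b] and the planar
  Laplacian on [g]: the former can be made small by a choice of [b] and the latter by a choice of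
  [g]. *)
Definition corrector b g (z : spacetime R) : C :=
  potk m (corrected_axial b) g z + potk m b (corrected_radial g) z.

Definition ctransport (F : spacetime R -> C) (z : spacetime R) : C :=
  - Dt4 F z + omega%:C%C * ((x1 z)%:C%C * Dx4 2 F z - (x2 z)%:C%C * Dx4 1 F z).

Lemma ctransport_parts F z : Complex (transport omega (fun z => complex.Re (F z)) z)
   (transport omega (fun z => complex.Im (F z)) z) = ctransport F z.
Proof.
by apply: complex_ext; rewrite ?(ReD, ReN, Re_scale) ?(ImD, ImN, Im_scale).
Qed.

Lemma ctransport_pot b g z : csm1 b -> csm1 g ->
  ctransport (potk m b g) z = - (i * theta%:C%C) * potk m b g z.
Proof.
move=> sb sg; have hA := pot_angular T k m z sb sg; have hT := congr1 (fun F => F z) (pot_dt T k m sb sg).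
by rewrite /= in hT; rewrite /ctransport hA hT /theta; ring.
Qed.

Lemma ctransportD F G z : csm (@spacetime_chart R) F -> csm (@spacetime_chart R) G ->
  ctransport (fun z => F z + G z) z = ctransport F z + ctransport G z.
Proof.
move=> sF sG; have cD := @cdirD _ _ _ _ (@spacetime_chartP R) _ _ _ sF sG.
by rewrite /ctransport /Dt4 /Dx4 !cD; ring.
Qed.

Lemma csm1_corrected_axial b : csm1 b -> csm1 (corrected_axial b).
Proof.
move=> sb; have s1 := csm1_D1 sb; have s2 := csm1_D1 s1.
apply: csmD => //; apply: csmM; first exact: csm_cst.
have -> : (fun x => lambda%:C%C * D1 b x - D1 (D1 b) x) = fun x => lambda%:C%C * D1 b x + (-1) * D1 (D1 b) x.
  by apply/funext => x; rewrite mulN1r.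
by apply: csmD; apply: csmM => //; exact: csm_cst.
Qed.

Lemma csm1_corrected_radial g : csm1 g -> csm1 (corrected_radial g).
Proof. by move=> sg; apply: csmM; [exact: csm_cst|exact: csm1_radial_laplacian]. Qed.

Section Fixed.
Variables (b g : R -> C).
Hypotheses (sb : csm1 b) (sg : csm1 g) (kb : compact_supp b) (kg : compact_supp g).
Let S := potk m b g.
Let X := corrector b g.
Let B (z : spacetime R) : C := - (potk m (D1 (D1 b)) g z + potk m b (radial_laplacian m g) z)
  + lambda%:C%C * potk m (D1 b) g z.

Let oseen_parts z : Complex (oseen lambda (fun z => complex.Re (S z)) z)
   (oseen lambda (fun z => complex.Im (S z)) z) = B z.
Proof.
rewrite /B -pot_laplacian// -pot_d0//.
by apply: complex_ext; rewrite ?(ReD, ReN, Re_scale) ?(ImD, ImN, Im_scale).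
Qed.

Let Re_correction (s : C) (c x y : R) :
  complex.Re (s + i * c%:C%C * Complex x y) = complex.Re s - c * y.
Proof. by rewrite ReD !ReM !ImM /=; ring. Qed.
Let Im_correction (s : C) (c x y : R) :
  complex.Im (s + i * c%:C%C * Complex x y) = complex.Im s + c * x.
Proof. by rewrite ImD !ImM !ReM /=; ring. Qed.

Lemma correctorE z : X z = S z + i * (theta^-1)%:C%C * B z.
Proof.
by rewrite /X /corrector /B /S /corrected_axial /corrected_radial /pot; ring.
Qed.

Lemma test_corrector :
  test (fun z => complex.Re (X z)) /\ test (fun z => complex.Im (X z)).
Proof.
have [t1 t2] := test_pot sb sg kb kg.
have -> : (fun z => complex.Re (X z)) = fun z => complex.Re (S z) - theta^-1 * oseen lambda (fun z => complex.Im (S z)) z.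
  by apply/funext => z; rewrite correctorE -oseen_parts Re_correction.
have -> : (fun z => complex.Im (X z)) = fun z => complex.Im (S z) + theta^-1 * oseen lambda (fun z => complex.Re (S z)) z.
  by apply/funext => z; rewrite correctorE -oseen_parts Im_correction.
split.
- by apply: smooth_testB => //; apply: smooth_testZ; exact: test_oseen.
- by apply: smooth_testD => //; apply: smooth_testZ; exact: test_oseen.
Qed.

(** As [S], [B S] is an eigenfunction of the transport operator with eigenvalue [- i theta], so
  [(i / theta) B S] is a preimage of [B S]. *)
Lemma transport_corrector z :
  transport omega (fun z => complex.Re (X z)) z =
    transport omega (fun z => complex.Re (S z)) z + oseen lambda (fun z => complex.Re (S z)) z /\
  transport omega (fun z => complex.Im (X z)) z =
    transport omega (fun z => complex.Im (S z)) z + oseen lambda (fun z => complex.Im (S z)) z.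
Proof.
have sb1 := csm1_corrected_axial sb; have sg1 := csm1_corrected_radial sg.
have : ctransport X z = ctransport S z + B z.
  rewrite /X /corrector ctransportD; [|exact: csm4_pot|exact: csm4_pot].
  rewrite !ctransport_pot// -mulrDr -/(corrector b g z) -/(X z) correctorE.
  have tt : theta%:C%C * (theta^-1)%:C%C = 1 :> C.
    by apply: complex_ext; rewrite ?ReM ?ImM /= ?mulfV//; ring.
  rewrite -/(S z); move: (B z) (S z) => Bz Sz; move: (theta%:C%C) (theta^-1)%:C%C tt => th thV tt.
  transitivity (- (i * th) * Sz + (1 - (i * i + 1)) * (th * thV) * Bz); first by ring.
  by rewrite ii tt subr0 !mul1r.
rewrite -!ctransport_parts -oseen_parts => e.
by split; [have := congr1 (@complex.Re R) e|have := congr1 (@complex.Im R) e].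
Qed.

End Fixed.

End PotentialDuality.

(** * Scaling and iterated integrals *)

Section Scaling.
Variable R : realType.
Local Notation L := (@lebesgue_measure R).
Local Open Scope ereal_scope.

(** Lebesgue measure is determined by its values on intervals, so it coincides with the rescaled
  push-forward under the affine map. *)
Lemma integral_affine (r tau : R) (h : R -> \bar R) : (0 < r)%R ->
  measurable_fun [set: measurableTypeR R] h -> (forall x, 0 <= h x) ->
  \int[L]_x h ((x - tau) / r)%R = r%:E * \int[L]_x h x.
Proof.
move=> r0 mh h0.
pose phi (x : measurableTypeR R) : measurableTypeR R := ((x - tau) / r)%R.
have mphi : measurable_fun setT phi.
  apply: measurable_funM => //; exact: measurable_funB.
have rn0 : (0 <= r^-1)%R by rewrite invr_ge0 ltW.
pose nu := mscale (NngNum rn0) (measure_function_pushforward__canonical__measure_function_Measure L mphi).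
have r1 : (0 < r^-1)%R by rewrite invr_gt0.
have nuE X : measurable X -> L X = nu X.
  apply: lebesgue_measure_unique => {}X /ocitvP[->|[[a b] /= ab ->]]; first by rewrite !measure0.
  rewrite /nu /mscale/= /pushforward.
  have -> : phi @^-1` `]a, b] = `](r * a + tau)%R, (r * b + tau)%R]%classic.
    apply/seteqP; split => x /=; rewrite !in_itv/= /phi ltr_pdivlMr// ler_pdivrMr// ltrBrDr lerBlDr mulrC [(b * r)%R]mulrC//.
  rewrite !lebesgue_measure_itv/= !lte_fin ab ltrD2r ltr_pM2l// ab -!EFinD -EFinM.
  by congr EFin; field; rewrite gt_eqF.
have -> : \int[L]_x h x = \int[nu]_x h x by apply: eq_measure_integral => A mA _; exact: nuE.
rewrite ge0_integral_mscale//= ge0_integral_pushforward//= preimage_setT.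
by rewrite muleA -EFinM mulfV ?gt_eqF// mul1e.
Qed.

End Scaling.

Section Tonelli.
Variable R : realType.
Local Notation L := (@lebesgue_measure R).
Local Open Scope ereal_scope.

(** The measure on space is a product of products, so the iterated integrals have to be taken in
  two stages. *)
Lemma tonelli_space (h : space3 R -> \bar R) :
  measurable_fun [set: measurableTypeR R * measurableTypeR R * measurableTypeR R] h ->
  (forall x, 0 <= h x) ->
  \int[leb_space R]_x h x = \int[L]_a \int[L]_b \int[L]_c h ((a, b), c).
Proof.
move=> mh h0.
pose F p := \int[L]_c h (p, c).
have F0 p : 0 <= F p by exact: integral_ge0.
have mF : measurable_fun [set: measurableTypeR R * measurableTypeR R] F.
  exact: (@measurable_fun_fubini_tonelli_F _ _ _ _ _ L h mh h0).
have -> : \int[leb_space R]_x h x = \int[sf_product L L]_p F p.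
  exact: (@fubini_tonelli1 _ _ _ _ _ (sf_product L L) L h mh h0).
exact: (@fubini_tonelli1 _ _ _ _ _ L L F mF F0).
Qed.

Lemma integral_period (T : R) (h : space3 R -> \bar R) : (0 < T)%R ->
  measurable_fun [set: measurableTypeR R * measurableTypeR R * measurableTypeR R] h ->
  (forall x, 0 <= h x) ->
  \int[leb_spacetime R]_(z in period_domain T setT) h z.2 = T%:E * \int[leb_space R]_x h x.
Proof.
move=> T0 mh h0.
have mD : measurable (period_domain T (@setT (measurableTypeR R * measurableTypeR R * measurableTypeR R))) by exact: measurableX.
rewrite integral_mkcond.
pose H z := ((fun z : spacetime R => h z.2) \_ (period_domain T setT)) z.
have H0 z : 0 <= H z by rewrite /H patchE; case: ifP.
have mH : measurable_fun [set: measurableTypeR R * (measurableTypeR R * measurableTypeR R * measurableTypeR R)] H.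
  apply/(measurable_restrictT _ mD); apply: measurable_funTS.
  exact: measurableT_comp mh measurable_snd.
have -> : \int[leb_spacetime R]_z ((fun z : spacetime R => h z.2) \_ (period_domain T setT)) z = \int[L]_t \int[leb_space R]_x H (t, x).
  exact: (@fubini_tonelli1 _ _ _ _ _ L (leb_space R) H mH H0).
have -> : (fun t => \int[leb_space R]_x H (t, x)) = (fun=> \int[leb_space R]_x h x) \_ (`[0%R, T]).
  apply/funext => t; rewrite patchE /H; case: ifPn => ht.
    apply: eq_integral => x _; rewrite patchE mem_set//; split => //=; exact: set_mem.
  apply: integral0_eq => x _; rewrite patchE; case: ifPn => // /set_mem[/= h1 _].
  by rewrite notin_setE in ht.
rewrite -integral_mkcond integral_cst//= lebesgue_measure_itv/= lte_fin T0 sube0 muleC //.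
Qed.

End Tonelli.

(** * The gradient energy of a potential *)

Section Energy.
Variables (R : realType) (T : R) (k : int).
Local Notation C := R[i].
Local Notation csm1 := (csm (@line_chart R)).
Local Notation sm1 := (sm (@line_chart R)).
Local Notation i := (Complex (0 : R) 1).
Local Notation potk := (pot T k).
Local Notation L := (@lebesgue_measure R).

(** The squared length of the rotated planar gradient. *)
Definition energy (F : spacetime R -> C) (z : spacetime R) : R :=
  sqn (Dx4 1 F z) + sqn (Dx4 2 F z).

(** The planar energy density of [(x_1 + i x_2)^(n+1) rho(q)] at [q = x_1^2 + x_2^2]: the two
  squares are the angular and the radial derivative, up to the common factor [q ^+ n]. *)
Definition radial_energy (n : nat) (rho : R -> R) (q : R) : R :=
  q ^+ n * ((n.+1%:R * rho q) ^+ 2 + (n.+1%:R * rho q + 2 * q * dird (1 : R) rho q) ^+ 2).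

Definition realfun_C (rho : R -> R) : R -> C := fun q => (rho q)%:C%C.

Lemma D1_realfun_C rho : sm1 rho -> D1 (realfun_C rho) = realfun_C (dird (1 : R) rho).
Proof. by move=> sr; rewrite /D1 (cdir_real _ sr). Qed.

Lemma csm1_realfun_C rho : sm1 rho -> csm1 (realfun_C rho).
Proof. exact: csm_real. Qed.

Lemma Complex_split (x y : R) : Complex x y = x%:C%C + i * y%:C%C.
Proof. by apply: complex_ext; rewrite ?ReD ?ImD ?ReM ?ImM /=; ring. Qed.

Lemma energy_pot n b rho z : csm1 b -> sm1 rho ->
  energy (potk n.+1 b (realfun_C rho)) z = sqn (b (x0 z)) * radial_energy n rho (rsq z).
Proof.
move=> sb sr; have sg := csm1_realfun_C sr.
rewrite /energy pot_d1// pot_d2// D1_realfun_C//.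
pose W := time_char T k z.1 * b (x0 z) * planar z ^+ n.
set q := rsq z; set r := rho q; set r' := dird (1 : R) rho q.
have e1 : n.+1%:R * potk n.+1.-1 b (realfun_C rho) z + 2 * (x1 z)%:C%C * potk n.+1 b (realfun_C (dird (1 : R) rho)) z =
  W * Complex (n.+1%:R * r + 2 * x1 z ^+ 2 * r') (2 * x1 z * x2 z * r').
  have -> : Complex (n.+1%:R * r + 2 * x1 z ^+ 2 * r') (2 * x1 z * x2 z * r') =
     n.+1%:R * r%:C%C + 2 * (x1 z)%:C%C * planar z * r'%:C%C.
    by rewrite [LHS]Complex_split planarE; ring.
  by rewrite /pot /realfun_C /= -/q -/r -/r' /W exprS; ring.
have e2 : n.+1%:R * i * potk n.+1.-1 b (realfun_C rho) z + 2 * (x2 z)%:C%C * potk n.+1 b (realfun_C (dird (1 : R) rho)) z =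
  W * Complex (2 * x1 z * x2 z * r') (n.+1%:R * r + 2 * x2 z ^+ 2 * r').
  have -> : Complex (2 * x1 z * x2 z * r') (n.+1%:R * r + 2 * x2 z ^+ 2 * r') =
     n.+1%:R * i * r%:C%C + 2 * (x2 z)%:C%C * planar z * r'%:C%C.
    by rewrite [LHS]Complex_split planarE; ring.
  by rewrite /pot /realfun_C /= -/q -/r -/r' /W exprS; ring.
rewrite e1 e2 !sqnM sqnX sqn_time_char mul1r /radial_energy -/r -/r'.
have -> : sqn (planar z) = q by [].
by rewrite /sqn /= -/r -/r' /q /rsq; ring.
Qed.

Lemma energyD_le F G z : csm (@spacetime_chart R) F -> csm (@spacetime_chart R) G ->
  energy (fun z => F z + G z) z <= 2 * energy F z + 2 * energy G z.
Proof.
move=> sF sG; have cD := @cdirD _ _ _ _ (@spacetime_chartP R) _ _ _ sF sG.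
rewrite /energy /Dx4 !cD.
have := sqnD_le (Dx4 1 F z) (Dx4 1 G z); have := sqnD_le (Dx4 2 F z) (Dx4 2 G z).
rewrite /Dx4; lra.
Qed.

Definition axial_energy (b : R -> C) : \bar R := (\int[L]_x (sqn (b x))%:E)%E.
Definition planar_energy n rho : \bar R :=
  (\int[L]_y1 \int[L]_y2 (radial_energy n rho (y1 ^+ 2 + y2 ^+ 2))%:E)%E.

Lemma radial_energy_ge0 n rho q : 0 <= q -> 0 <= radial_energy n rho q.
Proof. by move=> q0; rewrite mulr_ge0 ?exprn_ge0// addr_ge0// sqr_ge0. Qed.

Lemma sm1_continuous (f : R -> R) : sm1 f -> continuous f.
Proof.
move=> sf x; apply: differentiable_continuous.
exact: (sm_differentiable (@line_chartP R)).
Qed.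

Lemma sm1_measurable (f : R -> R) : sm1 f -> measurable_fun [set: measurableTypeR R] f.
Proof. by move=> sf; exact: continuous_measurable_fun (sm1_continuous sf). Qed.

Lemma csm1_measurable_sqn (b : R -> C) : csm1 b -> measurable_fun [set: measurableTypeR R] (fun x => sqn (b x)).
Proof.
by move=> [b1 b2]; apply: measurable_funD; apply: measurable_funX; exact: sm1_measurable.
Qed.

Lemma sm1_radial_energy n rho : sm1 rho -> sm1 (radial_energy n rho).
Proof.
move=> sr; have sd : sm1 (dird (1 : R) rho) by exact: sm_dird (@line_chartP R) _ _ sr.
have sid : sm1 (fun q : R => q) := sm_crd _ tt.
have sq f : sm1 f -> sm1 (fun q => f q ^+ 2) by move=> sf; exact: sm_mul.
have sc c f : sm1 f -> sm1 (fun q => c * f q) by move=> sf; apply: sm_mul => //; exact: sm_cst.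
apply: sm_mul.
  elim: n => [|n ih]; first by under eq_fun do rewrite expr0; exact: sm_cst.
  by under eq_fun do rewrite exprS; exact: sm_mul.
apply: sm_add; apply: (sq (fun q => _)); first exact: sc.
apply: sm_add; first exact: sc.
by apply: sm_mul => //; apply: sc.
Qed.

(** The energy density is a product of a function of [x_0] and a function of [(x_1, x_2)], and does
  not depend on time. *)
Lemma energy_integral n b rho : 0 < T -> csm1 b -> sm1 rho ->
  (\int[leb_spacetime R]_(z in period_domain T setT)
    (energy (potk n.+1 b (realfun_C rho)) z)%:E =
  T%:E * (axial_energy b * planar_energy n rho))%E.
Proof.
move=> T0 sb sr.
pose h (x : space3 R) : \bar R := ((sqn (b x.1.1))%:E * (radial_energy n rho (x.1.2 ^+ 2 + x.2 ^+ 2))%:E)%E.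
have mre := sm1_measurable (sm1_radial_energy n sr).
have mf1 : measurable_fun [set: measurableTypeR R * measurableTypeR R * measurableTypeR R] fst := measurable_fst.
have m0 : measurable_fun [set: measurableTypeR R * measurableTypeR R * measurableTypeR R] (fun x => x.1.1).
  exact: measurableT_comp measurable_fst mf1.
have m1 : measurable_fun [set: measurableTypeR R * measurableTypeR R * measurableTypeR R] (fun x => x.1.2).
  exact: measurableT_comp measurable_snd mf1.
have m2 : measurable_fun [set: measurableTypeR R * measurableTypeR R * measurableTypeR R] (fun x => x.2).
  exact: measurable_snd.
have rad0 (y1 y2 : R) : 0 <= radial_energy n rho (y1 ^+ 2 + y2 ^+ 2).
  by rewrite radial_energy_ge0// addr_ge0 ?sqr_ge0.
have mh : measurable_fun [set: measurableTypeR R * measurableTypeR R * measurableTypeR R] h.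
  apply: emeasurable_funM; apply/measurable_EFinP.
    exact: measurableT_comp (csm1_measurable_sqn sb) m0.
  apply: (@measurableT_comp _ _ _ _ _ _ (radial_energy n rho) setT _ mre).
  by apply: measurable_funD; exact: measurable_funX.
have h0 x : (0 <= h x)%E by rewrite mule_ge0// lee_fin ?sqn_ge0.
under eq_integral do rewrite energy_pot// EFinM -/(h _.2).
rewrite (@integral_period _ _ h)//; congr (_ * _)%E.
rewrite tonelli_space//.
pose F y1 := (\int[L]_y2 (radial_energy n rho (y1 ^+ 2 + y2 ^+ 2))%:E)%E.
have mrad : measurable_fun [set: measurableTypeR R * measurableTypeR R] (fun y : R * R => (radial_energy n rho (y.1 ^+ 2 + y.2 ^+ 2))%:E).
  apply/measurable_EFinP; apply: (@measurableT_comp _ _ _ _ _ _ (radial_energy n rho) setT _ mre).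
  by apply: measurable_funD; apply: measurable_funX; [exact: measurable_fst|exact: measurable_snd].
have F0 y1 : (0 <= F y1)%E by apply: integral_ge0 => y2 _; rewrite lee_fin.
have mF : measurable_fun [set: measurableTypeR R] F.
  apply: (@measurable_fun_fubini_tonelli_F _ _ _ _ _ L _ mrad) => y; by rewrite lee_fin.
transitivity (\int[L]_x0 ((sqn (b x0))%:E * planar_energy n rho))%E.
  apply: eq_integral => a _; rewrite /planar_energy -/(F _).
  transitivity (\int[L]_y1 ((sqn (b a))%:E * F y1))%E.
    apply: eq_integral => y1 _; rewrite -ge0_integralZl//.
    + apply/measurable_EFinP; apply: (@measurableT_comp _ _ _ _ _ _ (radial_energy n rho) setT _ mre).
      by apply: measurable_funD => //; exact: measurable_funX.
    + by move=> y2 _; rewrite lee_fin.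
    + by rewrite lee_fin sqn_ge0.
  by rewrite ge0_integralZl// lee_fin sqn_ge0.
rewrite ge0_integralZr//.
- by apply/measurable_EFinP; exact: csm1_measurable_sqn.
- by move=> x _; rewrite lee_fin sqn_ge0.
- by rewrite /planar_energy; apply: integral_ge0 => y1 _; exact: F0.
Qed.

End Energy.

(** * Energies of compactly supported profiles *)

Section Profiles.
Variable R : realType.
Local Notation C := R[i].
Local Notation csm1 := (csm (@line_chart R)).
Local Notation sm1 := (sm (@line_chart R)).
Local Notation L := (@lebesgue_measure R).
Local Notation d1 := (dird (1 : R)).
Let lineP := @line_chartP R.

Definition supp01 (f : R -> R) := forall x, (x < 0) || (1 < x) -> f x = 0.

Lemma sm1_d1 f : sm1 f -> sm1 (d1 f).
Proof. exact: sm_dird lineP _ _. Qed.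

Lemma supp01_d1 f : supp01 f -> supp01 (d1 f).
Proof.
move=> sf x xo; rewrite dird.unlock.
rewrite (@near_eq_derive _ _ _ f (fun=> 0) x 1); first exact: (@derive_cst _ R R 0 1).
case/orP : xo => h.
- by near=> y; apply: sf; apply/orP; left; near: y; exact: lt_nbhsl.
- by near=> y; apply: sf; apply/orP; right; near: y; exact: lt_nbhsr.
Unshelve. all: by end_near. Qed.

Lemma supp01_bounded f : sm1 f -> supp01 f -> exists2 B, 0 <= B & forall x, `|f x| <= B.
Proof.
move=> sf kf.
have cf : {within `[0, 1], continuous (fun x => `|f x|)}.
  by apply: continuous_subspaceT => x; apply: cvg_norm; exact: sm1_continuous sf _.
have [c _ hc] := EVT_max ler01 cf.
exists `|f c| => // x.
have [x0|x0] := ltP x 0; first by rewrite kf ?x0// normr0.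
have [x1|x1] := ltP 1 x; first by rewrite kf ?x1 ?orbT// normr0.
by apply: hc; rewrite in_itv/= x0.
Qed.

Lemma integral_le_itv (f : R -> \bar R) (B a b : R) : a < b ->
  measurable_fun [set: measurableTypeR R] f ->
  (forall x, 0 <= f x)%E -> (forall x, f x <= B%:E)%E -> (forall x, x \notin `[a, b] -> f x = 0%E) ->
  (\int[L]_x (f x) <= (B * (b - a))%:E)%E.
Proof.
move=> ab mf f0 fB fo.
rewrite (_ : (B * (b - a))%:E = \int[L]_(x in `[a, b]) (cst B%:E x))%E; last first.
  by rewrite integral_cst//= lebesgue_measure_itv/= lte_fin ab -EFinB -EFinM.
rewrite (_ : \int[L]_x (f x) = \int[L]_(x in `[a, b]) (f x))%E; last first.
  rewrite [RHS]integral_mkcond; apply: eq_integral => x _; rewrite patchE.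
  by case: ifPn => //; rewrite mem_setE => /fo ->.
apply: ge0_le_integral => //; exact: measurable_funTS.
Qed.

Lemma itv_le_integral (f : R -> \bar R) (B a b : R) : a < b -> 0 <= B ->
  measurable_fun [set: measurableTypeR R] f ->
  (forall x, 0 <= f x)%E -> (forall x, a <= x -> x <= b -> (B%:E <= f x)%E) ->
  ((B * (b - a))%:E <= \int[L]_x (f x))%E.
Proof.
move=> ab B0 mf f0 fB.
rewrite (_ : (B * (b - a))%:E = \int[L]_(x in `[a, b]) (cst B%:E x))%E; last first.
  by rewrite integral_cst//= lebesgue_measure_itv/= lte_fin ab -EFinB -EFinM.
apply: (@le_trans _ _ (\int[L]_(x in `[a, b]) (f x))%E).
  apply: ge0_le_integral => //; first exact: measurable_funTS.
  by move=> x /=; rewrite in_itv/= => /andP[h1 h2]; exact: fB.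
exact: ge0_subset_integral.
Qed.

Lemma supp01_energy f : sm1 f -> supp01 f ->
  exists2 J : R, 0 <= J & (\int[L]_x (f x ^+ 2)%:E = J%:E)%E.
Proof.
move=> sf kf; have [B B0 hB] := supp01_bounded sf kf.
have i0 : (0 <= \int[L]_x (f x ^+ 2)%:E)%E by apply: integral_ge0 => x _; rewrite lee_fin sqr_ge0.
have : (\int[L]_x (f x ^+ 2)%:E <= (B ^+ 2 * (1 - 0))%:E)%E.
  apply: integral_le_itv => //.
  - by apply/measurable_EFinP; apply: measurable_funX; exact: sm1_measurable.
  - by move=> x; rewrite lee_fin sqr_ge0.
  - by move=> x; rewrite lee_fin -real_normK ?num_real// lerXn2r ?nnegrE.
  - by move=> x; rewrite in_itv/= negb_and -!ltNge => h; rewrite kf ?expr0n.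
case: (\int[L]_x _)%E i0 => // J; rewrite lee_fin => J0 _; first by exists J.
Qed.

Lemma bump_energy_gt0 (J : R) : (\int[L]_x (bump x ^+ 2)%:E = J%:E)%E -> 0 < J.
Proof.
move=> e; have [d d0 hd] := bump_gt0 R.
rewrite -lte_fin -e.
apply: (@lt_le_trans _ _ (d ^+ 2 * ((1 - 4^-1) - 4^-1))%:E).
  by rewrite lte_fin mulr_gt0 ?exprn_gt0//; lra.
apply: itv_le_integral; [lra|exact: sqr_ge0|..].
- by apply/measurable_EFinP; apply: measurable_funX; apply: sm1_measurable; exact: sm1_bump.
- by move=> x; rewrite lee_fin sqr_ge0.
- move=> x h1 h2; rewrite lee_fin.
  by rewrite lerXn2r ?nnegrE ?(ltW d0) ?hd// (le_trans (ltW d0))// hd.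
Qed.

Lemma d1_affine f (tau s : R) : sm1 f ->
  d1 (fun x => f ((x - tau) / s)) = fun x => s^-1 * d1 f ((x - tau) / s).
Proof.
move=> sf; have sx : sm1 (fun x => (x - tau) / s).
  apply: sm_mul; last exact: sm_cst.
  by apply: sm_add; [exact: (sm_crd _ tt) | exact: sm_cst].
rewrite (dird_comp lineP 1 (sm1_derivable_sequence sf) sx); apply/funext => x.
rewrite dird1E (@dirdM _ _ _ _ lineP 1 (fun x => x - tau) (fun=> s^-1)); last 2 first.
- by apply: sm_add; [exact: (sm_crd _ tt) | exact: sm_cst].
- exact: sm_cst.
rewrite (@dirdD _ _ _ _ lineP 1 (@line_chart R tt) (fun=> - tau)); [|exact: sm_crd|exact: sm_cst].
by rewrite !dird_cst (dird_crd lineP) /line_chart; ring.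
Qed.

Lemma sm1_affine f (tau s : R) : sm1 f -> sm1 (fun x => f ((x - tau) / s)).
Proof.
move=> sf; apply: (sm_of_sm1 sf); apply: sm_mul; last exact: sm_cst.
by apply: sm_add; [exact: (sm_crd _ tt) | exact: sm_cst].
Qed.

Lemma d1_scale f (s : R) : sm1 f -> d1 (fun x => f (x / s)) = fun x => s^-1 * d1 f (x / s).
Proof.
move=> sf; rewrite (_ : (fun x => f (x / s)) = fun x => f ((x - 0) / s)).
  by rewrite d1_affine//; apply/funext => x; rewrite subr0.
by apply/funext => x; rewrite subr0.
Qed.

Lemma supp01_radial_energy n rho : supp01 rho -> supp01 (radial_energy n rho).
Proof.
move=> kr x xo; have kd := supp01_d1 kr.
by rewrite /radial_energy (kr _ xo) (kd _ xo) !mulr0 addr0 expr0n/= addr0 mulr0.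
Qed.

Section Planar.
Variables (n : nat) (rho : R -> R).
Hypothesis sr : sm1 rho.
Let G q := radial_energy n rho q.
Let F y1 := (\int[L]_y2 (G (y1 ^+ 2 + y2 ^+ 2))%:E)%E.

Let G0 (y1 y2 : R) : 0 <= G (y1 ^+ 2 + y2 ^+ 2).
Proof. by rewrite radial_energy_ge0// addr_ge0 ?sqr_ge0. Qed.

Let mG : measurable_fun [set: measurableTypeR R] G.
Proof. by apply: sm1_measurable; exact: sm1_radial_energy. Qed.

Let mG2 y1 : measurable_fun [set: measurableTypeR R] (fun y2 => (G (y1 ^+ 2 + y2 ^+ 2))%:E).
Proof.
apply/measurable_EFinP; apply: (@measurableT_comp _ _ _ _ _ _ G setT _ mG).
by apply: measurable_funD => //; exact: measurable_funX.
Qed.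

Let F0 y1 : (0 <= F y1)%E.
Proof. by apply: integral_ge0 => y2 _; rewrite lee_fin. Qed.

Let mF : measurable_fun [set: measurableTypeR R] F.
Proof.
have mrad : measurable_fun [set: measurableTypeR R * measurableTypeR R] (fun y : R * R => (G (y.1 ^+ 2 + y.2 ^+ 2))%:E).
  apply/measurable_EFinP; apply: (@measurableT_comp _ _ _ _ _ _ G setT _ mG).
  by apply: measurable_funD; apply: measurable_funX; [exact: measurable_fst|exact: measurable_snd].
by apply: (@measurable_fun_fubini_tonelli_F _ _ _ _ _ L _ mrad) => y; rewrite lee_fin.
Qed.

(** Dilating the plane by [r] multiplies the gradient of a homogeneous factor of degree [n+1] by
  [r ^+ n] and the area by [r ^+ 2]. *)
Lemma planar_energy_scale (r : R) : 0 < r ->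
  planar_energy n (fun q => rho (q / r ^+ 2)) = (((r ^+ n.+1) ^+ 2)%:E * planar_energy n rho)%E.
Proof.
move=> r0; have rn0 : r != 0 by rewrite gt_eqF.
have re q : radial_energy n (fun q => rho (q / r ^+ 2)) q = (r ^+ n) ^+ 2 * G (q / r ^+ 2).
  rewrite /radial_energy d1_scale// /G /radial_energy.
  have -> : q ^+ n = (r ^+ n) ^+ 2 * (q / r ^+ 2) ^+ n.
    by rewrite -exprM mulnC exprM -exprMn mulrC divfK// expf_neq0.
  by field.
have rr0 : (0 <= ((r ^+ n) ^+ 2)%:E)%E by rewrite lee_fin sqr_ge0.
transitivity (\int[L]_y1 (((r ^+ n) ^+ 2)%:E * (r%:E * F ((y1 - 0) / r)%R)))%E.
  apply: eq_integral => y1 _.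
  transitivity (\int[L]_y2 (((r ^+ n) ^+ 2)%:E * (G (((y1 - 0) / r) ^+ 2 + ((y2 - 0) / r) ^+ 2))%:E))%E.
    apply: eq_integral => y2 _; rewrite re EFinM; congr (_ * (G _)%:E)%E.
    by rewrite !subr0 mulrDl !expr_div_n.
  rewrite ge0_integralZl//.
  - congr (_ * _)%E.
    apply: (@integral_affine R r 0 (fun y2 => (G (((y1 - 0) / r) ^+ 2 + y2 ^+ 2))%:E) r0 (mG2 _)) => y2.
    by rewrite lee_fin.
  - have := mG2 ((y1 - 0) / r) => m.
    apply/measurable_EFinP; apply: (@measurableT_comp _ _ _ _ _ _ G setT _ mG).
    apply: measurable_funD => //; apply: measurable_funX; apply: measurable_funM => //.
    by apply: measurable_funB.
  - by move=> y2 _; rewrite lee_fin.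
have mFr : measurable_fun [set: measurableTypeR R] (fun y1 => F ((y1 - 0) / r)%R).
  apply: (@measurableT_comp _ _ _ _ _ _ F setT _ mF).
  by apply: measurable_funM => //; exact: measurable_funB.
rewrite ge0_integralZl//; last 2 first.
- exact: measurable_funeM.
- by move=> y1 _; rewrite mule_ge0// lee_fin ltW.
rewrite ge0_integralZl// ?lee_fin ?(ltW r0)//.
rewrite (@integral_affine R r 0 F r0 mF F0) !muleA -!EFinM; congr (_%:E * _)%E.
by rewrite [r ^+ n.+1]exprS; ring.
Qed.

Lemma planar_energyZ (c : R) :
  planar_energy n (fun q => c * rho q) = ((c ^+ 2)%:E * planar_energy n rho)%E.
Proof.
have re q : radial_energy n (fun q => c * rho q) q = c ^+ 2 * G q.
  rewrite /G /radial_energy (@dirdM _ _ _ _ lineP 1 (fun=> c) rho) ?dird_cst//; last exact: sm_cst.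
  by ring.
have c0 : (0 <= (c ^+ 2)%:E)%E by rewrite lee_fin sqr_ge0.
transitivity (\int[L]_y1 ((c ^+ 2)%:E * F y1))%E; last by rewrite ge0_integralZl.
apply: eq_integral => y1 _; rewrite -ge0_integralZl//.
  by apply: eq_integral => y2 _; rewrite re EFinM.
by move=> y2 _; rewrite lee_fin.
Qed.

Lemma planar_energy_fin : supp01 rho -> exists2 K : R, 0 <= K & planar_energy n rho = K%:E.
Proof.
move=> kr; have [B B0 hB] := supp01_bounded (sm1_radial_energy n sr) (supp01_radial_energy n kr).
have GB q : G q <= B by rewrite (le_trans _ (hB q))// ler_norm.
have out y1 y2 : (1 < `|y1|) || (1 < `|y2|) -> G (y1 ^+ 2 + y2 ^+ 2) = 0.
  move=> h; apply: (supp01_radial_energy n kr); apply/orP; right.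
  have key (y : R) : 1 < `|y| -> 1 < y ^+ 2.
    by move=> y1'; rewrite -real_normK ?num_real// exprn_egt1.
  case/orP : h => /key h; first by rewrite (lt_le_trans h)// lerDl sqr_ge0.
  by rewrite (lt_le_trans h)// lerDr sqr_ge0.
have itvN (y : R) : y \notin `[- 1, 1] -> 1 < `|y|.
  by rewrite in_itv/= -ler_norml -ltNge.
have F1 y1 : (F y1 <= (B * (1 - -1))%:E)%E.
  apply: integral_le_itv => //.
  - by move=> y2; rewrite lee_fin.
  - by move=> y2; rewrite lee_fin.
  - by move=> y2 /itvN h; rewrite out// h orbT.
have i0 : (0 <= planar_energy n rho)%E by apply: integral_ge0 => y1 _; exact: F0.
have : (planar_energy n rho <= (B * (1 - -1) * (1 - -1))%:E)%E.
  apply: integral_le_itv => //.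
  - move=> y1 /itvN h; apply: integral0_eq => y2 _; by rewrite -/(G _) out// h.
case: (planar_energy n rho) i0 => // J; rewrite lee_fin => J0 _; first by exists J.
Qed.

(** The energy density is bounded below on the rectangle [1/2 <= y1 <= 3/4], [0 <= y2 <= 1/4], on
  which [y1^2 + y2^2] stays in the interval where [rho] is bounded below. *)
Lemma planar_energy_gt0 (d K : R) : 0 < d -> (forall x, 4^-1 <= x -> x <= 1 - 4^-1 -> d <= rho x) ->
  planar_energy n rho = K%:E -> 0 < K.
Proof.
move=> d0 hd e; rewrite -lte_fin -e.
pose c := 4^-1 ^+ n * d ^+ 2.
have c0 : 0 < c by rewrite mulr_gt0 ?exprn_gt0// invr_gt0.
have Gc y1 y2 : 2^-1 <= y1 -> y1 <= 1 - 4^-1 -> 0 <= y2 -> y2 <= 4^-1 -> c <= G (y1 ^+ 2 + y2 ^+ 2).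
  move=> h1 h2 h3 h4; set q := _ + _.
  have q1 : 4^-1 <= q.
    rewrite (@le_trans _ _ (y1 ^+ 2)) ?lerDl ?sqr_ge0//; nra.
  have q2 : q <= 1 - 4^-1 by rewrite /q; nra.
  have dq := hd _ q1 q2.
  have n1 : (1 : R) <= n.+1%:R by rewrite ler1n.
  have i4 : (0 : R) <= 4^-1 by rewrite invr_ge0.
  apply: ler_pM; [exact: exprn_ge0|exact: sqr_ge0| |].
    by rewrite lerXn2r ?nnegrE// (le_trans i4).
  apply: (@le_trans _ _ ((n.+1%:R * rho q) ^+ 2)); last by rewrite lerDl sqr_ge0.
  rewrite lerXn2r ?nnegrE ?(ltW d0)//.
    by rewrite mulr_ge0// (le_trans (ltW d0)).
  by rewrite (le_trans dq)// ler_peMl// (le_trans (ltW d0)).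
have Fc y1 : 2^-1 <= y1 -> y1 <= 1 - 4^-1 -> ((c * (4^-1 - 0))%:E <= F y1)%E.
  move=> h1 h2; apply: itv_le_integral => //.
  - exact: ltW.
  - by move=> y2; rewrite lee_fin.
  - by move=> y2 h3 h4; rewrite lee_fin Gc.
apply: (@lt_le_trans _ _ (c * (4^-1 - 0) * ((1 - 4^-1) - 2^-1))%:E).
  by rewrite lte_fin subr0 !mulr_gt0//; lra.
apply: itv_le_integral => //; first by lra.
by rewrite subr0 mulr_ge0 ?(ltW c0)// invr_ge0.
Qed.

End Planar.

End Profiles.

(** * Wave packets *)

Section Packet.
Variables (R : realType) (T lambda omega : R) (k : int) (n : nat).
Hypothesis lambda_gt0 : 0 < lambda.
Local Notation C := R[i].
Local Notation csm1 := (csm (@line_chart R)).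
Local Notation sm1 := (sm (@line_chart R)).
Local Notation L := (@lebesgue_measure R).
Local Notation d1 := (dird (1 : R)).
Local Notation i := (Complex (0 : R) 1).
Let theta := frequency T k - omega * n.+1%:R.
Hypothesis theta_neq0 : theta != 0.
Let xi := theta / lambda.
Let lineP := @line_chartP R.

Definition real_radial_laplacian (rho : R -> R) (q : R) : R :=
  4 * n.+2%:R * d1 rho q + 4 * q * d1 (d1 rho) q.

Lemma sm1_real_radial_laplacian rho : sm1 rho -> sm1 (real_radial_laplacian rho).
Proof.
move=> sr; have s1 := sm1_d1 sr; have s2 := sm1_d1 s1.
apply: sm_add; apply: sm_mul => //; first exact: sm_cst.
by apply: sm_mul; [exact: sm_cst|exact: (sm_crd _ tt)].
Qed.

Lemma radial_laplacian_real rho : sm1 rho ->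
  radial_laplacian n.+1 (realfun_C rho) = realfun_C (real_radial_laplacian rho).
Proof.
move=> sr; apply/funext => q; rewrite /radial_laplacian !D1_realfun_C//; last exact: sm1_d1.
by rewrite /realfun_C /real_radial_laplacian; ring.
Qed.

(** The Laplacian scales with a factor [r ^- 2] relative to the identity under the dilation of the
  plane by [r], so its energy becomes negligible for a widely spread bump. *)
Lemma radial_profile (eps : R) : 0 < eps -> exists rho, [/\ sm1 rho,
  compact_supp (realfun_C rho) & exists K1 K2 : R, [/\ 0 < K1, 0 <= K2,
    planar_energy n rho = K1%:E, planar_energy n (real_radial_laplacian rho) = K2%:E & K2 <= eps * K1]].
Proof.
move=> eps0.
have sb : sm1 (@bump R) := sm1_bump R.
have kb : supp01 (@bump R).
  by move=> x /orP[h|h]; rewrite bump_out// (ltW h) ?orbT.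
have sl := sm1_real_radial_laplacian sb.
have kl : supp01 (real_radial_laplacian (@bump R)).
  move=> x xo; have k1 := supp01_d1 kb; have k2 := supp01_d1 k1.
  by rewrite /real_radial_laplacian k1// k2// !mulr0 addr0.
have [K1 _ e1] := planar_energy_fin n sb kb.
have [K2 K20 e2] := planar_energy_fin n sl kl.
have [d d0 hd] := bump_gt0 R.
have K10 : 0 < K1 := planar_energy_gt0 sb d0 hd e1.
(* this radius satisfies both [1 <= r] and [K2 <= r * (eps * K1)] *)
pose r := 1 + K2 / (eps * K1).
have q0 : 0 <= K2 / (eps * K1) by rewrite divr_ge0// mulr_ge0// ltW.
have r1 : 1 <= r by rewrite lerDl.
have r0 : 0 < r := lt_le_trans ltr01 r1.
have rr0 : 0 < r ^+ 2 by rewrite exprn_gt0.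
pose rho (q : R) := bump (q / r ^+ 2).
have srho : sm1 rho.
  have := sm1_affine 0 (r ^+ 2) sb; by under eq_fun do rewrite subr0.
have s1 := sm1_d1 sb.
have lap : real_radial_laplacian rho = fun q => r ^- 2 * real_radial_laplacian (@bump R) (q / r ^+ 2).
  apply/funext => q; rewrite /real_radial_laplacian d1_scale//.
  rewrite (@dirdM _ _ _ _ lineP 1 (fun=> r ^- 2) (fun x => d1 (@bump R) (x / r ^+ 2))); last 2 first.
  - exact: sm_cst.
  - by have := sm1_affine 0 (r ^+ 2) s1; under eq_fun do rewrite subr0.
  by rewrite d1_scale// dird_cst; field; rewrite gt_eqF.
exists rho; split => //.
  exists (r ^+ 2) => x hx; rewrite /realfun_C /rho bump_out//.
  have [x0|x0] := leP x 0; first by rewrite pmulr_lle0 ?invr_gt0// x0.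
  by rewrite orbC ler_pdivlMr// mul1r; move: hx; rewrite ger0_norm ?(ltW x0)// => /ltW ->.
exists ((r ^+ n.+1) ^+ 2 * K1), ((r ^+ n.+1) ^+ 2 * (r ^- 2) ^+ 2 * K2).
have R0 : 0 < (r ^+ n.+1) ^+ 2 by rewrite !exprn_gt0.
split.
- exact: mulr_gt0.
- by rewrite mulr_ge0// mulr_ge0 ?sqr_ge0// ltW.
- by rewrite planar_energy_scale// e1 EFinM.
- have sl' : sm1 (fun q => real_radial_laplacian (@bump R) (q / r ^+ 2)).
    by have := sm1_affine 0 (r ^+ 2) sl; under eq_fun do rewrite subr0.
  by rewrite lap planar_energyZ// planar_energy_scale// e2 -!EFinM; congr EFin; ring.
- rewrite -[leLHS]mulrA [leRHS]mulrCA ler_pM2l//.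
  rewrite exprVn -exprM ler_pdivrMl ?exprn_gt0//.
  rewrite (@le_trans _ _ (r * (eps * K1)))//.
    rewrite /r mulrDl divfK ?gt_eqF ?mulr_gt0// mul1r lerDr mulr_ge0 ?ltW//.
  by apply: ler_wpM2r; [rewrite mulr_ge0// ltW|rewrite ler_eXnr].
Qed.

Lemma D1_modulated (f : R -> R) (nu : R) : sm1 f ->
  D1 (fun x => nu%:C%C * (Complex (cos (xi * x)) (sin (xi * x)) * (f x)%:C%C)) =
  fun x => nu%:C%C * (Complex (cos (xi * x)) (sin (xi * x)) * (i * (xi * f x)%:C%C + (d1 f x)%:C%C)).
Proof.
move=> sf; have sw := csm1_wave xi; have sfC := csm1_realfun_C sf.
rewrite /D1 (cdirZ lineP); last exact: csmM.
have dw : cdir (1 : R) (fun t => Complex (cos (xi * t)) (sin (xi * t))) = _ := D1_wave xi.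
have df : cdir (1 : R) (realfun_C f) = realfun_C (d1 f) := D1_realfun_C sf.
rewrite (cdirM lineP _ sw sfC) dw df.
by apply/funext => x; rewrite /realfun_C; ring.
Qed.

Definition modulated (nu : R) (f : R -> R) (x : R) : C :=
  nu%:C%C * (Complex (cos (xi * x)) (sin (xi * x)) * (f x)%:C%C).

Lemma csm1_modulated nu f : sm1 f -> csm1 (modulated nu f).
Proof.
move=> sf; apply: csmM; first exact: csm_cst.
by apply: csmM; [exact: csm1_wave|exact: csm1_realfun_C].
Qed.

Lemma sqn_modulated nu f x : sqn (modulated nu f x) = nu ^+ 2 * f x ^+ 2.
Proof. by rewrite /modulated !sqnM sqn_wave !sqn_real mul1r. Qed.

(** At the frequency [xi] the first derivative of the exponential contributes
  [lambda * i * xi * (i / theta) = - 1], which cancels the leading term [b] of [corrected_axial]; only [xi ^+ 2] and derivatives of the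
  envelope survive. *)
Lemma corrected_modulated nu f x : sm1 f ->
  corrected_axial T lambda omega k n.+1 (modulated nu f) x =
  nu%:C%C * Complex (cos (xi * x)) (sin (xi * x)) * (i * (theta^-1)%:C%C *
   Complex (xi ^+ 2 * f x + lambda * d1 f x - d1 (d1 f) x) (- (2 * xi * d1 f x))).
Proof.
move=> sf; have s1 := sm1_d1 sf.
have e1 : D1 (modulated nu f) = fun x => i * modulated nu (fun x => xi * f x) x + modulated nu (d1 f) x.
  rewrite /modulated D1_modulated//; apply/funext => y; ring.
have sxf : sm1 (fun x => xi * f x) by apply: sm_mul => //; exact: sm_cst.
have e2 : D1 (D1 (modulated nu f)) = fun x => i * D1 (modulated nu (fun x => xi * f x)) x + D1 (modulated nu (d1 f)) x.
  rewrite e1 /D1 (cdirD lineP); [|by apply: csmM; [exact: csm_cst|exact: csm1_modulated]|exact: csm1_modulated].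
  by rewrite (cdirZ lineP)//; exact: csm1_modulated.
have dxf : d1 (fun x => xi * f x) = fun x => xi * d1 f x.
  rewrite (@dirdM _ _ _ _ lineP 1 (fun=> xi) f) ?dird_cst//; last exact: sm_cst.
  by apply/funext => y; ring.
rewrite /corrected_axial -/theta e2 e1 {1}/modulated D1_modulated// D1_modulated// dxf /modulated.
have tx : (theta^-1)%:C%C * lambda%:C%C * xi%:C%C = 1 :> C.
  by rewrite -!rmorphM/= (_ : _ * _ = 1)// /xi; field; rewrite theta_neq0 gt_eqF.
set e := Complex (cos _) _; rewrite [Complex (_ + _) _]Complex_split.
apply/eqP; rewrite -subr_eq0.
rewrite (_ : _ - _ = nu%:C%C * e * (i * i + 1) * ((f x)%:C%C - i * (theta^-1)%:C%C * (xi ^+ 2 * f x)%:C%C)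
   + nu%:C%C * e * (f x)%:C%C * (i * i) * ((theta^-1)%:C%C * lambda%:C%C * xi%:C%C - 1)); last by ring.
by rewrite ii tx subrr !(mulr0, mul0r) addr0.
Qed.

(** For an envelope of large width [M], the derivatives of the envelope are negligible and the
  corrected profile has relative size [xi ^+ 2 / |theta| = |theta| / lambda ^+ 2]; the constant [4]
  absorbs the cross terms.  Since [M] does not depend on [tau], the packet can be placed anywhere on
  the axis. *)
Lemma axial_profile (K : R) : 0 < K -> exists2 M : R, 1 <= M & forall tau, exists b,
  [/\ csm1 b, forall x, (x <= tau) || (tau + M <= x) -> b x = 0,
      axial_energy b = (K^-1)%:E &
      (axial_energy (corrected_axial T lambda omega k n.+1 b) <=
        (4 * theta ^+ 2 / lambda ^+ 4 * K^-1)%:E)%E].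
Proof.
move=> K0.
have sb : sm1 (@bump R) := sm1_bump R.
have s1 := sm1_d1 sb; have s2 := sm1_d1 s1.
have kb : supp01 (@bump R).
  by move=> x /orP[h|h]; rewrite bump_out// (ltW h) ?orbT.
have [J0 _ e0] := supp01_energy sb kb.
have [J1 J1_ge0 e1] := supp01_energy s1 (supp01_d1 kb).
have [J2 J2_ge0 e2] := supp01_energy s2 (supp01_d1 (supp01_d1 kb)).
have J0_gt0 := bump_energy_gt0 e0.
have xi0 : xi != 0 by rewrite mulf_neq0// invr_neq0// gt_eqF.
pose A := (3 * lambda ^+ 2 + 4 * xi ^+ 2) * J1 + 3 * J2.
have A0 : 0 <= A.
  by rewrite addr_ge0 ?mulr_ge0// addr_ge0// mulr_ge0// sqr_ge0.
pose B := xi ^+ 4 * J0.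
have B0 : 0 < B by rewrite mulr_gt0// exprn_even_gt0.
(* chosen so that [M^-1 ^+ 2 * A <= B]: [A] collects the terms with derivatives of the envelope *)
pose M := 1 + A / B.
have q0 : 0 <= A / B by rewrite divr_ge0// ltW.
have M1 : 1 <= M by rewrite lerDl.
have M0 : 0 < M := lt_le_trans ltr01 M1.
exists M => // tau.
(* amplitude normalizing the energy to [K^-1] *)
pose nu := Num.sqrt ((M * J0 * K)^-1).
have nu2 : nu ^+ 2 = (M * J0 * K)^-1 by rewrite sqr_sqrtr// invr_ge0 !mulr_ge0 ?ltW.
pose f (x : R) := bump ((x - tau) / M).
have sf : sm1 f := sm1_affine tau M sb.
have df : d1 f = fun x => M^-1 * d1 (@bump R) ((x - tau) / M) := d1_affine tau M sb.
have ddf : d1 (d1 f) = fun x => M^-1 * (M^-1 * d1 (d1 (@bump R)) ((x - tau) / M)).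
  rewrite df (@dirdM _ _ _ _ lineP 1 (fun=> M^-1) (fun x => d1 (@bump R) ((x - tau) / M))); last 2 first.
  - exact: sm_cst.
  - exact: sm1_affine.
  by rewrite (d1_affine tau M s1) dird_cst; apply/funext => x; ring.
have msq g : sm1 g -> measurable_fun [set: measurableTypeR R] (fun x => (g x ^+ 2)%:E).
  by move=> sg; apply/measurable_EFinP; apply: measurable_funX; exact: sm1_measurable.
have sq0 g (x : R) : (0 <= ((g x : R) ^+ 2)%:E)%E by rewrite lee_fin sqr_ge0.
have sp := csm1_modulated nu sf.
exists (modulated nu f); split => //.
- move=> x xo; rewrite /modulated /f bump_out ?mulr0//.
  by rewrite pmulr_lle0 ?invr_gt0// subr_le0 ler_pdivlMr// mul1r lerBrDl.
- rewrite /axial_energy; under eq_integral do rewrite sqn_modulated EFinM.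
  rewrite ge0_integralZl//; [|exact: msq|by rewrite lee_fin sqr_ge0].
  rewrite (@integral_affine R M tau (fun y => (bump y ^+ 2)%:E) M0 (msq _ sb) (sq0 _)) e0 nu2 -!EFinM.
  by congr EFin; field; rewrite !gt_eqF.
pose c := nu ^+ 2 * theta ^- 2.
have c_ge0 : 0 <= c by rewrite mulr_ge0 ?sqr_ge0// invr_ge0 sqr_ge0.
(* bound of the energy density of the corrected profile by squares of the envelope and its
     derivatives, using [(p + q - r)^2 <= 3 (p^2 + q^2 + r^2)] *)
pose h y : \bar R := ((c * (3 * xi ^+ 4))%:E * (bump y ^+ 2)%:E +
  ((c * ((3 * lambda ^+ 2 + 4 * xi ^+ 2) * M ^- 2))%:E * (d1 (@bump R) y ^+ 2)%:E +
   (c * (3 * M ^- 4))%:E * (d1 (d1 (@bump R)) y ^+ 2)%:E))%E.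
have k0_ge0 : 0 <= c * (3 * xi ^+ 4) by rewrite mulr_ge0// mulr_ge0// exprn_even_ge0.
have k1_ge0 : 0 <= c * ((3 * lambda ^+ 2 + 4 * xi ^+ 2) * M ^- 2).
  rewrite mulr_ge0// mulr_ge0 ?invr_ge0 ?sqr_ge0//.
  by rewrite addr_ge0// mulr_ge0// sqr_ge0.
have k2_ge0 : 0 <= c * (3 * M ^- 4).
  by rewrite mulr_ge0// mulr_ge0// invr_ge0 exprn_ge0// ltW.
have mh : measurable_fun [set: measurableTypeR R] h.
  by apply: emeasurable_funD; [|apply: emeasurable_funD]; apply: measurable_funeM; exact: msq.
have h0 y : (0 <= h y)%E by rewrite !adde_ge0// mule_ge0// lee_fin.
pose h1 (x : R) := h ((x - tau) / M).
apply: (@le_trans _ _ (\int[L]_x h1 x)%E).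
  apply: ge0_le_integral => //.
  - by move=> x _; rewrite lee_fin sqn_ge0.
  - by apply/measurable_EFinP; apply: csm1_measurable_sqn; exact: csm1_corrected_axial.
  - apply: (@measurableT_comp _ _ _ _ _ _ h setT _ mh).
    by apply: measurable_funM => //; exact: measurable_funB.
  move=> x _; rewrite corrected_modulated// /h1 /h -!EFinM -!EFinD lee_fin.
  rewrite !sqnM sqn_wave !sqn_real mulr1 ddf df /f.
  set b0 := bump _; set b1 := d1 _ _; set b2 := d1 _ _.
  have -> : M ^- 2 = M^-1 ^+ 2 by rewrite exprVn.
  have -> : M ^- 4 = M^-1 ^+ 4 by rewrite exprVn.
  set mi := M^-1.
  have -> : nu ^+ 2 * (sqn i * theta^-1 ^+ 2 * sqn (Complex (xi ^+ 2 * b0 + lambda * (mi * b1) - mi * (mi * b2)) (- (2 * xi * (mi * b1))))) =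
    c * ((xi ^+ 2 * b0 + lambda * (mi * b1) - mi * (mi * b2)) ^+ 2 + (2 * xi * (mi * b1)) ^+ 2).
    by rewrite /sqn/= /c -exprVn; ring.
  rewrite -!(mulrA c) -!mulrDr ler_wpM2l// -subr_ge0.
  set p := xi ^+ 2 * b0; set q := lambda * (mi * b1); set r := mi * (mi * b2).
  rewrite (_ : _ - _ = (p - q) ^+ 2 + (p + r) ^+ 2 + (q + r) ^+ 2); last by rewrite /p /q /r; ring.
  by rewrite !addr_ge0// sqr_ge0.
rewrite /h1 (@integral_affine R M tau h M0 mh h0) /h.
rewrite ge0_integralD//; last 4 first.
- by move=> x _; rewrite mule_ge0// lee_fin.
- by apply: measurable_funeM; exact: msq.
- by move=> x _; rewrite adde_ge0// mule_ge0// lee_fin.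
- by apply: emeasurable_funD; apply: measurable_funeM; exact: msq.
rewrite ge0_integralD//; last 4 first.
- by move=> x _; rewrite mule_ge0// lee_fin.
- by apply: measurable_funeM; exact: msq.
- by move=> x _; rewrite mule_ge0// lee_fin.
- by apply: measurable_funeM; exact: msq.
rewrite !ge0_integralZl//; try exact: msq; rewrite ?lee_fin//.
rewrite e0 e1 e2 -!EFinM lee_fin.
have cM : 0 <= c * M by rewrite mulr_ge0// ltW.
have MV1 : M^-1 <= 1 by rewrite invf_le1.
have MV0 : 0 <= M^-1 by rewrite invr_ge0 ltW.
have AB : M^-1 ^+ 2 * A <= B.
  apply: (@le_trans _ _ (M^-1 * A)).
    by rewrite ler_wpM2r// expr2 ler_piMl.
  rewrite mulrC ler_pdivrMr// /M mulrDr mulr1 mulrC divfK ?gt_eqF// lerDr ltW//.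
have M4 : M^-1 ^+ 4 * (3 * J2) <= M^-1 ^+ 2 * (3 * J2).
  rewrite ler_wpM2r ?mulr_ge0//; apply: ler_wiXn2l => //.
apply: (@le_trans _ _ (c * M * (4 * B))).
  rewrite [leLHS](_ : _ = c * M * (3 * B + (M^-1 ^+ 2 * ((3 * lambda ^+ 2 + 4 * xi ^+ 2) * J1) + M^-1 ^+ 4 * (3 * J2)))); last first.
    by rewrite -!exprVn /B; ring.
  rewrite ler_wpM2l//; move: AB M4; rewrite /A mulrDr.
  set z1 := M^-1 ^+ 2 * _; set z2 := M^-1 ^+ 2 * _; set z3 := M^-1 ^+ 4 * _ => AB M4.
  lra.
rewrite /c nu2 /B /xi le_eqVlt; apply/orP; left; apply/eqP; field.
by rewrite theta_neq0 !gt_eqF.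
Qed.

End Packet.

Section WavePacket.
Variables (R : realType) (T lambda omega : R) (k : int) (n : nat).
Hypotheses (T_gt0 : 0 < T) (lambda_gt0 : 0 < lambda).
Local Notation C := R[i].
Local Notation csm1 := (csm (@line_chart R)).
Local Notation sm1 := (sm (@line_chart R)).
Local Notation i := (Complex (0 : R) 1).
Let theta := frequency T k - omega * n.+1%:R.
Hypothesis theta_neq0 : theta != 0.
Local Notation potk := (pot T k n.+1).
Local Notation mu4 := (leb_spacetime R).

Lemma energy_ge0 (F : spacetime R -> C) z : 0 <= energy F z.
Proof. by rewrite addr_ge0 ?sqn_ge0. Qed.

Lemma csm4_measurable (F : spacetime R -> C) : csm (@spacetime_chart R) F -> cmeasurable F.
Proof. by move=> [F1 F2]; split; exact: sm4_measurable. Qed.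

Lemma energy_measurable (F : spacetime R -> C) : csm (@spacetime_chart R) F ->
  measurable_fun [set: measurableTypeR R * (measurableTypeR R * measurableTypeR R * measurableTypeR R)] (energy F).
Proof.
move=> sF; apply: measurable_funD; apply: measurable_sqn; apply: csm4_measurable; apply: csm_cdir => //; exact: spacetime_chartP.
Qed.

(** The axial and the planar correction each contribute half of the bound.  The planar one is the
  Laplacian divided by [theta], and is made small enough by spreading the radial profile before the
  axial one is chosen; the axial profile then normalizes the total energy. *)
Theorem wave_packet : exists M rho, [/\ 1 <= M, sm1 rho, compact_supp (realfun_C rho) &
  forall tau, exists b, [/\ csm1 b,
    forall x, (x <= tau) || (tau + M <= x) -> b x = 0,
    (\int[mu4]_(z in period_domain T setT) (energy (potk b (realfun_C rho)) z)%:E = T%:E)%E &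
    (\int[mu4]_(z in period_domain T setT)
      (energy (corrector T lambda omega k n.+1 b (realfun_C rho)) z)%:E
       <= (16 * T * theta ^+ 2 / lambda ^+ 4)%:E)%E]].
Proof.
(* the ratio of planar energies for which the planar correction, which carries
   [theta^-1 ^+ 2], matches the bound of the axial one *)
have eps0 : 0 < 4 * theta ^+ 4 / lambda ^+ 4.
  by rewrite divr_gt0 ?exprn_gt0// mulr_gt0// exprn_even_gt0.
have [rho [srho krho [K1 [K2 [K10 K20 e1 e2 K21]]]]] := radial_profile n eps0.
have [M M1 hM] := axial_profile lambda_gt0 theta_neq0 K10.
exists M, rho; split => // tau; have [b [sb bo eb eb1]] := hM tau.
exists b; split => //.
  rewrite energy_integral// eb e1 -!EFinM; congr EFin; field; exact: lt0r_neq0.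
have slap := sm1_real_radial_laplacian n srho.
pose cb (x : R) : C := - (i * (theta^-1)%:C%C) * b x.
have scb : csm1 cb by apply: csmM => //; exact: csm_cst.
have s1 := csm1_corrected_axial T lambda omega k n.+1 sb.
set b1 := corrected_axial _ _ _ _ _ _ in s1 eb1.
have Xe : corrector T lambda omega k n.+1 b (realfun_C rho) =
    fun z => potk b1 (realfun_C rho) z + potk cb (realfun_C (real_radial_laplacian n rho)) z.
  apply/funext => z; rewrite /corrector; congr (_ + _).
  by rewrite /pot /corrected_radial radial_laplacian_real// -/theta /cb; ring.
have p1 := csm4_pot T k n.+1 s1 (csm1_realfun_C srho).
have p2 := csm4_pot T k n.+1 scb (csm1_realfun_C slap).
have D_m : measurable (period_domain T [set: space3 R]) by exact: measurableX.
have em (F : spacetime R -> C) : csm (@spacetime_chart R) F ->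
    measurable_fun (period_domain T [set: space3 R]) (fun z => (energy F z)%:E).
  by move=> sF; apply: measurable_funTS; apply/measurable_EFinP; exact: energy_measurable.
have pos (F : spacetime R -> C) z : (0 <= (energy F z)%:E)%E by rewrite lee_fin energy_ge0.
apply: (@le_trans _ _ (\int[mu4]_(z in period_domain T setT)
  (2%:E * (energy (potk b1 (realfun_C rho)) z)%:E + 2%:E * (energy (potk cb (realfun_C (real_radial_laplacian n rho))) z)%:E)))%E.
  apply: ge0_le_integral => //.
  - by apply: em; rewrite Xe; exact: csmD.
  - by apply: emeasurable_funD; apply: measurable_funeM; exact: em.
  - by move=> z _; rewrite -!EFinM -EFinD lee_fin Xe; exact: energyD_le.
rewrite ge0_integralD//; last 4 first.
- by move=> z _; rewrite mule_ge0.
- by apply: measurable_funeM; exact: em.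
- by move=> z _; rewrite mule_ge0.
- by apply: measurable_funeM; exact: em.
rewrite !ge0_integralZl//; try exact: em.
rewrite !energy_integral// e1 e2.
have -> : axial_energy cb = ((theta^-1 ^+ 2)%:E * axial_energy b)%E.
  rewrite /axial_energy -ge0_integralZl//.
  - apply: eq_integral => x _; rewrite -EFinM /cb sqnM; congr (_ * _)%:E.
    by rewrite /sqn !(ReN, ImN, ReM, ImM) /=; ring.
  - by apply/measurable_EFinP; exact: csm1_measurable_sqn.
  - by move=> x _; rewrite lee_fin sqn_ge0.
  - by rewrite lee_fin sqr_ge0.
rewrite eb -!EFinM.
apply: (@le_trans _ _ (2%:E * (T%:E * ((4 * theta ^+ 2 / lambda ^+ 4 / K1)%:E * K1%:E)) + (2 * (T * (theta^-1 ^+ 2 * K1^-1 * K2)))%:E))%E.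
  apply: leeD => //; rewrite lee_pmul2l//= lee_pmul2l ?lte_fin//= lee_pmul2r ?lte_fin//=.
rewrite -!EFinM -EFinD lee_fin.
have h2 : theta^-1 ^+ 2 * K1^-1 * K2 <= 4 * theta ^+ 2 / lambda ^+ 4.
  rewrite mulrAC ler_pdivrMr// exprVn ler_pdivrMl ?exprn_even_gt0//.
  by rewrite (le_trans K21)// le_eqVlt; apply/orP; left; apply/eqP; ring.
rewrite divfK ?gt_eqF// (_ : 16 * T * theta ^+ 2 / lambda ^+ 4 =
  2 * (T * (4 * theta ^+ 2 / lambda ^+ 4)) + 2 * (T * (4 * theta ^+ 2 / lambda ^+ 4))); last by ring.
by rewrite lerD2l ler_pM2l// ler_pM2l.
Qed.

End WavePacket.

(** * Small divisors *)

Section SmallDetuning.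
Variable R : realType.

(** Dirichlet's argument: two of the fractional parts of [a * j], [j <= N], are closer than [1 / N].
  The bound [1 / N < a] excludes that the integer parts coincide, so that the numerator is
  positive. *)
Lemma pigeonhole_detuning (a eps : R) : 0 < a -> 0 < eps ->
  exists k n : nat, (0 < k)%N /\ `|a * k%:R - n.+1%:R| < eps.
Proof.
move=> a0 eps0.
pose N := (Num.truncn (Num.max eps^-1 a^-1)).+1.
have N0 : (0 : R) < N%:R by rewrite ltr0n.
have NM : Num.max eps^-1 a^-1 < N%:R by exact: truncnS_gt.
have Ne : N%:R^-1 < eps.
  by rewrite -[ltRHS]invrK ltf_pV2 ?posrE ?invr_gt0// (le_lt_trans _ NM)// le_max lexx.
have Na : N%:R^-1 < a.
  by rewrite -[ltRHS]invrK ltf_pV2 ?posrE ?invr_gt0// (le_lt_trans _ NM)// le_max lexx orbT.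
pose ip (j : nat) := Num.truncn (a * j%:R).
pose fp (j : nat) : R := a * j%:R - (ip j)%:R.
have aj0 j : 0 <= a * j%:R by rewrite mulr_ge0// ltW.
have fp0 j : 0 <= fp j by rewrite subr_ge0 truncn_le.
have fp1 j : fp j < 1 by rewrite ltrBlDl natr1 truncnS_gt.
have box_lt j : (Num.truncn (N%:R * fp j) < N)%N.
  rewrite truncn_lt_nat ?mulr_ge0 ?(ltW N0)//.
  by rewrite -[ltRHS]mulr1 ltr_pM2l.
pose boxn (j : 'I_N.+1) : 'I_N := Ordinal (box_lt j).
have [i [j [ij eij]]] : exists i j : 'I_N.+1, (i < j)%N /\ boxn i = boxn j.
  have : ~~ injectiveb boxn.
    apply/negP => /injectiveP /leq_card; by rewrite !card_ord ltnn.
  case/injectivePn => i [j ij eij].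
  have [lt|lt|/val_inj e] := ltngtP i j; [by exists i, j|by exists j, i|by rewrite e eqxx in ij].
have close : `|fp j - fp i| < N%:R^-1.
  have e : Num.truncn (N%:R * fp i) = Num.truncn (N%:R * fp j) := congr1 val eij.
  have h1 := truncn_itv (_ : 0 <= N%:R * fp i); have h2 := truncn_itv (_ : 0 <= N%:R * fp j).
  have /andP[l1 u1] := h1 (mulr_ge0 (ltW N0) (fp0 i)).
  have /andP[l2 u2] := h2 (mulr_ge0 (ltW N0) (fp0 j)).
  rewrite e in l1 u1; rewrite -natr1 in u1 u2.
  rewrite -(ltr_pM2l N0) mulfV ?gt_eqF// -[X in X * _](ger0_norm (ltW N0)) -normrM mulrBr.
  rewrite ltr_norml; lra.
have ip_le : (ip i <= ip j)%N.
  by apply: le_truncn; rewrite ler_pM2l// ler_nat ltnW.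
pose k := (j - i)%N; pose m := (ip j - ip i)%N.
have k0 : (0 < k)%N by rewrite subn_gt0.
have ekm : a * k%:R - m%:R = fp j - fp i.
  by rewrite /k /m !natrB ?(ltnW ij)// /fp; ring.
have m0 : (0 < m)%N.
  rewrite lt0n; apply/eqP => e; move: close; rewrite -ekm e subr0 ger0_norm//.
  move=> /lt_trans/(_ Na); rewrite gtr_pMr// ltNge ler1n k0//.
exists k, m.-1; split => //; rewrite prednK// ekm; exact: lt_trans Ne.
Qed.

(** Applying [pigeonhole_detuning] to a multiple of [a] makes [k] as large as desired, hence the
  approximations can be taken with distinct [k]. *)
Lemma small_detuning (a eps : R) (p : nat) : 0 < a -> 0 < eps ->
  exists kn : nat * nat, (p < kn.1)%N /\ `|a * kn.1%:R - kn.2.+1%:R| < eps.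
Proof.
move=> a0 eps0.
have [k [n [k0 h]]] := @pigeonhole_detuning (a * p.+1%:R) eps (mulr_gt0 a0 (ltr0Sn _ _)) eps0.
exists (p.+1 * k, n)%N; split => /=; first by rewrite -[(p < _)%N]/(p.+1 <= _)%N leq_pmulr.
by rewrite natrM mulrA.
Qed.

(** Along a sequence of increasing [k] the detunings decay like [4^-j]; weights [2^-j] on these [k],
  and [0] elsewhere, are summable but not bounded by a multiple of the detunings. *)
Lemma resonance_sequence (a : R) : 0 < a ->
  exists (n_ : nat -> nat) (c : nat -> R), [/\ forall k, 0 <= c k,
    forall N, \sum_(k < N) c k <= 2 &
    forall A, exists k, A * `|a * k%:R - (n_ k).+1%:R| < c k].
Proof.
move=> a0.
have /choice[g hg] : forall pj : nat * nat, exists kn : nat * nat,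
    (pj.1 < kn.1)%N /\ `|a * kn.1%:R - kn.2.+1%:R| < 4^-1 ^+ pj.2.
  by move=> [p j]; apply: small_detuning => //; rewrite exprn_gt0// invr_gt0.
pose s := fix s (j : nat) := if j is j'.+1 then g ((s j').1, j) else g (0, 0)%N.
have sS j : ((s j).1 < (s j.+1).1)%N := (hg ((s j).1, j.+1)).1.
have s_small j : `|a * (s j).1%:R - (s j).2.+1%:R| < 4^-1 ^+ j.
  by case: j => [|j]; [exact: (hg (0, 0)%N).2|exact: (hg ((s j).1, j.+1)).2].
have s_mono : {homo (fun j => (s j).1) : x y / (x < y)%N}.
  apply: homo_ltn => //; exact: ltn_trans.
have s_ge j : (j <= (s j).1)%N.
  by elim: j => // j ih; exact: leq_ltn_trans ih (sS j).
have s_inj i j : (s i).1 = (s j).1 -> i = j.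
  move=> e; have [/s_mono|/s_mono|//] := ltngtP i j; by rewrite e ltnn.
have /choice[n_ hn] : forall k, exists n, forall j, (s j).1 = k -> (s j).2 = n.
  move=> k; have [[j e]|h] := pselect (exists j, (s j).1 = k).
    by exists (s j).2 => j' e'; congr (s _).2; apply: s_inj; rewrite e'.
  by exists 0%N => j e; case: h; exists j.
pose c k : R := \sum_(j < k.+1) (if (s j).1 == k then 2^-1 ^+ j else 0).
have c0 k : 0 <= c k.
  by apply: sumr_ge0 => j _; case: ifP => // _; rewrite exprn_ge0// invr_ge0.
exists n_, c; split => //.
- move=> N.
  apply: (@le_trans _ _ (\sum_(k < N) \sum_(j < N) (if (s j).1 == k then 2^-1 ^+ j else 0))).
    apply: ler_sum => k _; rewrite /c.
    rewrite (big_ord_widen N (fun j => if (s j).1 == k then 2^-1 ^+ j else 0 : R))//.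
    rewrite [leLHS]big_mkcond/=; apply: ler_sum => j _; case: ifP => // _.
    by case: ifP => // _; rewrite exprn_ge0// invr_ge0.
  rewrite exchange_big/=.
  apply: (@le_trans _ _ (\sum_(j < N) 2^-1 ^+ j)).
    apply: ler_sum => j _.
    have [lt|ge] := ltnP (s j).1 N.
      rewrite (bigD1 (Ordinal lt))//= eqxx big1 ?addr0// => k /negP hk.
      case: eqP => // e; exfalso; apply: hk; apply/eqP/val_inj; exact: esym.
    rewrite big1 ?exprn_ge0 ?invr_ge0// => k _; case: eqP => // e.
    by move: ge; rewrite e leqNgt ltn_ord.
  have -> : \sum_(j < N) 2^-1 ^+ j = 2 - 2 * 2^-1 ^+ N :> R.
    elim: (N) => [|M ih]; first by rewrite big_ord0 expr0; ring.
    by rewrite big_ord_recr/= ih exprS; field.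
  by rewrite gerBl mulr_ge0// exprn_ge0// invr_ge0.
- move=> A; pose j := (Num.truncn `|A|).+1.
  have Aj : `|A| < 2 ^+ j.
    apply: (lt_trans (truncnS_gt _)); rewrite -/j -natrX ltr_nat; exact: ltn_expl.
  exists (s j).1; rewrite -(hn _ j erefl).
  have cj : 2^-1 ^+ j <= c (s j).1.
    have lt : (j < (s j).1.+1)%N by rewrite ltnS.
    rewrite /c (bigD1 (Ordinal lt))//= eqxx lerDl; apply: sumr_ge0 => i _.
    by case: ifP => // _; rewrite exprn_ge0// invr_ge0.
  apply: lt_le_trans cj; have := s_small j; set d := `|_ - _| => dj.
  apply: (@le_lt_trans _ _ (`|A| * 4^-1 ^+ j)).
    apply: (@le_trans _ _ (`|A| * d)); first by rewrite ler_wpM2r ?ler_norm// normr_ge0.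
    by rewrite ler_wpM2l// ltW.
  rewrite (_ : 4^-1 ^+ j = 2^-1 ^+ j * 2^-1 ^+ j); last by rewrite -exprMn; congr (_ ^+ _); field.
  rewrite mulrA gtr_pMl ?exprn_gt0 ?invr_gt0//.
  by rewrite exprVn ltr_pdivrMr ?exprn_gt0// mul1r.
Qed.

End SmallDetuning.

(** * The norm of square integrable functions *)

Section ComplexMeasurable.
Context d (E : measurableType d) (R : realType).
Local Notation C := R[i].
Implicit Types g h : E -> C.

Lemma cmeasurable_cst (z : C) : cmeasurable (fun _ : E => z).
Proof. by split; exact: measurable_cst. Qed.

Lemma cmeasurableM g h : cmeasurable g -> cmeasurable h -> cmeasurable (fun x => g x * h x).
Proof.
move=> [g1 g2] [h1 h2]; split.
- by under eq_fun do rewrite ReM; apply: measurable_funB; exact: measurable_funM.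
- by under eq_fun do rewrite ImM; apply: measurable_funD; exact: measurable_funM.
Qed.

Lemma cmeasurableD g h : cmeasurable g -> cmeasurable h -> cmeasurable (fun x => g x + h x).
Proof.
move=> [g1 g2] [h1 h2]; split.
- by under eq_fun do rewrite ReD; exact: measurable_funD.
- by under eq_fun do rewrite ImD; exact: measurable_funD.
Qed.

Lemma cmeasurable_sum n (F : nat -> E -> C) : (forall i, cmeasurable (F i)) ->
  cmeasurable (fun x => \sum_(i < n) F i x).
Proof.
move=> mF; elim: n => [|n ih].
  by under eq_fun do rewrite big_ord0; exact: cmeasurable_cst.
by under eq_fun do rewrite big_ord_recr/=; exact: cmeasurableD.
Qed.

End ComplexMeasurable.

Section L2Norm.
Variable R : realType.
Local Notation C := R[i].
Local Notation mu3 := (leb_space R).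
Implicit Type g : space3 R -> C.

Definition sq_integral g : \bar R := (\int[mu3]_x (sqn (g x))%:E)%E.

Lemma sq_integral_ge0 g : (0 <= sq_integral g)%E.
Proof. by apply: integral_ge0 => x _; rewrite lee_fin sqn_ge0. Qed.

Lemma L2normE g : L2norm g = sqrte (sq_integral g).
Proof.
rewrite /L2norm unlock /Lnorm; rewrite -poweR12_sqrt ?sq_integral_ge0//.
congr (_ `^ _)%E; apply: eq_integral => x _.
by rewrite poweR_EFin ger0_norm ?normcE ?sqrtr_ge0// powR_mulrn ?sqrtr_ge0// sqr_sqrtr ?sqn_ge0.
Qed.

Lemma L2norm_le g (s : R) : 0 <= s -> (sq_integral g <= (s ^+ 2)%:E)%E -> (L2norm g <= s%:E)%E.
Proof.
move=> s0; rewrite L2normE; have := sq_integral_ge0 g; case: (sq_integral g) => //= r r0.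
by rewrite !lee_fin => h; rewrite -[leRHS](ger0_norm s0) -sqrtr_sqr ler_sqrt// sqr_ge0.
Qed.

Lemma sq_integral_le g (s : R) : (L2norm g <= s%:E)%E -> (sq_integral g <= (s ^+ 2)%:E)%E.
Proof.
rewrite L2normE; have := sq_integral_ge0 g; case: (sq_integral g) => //= r.
rewrite !lee_fin => r0 h; rewrite -[leLHS](sqr_sqrtr r0) lerXn2r ?nnegrE ?sqrtr_ge0//.
by rewrite (le_trans _ h)// sqrtr_ge0.
Qed.

Lemma L2norm_ge0 g : (0 <= L2norm g)%E.
Proof. exact: Lnorm_ge0. Qed.

Lemma L2normD_le g h : cmeasurable g -> cmeasurable h ->
  (L2norm (fun x => (g x + h x)%R) <= L2norm g + L2norm h)%E.
Proof.
move=> mg mh.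
have m1 := measurable_normc mg; have m2 := measurable_normc mh.
have := @minkowski_EFin _ _ _ mu3 (fun x => Normc.normc (g x)) (fun x => Normc.normc (h x)) 2 m1 m2 (ler1n _ 2).
apply: le_trans; rewrite /L2norm unlock /Lnorm.
have two0 : (0 : R) <= 2^-1 by rewrite invr_ge0.
apply: (gt0_ler_poweR two0).
- by rewrite in_itv/= leey andbT; apply: integral_ge0 => x _; rewrite lee_fin powR_ge0.
- by rewrite in_itv/= leey andbT; apply: integral_ge0 => x _; rewrite lee_fin powR_ge0.
have mgh := cmeasurableD mg mh.
apply: ge0_le_integral => //.
- by move=> x _; rewrite poweR_ge0.
- apply: (@measurableT_comp _ _ _ _ _ _ (fun y => poweR y 2)); first exact: measurable_poweR.
  by apply: measurableT_comp => //; apply/measurable_EFinP; exact: measurable_normc.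
- apply: (@measurableT_comp _ _ _ _ _ _ (fun y => poweR y 2)); first exact: measurable_poweR.
  by apply: measurableT_comp => //; apply/measurable_EFinP; exact: measurable_funD.
move=> x _; apply: (gt0_ler_poweR (ler0n _ 2)); rewrite ?in_itv/= ?leey ?andbT// ?lee_fin ?normr_ge0//.
have nn (z : C) : 0 <= Normc.normc z by rewrite normcE sqrtr_ge0.
by rewrite !ger0_norm ?addr_ge0//; exact: le_normcD.
Qed.

End L2Norm.

(** * Absolutely convergent Fourier series are square integrable *)

Section AbsoluteFourierSeries.
Variables (R : realType) (T : R).
Hypothesis T_gt0 : 0 < T.
Local Notation C := R[i].
Local Notation mu3 := (leb_space R).

Lemma L2norm_charZ (k : int) t (g : space3 R -> C) :
  L2norm (fun x => fourier_char T k t * g x) = L2norm g.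
Proof.
rewrite !L2normE; congr sqrte; apply: eq_integral => x _.
by rewrite sqnM -/(time_char T k t) sqn_time_char mul1r.
Qed.

Lemma L2norm0 : L2norm (fun _ : space3 R => 0 : C) = 0%E.
Proof.
rewrite L2normE /sq_integral; under eq_integral do rewrite sqn0.
by rewrite integral0 sqrte0.
Qed.

Lemma L2norm_sum n (F : nat -> space3 R -> C) : (forall i, cmeasurable (F i)) ->
  (L2norm (fun x => (\sum_(i < n) F i x)%R) <= \sum_(i < n) L2norm (F i))%E.
Proof.
move=> mF; elim: n => [|n ih].
  by under eq_fun do rewrite big_ord0; rewrite big_ord0 L2norm0.
under eq_fun do rewrite big_ord_recr/=.
rewrite [leRHS]big_ord_recr/=; apply: (le_trans (L2normD_le (cmeasurable_sum n mF) (mF n))).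
by rewrite leeD2r.
Qed.

(** The norm of [g (t, _)] is bounded by the sum of the norms of the coefficients, uniformly in [t],
  since the characters have modulus [1].  The additional [1] bounds one remainder. *)
Lemma A_L2_bounded g : A_L2 T g -> exists S : R, 0 <= S /\
  forall t, (L2norm (fun x => g (t, x)) <= S%:E)%E.
Proof.
move=> [_ _ [fk [L2fk fin L2g lim]]].
set E := esum _ _ in fin.
have E0 : (0 <= E)%E by apply: esum_ge0 => k _; exact: L2norm_ge0.
exists (fine E + 1); split; first by rewrite addr_ge0// fine_ge0.
move=> t; have := lim t.
move=> /fine_cvgP[fn fc].
have lt1 : \forall n \near \oo, (fine (L2norm ((fun x => g (t, x)) - \sum_(i < n.*2.+1)
     fourier_char T ((i : nat)%:Z - n%:Z) t *: fk ((i : nat)%:Z - n%:Z))) < 1)%R.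
  by apply: (cvgr_lt _ fc).
near \oo => n.
have : L2norm ((fun x => g (t, x)) - \sum_(i < n.*2.+1)
     fourier_char T ((i : nat)%:Z - n%:Z) t *: fk ((i : nat)%:Z - n%:Z)) \is a fin_num by near: n.
have : fine (L2norm ((fun x => g (t, x)) - \sum_(i < n.*2.+1)
     fourier_char T ((i : nat)%:Z - n%:Z) t *: fk ((i : nat)%:Z - n%:Z))) < 1 by near: n.
set e := fun i : nat => (i%:Z - n%:Z)%R.
set h := (X in L2norm X) => h1 hf.
pose F (i : nat) (x : space3 R) : C := fourier_char T (e i) t * fk (e i) x.
have mF i : cmeasurable (F i) by apply: cmeasurableM; [exact: cmeasurable_cst|exact: (L2fk _).1].
have mP := cmeasurable_sum n.*2.+1 mF; have leP := L2norm_sum n.*2.+1 mF.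
have hE : h = fun x => g (t, x) + - 1 * (\sum_(i < n.*2.+1) F i x).
  apply/funext => x; rewrite /h mulN1r; congr (_ - _).
  by rewrite fct_sumE.
have mh : cmeasurable h.
  rewrite hE; apply: cmeasurableD; [exact: (L2g t).1|apply: cmeasurableM => //; exact: cmeasurable_cst].
have -> : (fun x => g (t, x)) = (fun x => h x + \sum_(i < n.*2.+1) F i x).
  by apply/funext => x; rewrite hE mulN1r subrK.
apply: (le_trans (L2normD_le mh mP)).
rewrite EFinD [leLHS]addeC; apply: leeD.
  rewrite fineK; last by rewrite ge0_fin_numE.
  apply: (le_trans leP); under eq_bigr do rewrite L2norm_charZ.
  apply: esum_ge; exists (e @` `I_n.*2.+1).
    by split => //; apply: finite_image; exact: finite_II.
  rewrite fsbig_image; last first.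
    by move=> i j _ _ /addIr [].
  by rewrite (@fsbig_ord _ _ _ _ (fun i => L2norm (fk (e i)))).
by rewrite -(fineK hf) lee_fin ltW.
Unshelve. all: by end_near. Qed.

(** A bound of the spatial norm that is uniform in time integrates over a period. *)
Lemma A_L2_sub_L2_spacetime : A_L2 T `<=` L2_spacetime T.
Proof.
move=> g Ag; have [S [S0 hS]] := A_L2_bounded Ag.
case: Ag => pg mg _; split => //.
have mq : measurable_fun [set: measurableTypeR R * (measurableTypeR R * measurableTypeR R * measurableTypeR R)] (fun z => sqn (g z)).
  exact: measurable_sqn.
under eq_integral do rewrite -sqn_normc.
pose H z := ((fun z : spacetime R => (sqn (g z))%:E) \_ (period_domain T setT)) z.
have H0 z : (0 <= H z)%E by rewrite /H patchE; case: ifP => // _; rewrite lee_fin sqn_ge0.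
have mD : measurable (period_domain T (@setT (measurableTypeR R * measurableTypeR R * measurableTypeR R))) by exact: measurableX.
have mH : measurable_fun [set: measurableTypeR R * (measurableTypeR R * measurableTypeR R * measurableTypeR R)] H.
  by apply/(measurable_restrictT _ mD); apply: measurable_funTS; apply/measurable_EFinP.
rewrite integral_mkcond.
have -> : (\int[leb_spacetime R]_z ((fun z : spacetime R => (sqn (g z))%:E) \_ (period_domain T setT)) z = \int[@lebesgue_measure R]_t \int[leb_space R]_x H (t, x))%E.
  exact: (@fubini_tonelli1 _ _ _ _ _ (@lebesgue_measure R) (leb_space R) H mH H0).
have mF : measurable_fun [set: measurableTypeR R] (fun t => \int[leb_space R]_x H (t, x))%E.
  exact: (@measurable_fun_fubini_tonelli_F _ _ _ _ _ (leb_space R) H mH H0).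
apply: (@le_lt_trans _ _ (S ^+ 2 * (T - 0))%:E); last exact: ltry.
apply: integral_le_itv => //.
- by move=> t; apply: integral_ge0.
- move=> t; apply: le_trans (sq_integral_le (hS t)).
  apply: ge0_le_integral => //.
  + exact: measurableT_comp mH (pair1_measurable t).
  + by apply/measurable_EFinP; apply: measurableT_comp mq (pair1_measurable t).
  + by move=> x _; rewrite /H patchE; case: ifP => // _; rewrite lee_fin sqn_ge0.
- move=> t tT; apply: integral0_eq => x _; rewrite /H patchE; case: ifPn => // /set_mem[/= h1 _].
  by rewrite h1 in tT.
Qed.

End AbsoluteFourierSeries.

(** * Fourier series with coefficients in disjoint slabs *)

Section StripSeries.
Variables (R : realType) (T : R).
Hypothesis T_gt0 : 0 < T.
Local Notation C := R[i].
Variables (Psi : nat -> space3 R -> C) (tau : nat -> R) (c : nat -> R).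
Hypotheses (mPsi : forall k, cmeasurable (Psi k))
  (ePsi : forall k, (sq_integral (Psi k) <= 1%:E)%E)
  (tau_mono : forall k, tau k <= tau k.+1) (tau_ge : forall k, k%:R <= tau k)
  (suppPsi : forall k x, (x.1.1 <= tau k) || (tau k.+1 <= x.1.1) -> Psi k x = 0)
  (c_ge0 : forall k, 0 <= c k) (c_sum : forall N, \sum_(k < N) c k <= 2).

Definition strip_term k t (x : space3 R) : C := (c k)%:C%C * fourier_char T k%:Z t * Psi k x.

(** The sum of all [strip_term]s: as [k <= tau k], the terms of index beyond [`|x.1.1|] vanish at
  [x], so that a finite sum suffices. *)
Definition strip_series t (x : space3 R) : C :=
  \sum_(k < (Num.truncn `|x.1.1|).+1) strip_term k t x.

Lemma tau_homo k l : (k <= l)%N -> tau k <= tau l.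
Proof. by move=> /subnK <-; elim: (l - k)%N => // n ih; rewrite (le_trans ih)// addSn. Qed.

Lemma Psi_disjoint k l x : Psi k x != 0 -> l != k -> Psi l x = 0.
Proof.
move=> Pk lk; apply: suppPsi; have [lt|lt|e] := ltngtP l k; last by rewrite e eqxx in lk.
- apply/orP; right; apply: (le_trans (tau_homo lt)).
  by case: leP => // h; move: Pk; rewrite suppPsi ?eqxx// ltW.
- apply/orP; left; apply: le_trans (tau_homo lt).
  by case: leP => // h; move: Pk; rewrite suppPsi ?eqxx// (ltW h) orbT.
Qed.

Lemma Psi_index k x : Psi k x != 0 -> (k < (Num.truncn `|x.1.1|).+1)%N.
Proof.
move=> Pk; have kx : tau k < x.1.1.
  by rewrite ltNge; apply/negP => h; move: Pk; rewrite suppPsi ?eqxx// h.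
rewrite ltnS truncn_ge_nat ?normr_ge0//; apply: (le_trans (tau_ge k)).
by apply: (le_trans (ltW kx)); exact: ler_norm.
Qed.

Lemma strip_sum (N k : nat) t x : Psi k x != 0 ->
  \sum_(l < N) strip_term l t x = if (k < N)%N then strip_term k t x else 0.
Proof.
move=> Pk; case: ifPn => kN.
  rewrite (bigD1 (Ordinal kN))//= big1 ?addr0// => l lk.
  by rewrite /strip_term (Psi_disjoint Pk) ?mulr0.
rewrite big1// => l _; rewrite /strip_term (Psi_disjoint Pk) ?mulr0//.
by apply: contraNneq kN => <-; exact: ltn_ord.
Qed.

Lemma strip_seriesE k t x : Psi k x != 0 -> strip_series t x = strip_term k t x.
Proof. by move=> Pk; rewrite /strip_series (strip_sum _ _ Pk) (Psi_index Pk). Qed.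

Lemma strip_sum0 (N : nat) t x : (forall k, Psi k x = 0) -> \sum_(l < N) strip_term l t x = 0.
Proof. by move=> P0; rewrite big1// => l _; rewrite /strip_term P0 mulr0. Qed.

Lemma strip_series_partial N t x : ((Num.truncn `|x.1.1|).+1 <= N)%N ->
  \sum_(l < N) strip_term l t x = strip_series t x.
Proof.
move=> xN; have [[k Pk]|P0] := pselect (exists k, Psi k x != 0).
  by rewrite (strip_sum _ _ Pk) (strip_seriesE _ Pk) (leq_trans (Psi_index Pk) xN).
rewrite /strip_series !strip_sum0// => k; apply/eqP/negPn/negP => h; by apply: P0; exists k.
Qed.

Lemma sqn_strip_term k t x : sqn (strip_term k t x) = c k ^+ 2 * sqn (Psi k x).
Proof. by rewrite /strip_term !sqnM sqn_real -/(time_char T k%:Z t) sqn_time_char mulr1. Qed.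

Lemma cmeasurable_strip_term k :
  @cmeasurable R _ (measurableTypeR R * (measurableTypeR R * measurableTypeR R * measurableTypeR R))%type (fun z => strip_term k z.1 z.2).
Proof.
apply: cmeasurableM; last first.
  by case: (mPsi k) => p1 p2; split; [exact: measurableT_comp p1 measurable_snd|exact: measurableT_comp p2 measurable_snd].
apply: cmeasurableM; first exact: cmeasurable_cst.
have [w1 w2] := csm1_time_char T k%:Z.
split.
- exact: measurableT_comp (sm1_measurable w1) measurable_fst.
- exact: measurableT_comp (sm1_measurable w2) measurable_fst.
Qed.

Lemma cmeasurable_strip_series :
  @cmeasurable R _ (measurableTypeR R * (measurableTypeR R * measurableTypeR R * measurableTypeR R))%type (fun z => strip_series z.1 z.2).
Proof.
have mN N := cmeasurable_sum N cmeasurable_strip_term.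
have cv (f : C -> R) z : f (\sum_(l < N) strip_term l z.1 z.2) @[N --> \oo] --> f (strip_series z.1 z.2).
  apply: cvg_near_cst; near=> N; rewrite strip_series_partial//.
  by near: N; exact: nbhs_infty_ge.
split.
- apply: (measurable_fun_cvg (h := fun N z => complex.Re (\sum_(l < N) strip_term l z.1 z.2))).
    by move=> N; exact: (mN N).1.
  by move=> z _; exact: cv.
- apply: (measurable_fun_cvg (h := fun N z => complex.Im (\sum_(l < N) strip_term l z.1 z.2))).
    by move=> N; exact: (mN N).2.
  by move=> z _; exact: cv.
Unshelve. all: by end_near. Qed.

Lemma cmeasurable_slice (F : spacetime R -> C) t :
  @cmeasurable R _ (measurableTypeR R * (measurableTypeR R * measurableTypeR R * measurableTypeR R))%type F ->
  @cmeasurable R _ (measurableTypeR R * measurableTypeR R * measurableTypeR R)%type (fun x => F (t, x)).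
Proof.
move=> [F1 F2]; split.
- exact: measurableT_comp F1 (pair1_measurable t).
- exact: measurableT_comp F2 (pair1_measurable t).
Qed.

Lemma cmeasurable_remainder N t :
  @cmeasurable R _ (measurableTypeR R * measurableTypeR R * measurableTypeR R)%type
    (fun x => strip_series t x - \sum_(l < N) strip_term l t x).
Proof.
have m1 := cmeasurable_slice t cmeasurable_strip_series.
have m2 := cmeasurable_slice t (cmeasurable_sum N cmeasurable_strip_term).
have m3 := cmeasurableD m1 (cmeasurableM (cmeasurable_cst _ (-1)) m2).
rewrite /= in m3; move: m3; under eq_fun do rewrite mulN1r.
by [].
Qed.

Let tail N := (\sum_(k <oo) (c (k + N)%N * 2)%:E)%E.

(** Disjointness of the supports turns the squared norm of the remainder into the sum of the squared
  norms of its terms, and [c k ^+ 2 <= 2 * c k]. *)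
Lemma strip_remainder_le N t :
  (sq_integral (fun x => (strip_series t x - \sum_(l < N) strip_term l t x)%R) <= tail N)%E.
Proof.
pose a i (x : space3 R) := (c (i + N)%N ^+ 2 * sqn (Psi (i + N)%N x))%:E.
have a0 i x : (0 <= a i x)%E by rewrite lee_fin mulr_ge0 ?sqr_ge0 ?sqn_ge0.
have ma i : measurable_fun [set: measurableTypeR R * measurableTypeR R * measurableTypeR R] (a i).
  by apply/measurable_EFinP; apply: measurable_funM => //; exact: measurable_sqn (mPsi _).
apply: (@le_trans _ _ (\int[leb_space R]_x (\sum_(i <oo) a i x))%E).
  apply: ge0_le_integral => //.
  - by move=> x _; rewrite lee_fin sqn_ge0.
  - by apply/measurable_EFinP; apply: measurable_sqn; exact: cmeasurable_remainder.
  - by apply: ge0_emeasurable_sum.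
  move=> x _; have [[k Pk]|P0] := pselect (exists k, Psi k x != 0); last first.
    have P0' k : Psi k x = 0 by apply/eqP/negPn/negP => h; apply: P0; exists k.
    rewrite /strip_series !strip_sum0// subr0 sqn0; exact: nneseries_ge0.
  rewrite (strip_seriesE _ Pk) (strip_sum _ _ Pk).
  have [kN|Nk] := ltnP k N; first by rewrite subrr sqn0; exact: nneseries_ge0.
  rewrite subr0 sqn_strip_term.
  apply: (@le_trans _ _ (a (k - N)%N x)); first by rewrite /a subnK.
  by rewrite (@nneseriesD1 _ (fun i => a i x) (k - N)%N xpredT)// leeDl//; exact: nneseries_ge0.
rewrite integral_nneseries//; apply: lee_nneseries => [i _ _|i _].
  by apply: integral_ge0.
rewrite /a; under eq_integral do rewrite EFinM.
rewrite ge0_integralZl//; last 3 first.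
- by apply/measurable_EFinP; exact: measurable_sqn (mPsi _).
- by move=> x _; rewrite lee_fin sqn_ge0.
- by rewrite lee_fin sqr_ge0.
apply: (@le_trans _ _ ((c (i + N)%N ^+ 2)%:E * 1%:E)%E).
  apply: lee_wpmul2l; [by rewrite lee_fin sqr_ge0|exact: ePsi].
rewrite mule1 lee_fin expr2 ler_wpM2l//.
have := c_sum (i + N).+1; apply: le_trans; rewrite big_ord_recr/= lerDr; exact: sumr_ge0.
Qed.

Let tail_ge0 N : (0 <= tail N)%E.
Proof. by apply: nneseries_ge0 => k _ _; rewrite lee_fin mulr_ge0. Qed.

Let tail_le N : (tail N <= 4%:E)%E.
Proof.
apply: lime_le; first by apply: is_cvg_nneseries => k _ _; rewrite lee_fin mulr_ge0.
apply: nearW => n; rewrite big_mkord sumEFin lee_fin -mulr_suml.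
have := c_sum (N + n); rewrite big_split_ord/=.
under [X in _ + X <= _]eq_bigr do rewrite addnC.
have : 0 <= \sum_(k < N) c k by apply: sumr_ge0.
lra.
Qed.

Let tail_cvg : tail N @[N --> \oo] --> 0%E.
Proof.
have tailE N : tail N = (\sum_(N <= k <oo) (c k * 2)%:E)%E.
  by rewrite /tail (@nneseries_addn _ (fun k => (c k * 2)%:E) N)// => k; rewrite lee_fin mulr_ge0.
under eq_fun do rewrite tailE.
apply: nneseries_tail_cvg => [|k _]; last by rewrite lee_fin mulr_ge0.
have -> : (\sum_(k <oo) (c k * 2)%:E = tail 0)%E by rewrite tailE.
exact: le_lt_trans (tail_le 0) (ltry _).
Qed.

Definition strip_coef (k : int) : space3 R -> C :=
  if k is Posz n then fun x => (c n)%:C%C * Psi n x else fun=> 0.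

Lemma strip_partial_sum n t x :
  \sum_(i < n.*2.+1) fourier_char T ((i : nat)%:Z - n%:Z) t * strip_coef ((i : nat)%:Z - n%:Z) x =
  \sum_(l < n.+1) strip_term l t x.
Proof.
rewrite -(big_mkord xpredT (fun i => fourier_char T (i%:Z - n%:Z) t * strip_coef (i%:Z - n%:Z) x)).
have n2 : (n <= n.*2.+1)%N by rewrite -addnn -addnS leq_addr.
rewrite (big_cat_nat (leq0n n) n2)/= big_nat big1 ?add0r; last first.
  move=> i /andP[_ lt]; have [j ->] : exists j, i%:Z - n%:Z = Negz j.
    exists (n - i).-1; rewrite NegzE prednK ?subn_gt0// -opprB; congr (- _).
    by rewrite subzn// ltnW.
  by rewrite mulr0.
rewrite -{1}[n]add0n big_addn (_ : n.*2.+1 - n = n.+1)%N; last first.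
  by rewrite -addnn -addnS addKn.
rewrite big_mkord; apply: eq_bigr => l _.
by rewrite PoszD addrK /strip_coef /strip_term; ring.
Qed.

(** The remainders are bounded by the tails of the summable sequence [c], uniformly in time. *)
Theorem strip_series_A_L2 : A_L2 T (fun z => strip_series z.1 z.2).
Proof.
split.
- move=> t x /=; apply: eq_bigr => k _; rewrite /strip_term.
  by rewrite -/(time_char T k%:Z (t + T)) time_char_periodic.
- exact: cmeasurable_strip_series.
have coef_m k : cmeasurable (strip_coef k).
  case: k => [n|n]; last exact: cmeasurable_cst.
  by apply: cmeasurableM => //; exact: cmeasurable_cst.
have coef_norm n : (L2norm (strip_coef (Posz n)) <= (c n)%:E)%E.
  apply: L2norm_le => //; rewrite /sq_integral/=.
  under eq_integral do rewrite sqnM sqn_real EFinM.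
  rewrite ge0_integralZl//; last 3 first.
  - by apply/measurable_EFinP; exact: measurable_sqn (mPsi _).
  - by move=> x _; rewrite lee_fin sqn_ge0.
  - by rewrite lee_fin sqr_ge0.
  rewrite -[leRHS]mule1; apply: lee_wpmul2l; [by rewrite lee_fin sqr_ge0|exact: ePsi].
exists strip_coef; split.
- move=> [n|n]; split => //; first by exact: le_lt_trans (coef_norm n) (ltry _).
  by rewrite L2norm0 ltry.
- have -> : (\esum_(k in [set: int]) L2norm (strip_coef k) = \sum_(n <oo) L2norm (strip_coef (Posz n)))%E.
    have P0 (n : nat) : xpredT n -> (0 <= L2norm (strip_coef (Posz n)))%E by move=> _; exact: L2norm_ge0.
    have iP : set_inj (fun n : nat => xpredT n) Posz by move=> i j _ _ [].
    rewrite -(@esum_pred_image R _ (fun k => L2norm (strip_coef k)) Posz xpredT P0 iP).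
    rewrite [RHS]esum_mkcond; apply: eq_esum => k _; case: ifPn => // /negP kN.
    case: k kN => [n|n] kN; last exact: L2norm0.
    by exfalso; apply: kN; apply/mem_set; exists n.
  apply: (@le_lt_trans _ _ (\sum_(n <oo) (c n)%:E)%E).
    by apply: lee_nneseries => // n _ _; exact: L2norm_ge0.
  apply: (@le_lt_trans _ _ 2%:E); last exact: ltry.
  apply: lime_le; first by apply: is_cvg_nneseries => k _ _; rewrite lee_fin.
  by apply: nearW => N; rewrite big_mkord sumEFin lee_fin.
- move=> t; split; first exact: cmeasurable_slice cmeasurable_strip_series.
  rewrite L2normE.
  have := strip_remainder_le 0 t; under [X in sq_integral X]eq_fun do rewrite big_ord0 subr0.
  move=> /le_trans/(_ (tail_le 0)); have := sq_integral_ge0 (strip_series t).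
  by case: (sq_integral _) => //= r; rewrite ltry.
move=> t.
have bound n : (L2norm ((fun x => strip_series t x) - \sum_(i < n.*2.+1)
     fourier_char T ((i : nat)%:Z - n%:Z) t *: strip_coef ((i : nat)%:Z - n%:Z))%R <= sqrte (tail n.+1))%E.
  rewrite L2normE lee_sqrt//.
  rewrite (_ : _ - _ = fun x => strip_series t x - \sum_(l < n.+1) strip_term l t x); last first.
    apply/funext => x; rewrite -strip_partial_sum; congr (_ - _).
    by rewrite fct_sumE.
  exact: strip_remainder_le.
have tfin n : tail n \is a fin_num by rewrite ge0_fin_numE// (le_lt_trans (tail_le n)) ?ltry.
apply: (@squeeze_cvge _ _ _ _ (cst 0%E) _ (fun n => sqrte (tail n.+1))); last 2 first.
- exact: cvg_cst.
- under eq_fun do rewrite -(fineK (tfin _))/=.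
  apply: cvg_EFin; first exact: nearW.
  rewrite -[X in _ --> X](@sqrtr0 R); apply: (cvg_comp (fun n => fine (tail n.+1))); last exact: sqrt_continuous.
  by have /fine_cvgP[_] := tail_cvg; rewrite -(cvg_shiftS _).
by apply: nearW => n; rewrite L2norm_ge0 bound.
Qed.

End StripSeries.

(** * Pairing with a complex potential *)

Section Pairing.
Variables (R : realType) (T : R).
Hypothesis T_gt0 : 0 < T.
Local Notation C := R[i].
Local Notation test := (smooth_test T).
Local Notation mu4 := (leb_spacetime R).
Local Notation D := (period_domain T [set: space3 R]).
Local Notation mspacetime := (measurableTypeR R * (measurableTypeR R * measurableTypeR R * measurableTypeR R))%type.

Let D_m : measurable (period_domain T (@setT (measurableTypeR R * measurableTypeR R * measurableTypeR R))).
Proof. exact: measurableX. Qed.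

Definition field_energy (v1 v2 : spacetime R -> C) : \bar R :=
  (\int[mu4]_(z in D) (sqn (v1 z) + sqn (v2 z))%:E)%E.

(** On bounded boxes [|w| <= 1 + w ^+ 2] is integrable. *)
Lemma L2_loc_integrable v : L2_spacetime T v ->
  loc_integrable T (fun z => complex.Re (v z)) /\ loc_integrable T (fun z => complex.Im (v z)).
Proof.
move=> [pv [m1 m2] iv].
have key (w : spacetime R -> R) : measurable_fun [set: mspacetime] w ->
    (forall z, w z ^+ 2 <= Normc.normc (v z) ^+ 2) -> loc_integrable T w.
  move=> mw wv; split => // r.
  have mB : measurable (period_domain T (box r) : set mspacetime) by exact (measurable_period T (measurable_box r)).
  apply: (@le_lt_trans _ _ (\int[mu4]_(z in period_domain T (box r)) (1%:E + ((Normc.normc (v z)) ^+ 2)%:E))%E).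
    apply: ge0_le_integral => //.
    - by apply/measurable_EFinP; apply: measurable_funTS; apply: measurableT_comp.
    - apply: emeasurable_funD => //; apply/measurable_EFinP; apply: measurable_funTS.
      by apply: measurable_funX; exact (measurable_normc (conj m1 m2)).
    move=> z _; rewrite -EFinD lee_fin; apply: (@le_trans _ _ (1 + w z ^+ 2)); last by rewrite lerD2l.
    have := real_normK (num_real (w z)); have := sqr_ge0 (`|w z| - 1); have := normr_ge0 (w z).
    by rewrite sqrrB1; lra.
  rewrite ge0_integralD//; last 2 first.
  - by move=> z _; rewrite lee_fin sqr_ge0.
  - apply/measurable_EFinP; apply: measurable_funTS.
    by apply: measurable_funX; exact (measurable_normc (conj m1 m2)).
  rewrite lte_add_pinfty//.
    rewrite integral_cst// mul1e.
    have e4 : mu4 (period_domain T (box r)) = (lebesgue_measure `[0%R, T] * leb_space R (box r))%E.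
      by apply: product_measure1E => //; exact: measurable_box.
    rewrite [X in (X < _)%E]e4.
    have -> : leb_space R (box r) = (lebesgue_measure `[(- r)%R, r] * lebesgue_measure `[(- r)%R, r] * lebesgue_measure `[(- r)%R, r])%E.
      rewrite boxE; transitivity (sf_product (@lebesgue_measure R) (@lebesgue_measure R) (`[(- r)%R, r] `*` `[(- r)%R, r]) * lebesgue_measure `[(- r)%R, r])%E.
        by apply: product_measure1E => //; exact: measurableX.
      by congr (_ * _)%E; exact: product_measure1E.
    rewrite !lebesgue_measure_itv/= !lte_fin.
    by do 2 case: ifP => _; rewrite -?EFinD -?EFinM ?ltry.
  apply: le_lt_trans iv; apply: ge0_subset_integral => //.
  - by apply/measurable_EFinP; apply: measurable_funTS; apply: measurable_funX; exact (measurable_normc (conj m1 m2)).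
  - by move=> z _; rewrite lee_fin sqr_ge0.
  - by move=> z [h _]; split.
split; apply: key => // z; rewrite -sqn_normc /sqn.
- by rewrite lerDl sqr_ge0.
- by rewrite lerDr sqr_ge0.
Qed.

(** The real inner product of the plane. *)
Definition cdot (x y : C) : R := complex.Re x * complex.Re y + complex.Im x * complex.Im y.

Lemma cdot_Young (delta : R) x y : 0 < delta ->
  `|cdot x y| <= (delta * sqn x + delta^-1 * sqn y) / 2.
Proof.
move=> d0; have d1 : 0 < delta^-1 by rewrite invr_gt0.
rewrite /cdot /sqn; set a := complex.Re x; set b := complex.Im x; set p := complex.Re y; set q := complex.Im y.
have e : delta * delta^-1 = 1 by rewrite mulfV// gt_eqF.
have h (s u : R) : `|s * u| <= (delta * s ^+ 2 + delta^-1 * u ^+ 2) / 2.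
  rewrite ler_norml; apply/andP; split; rewrite -subr_ge0.
    rewrite (_ : _ - _ = delta^-1 / 2 * (delta * s + u) ^+ 2 + (1 - delta * delta^-1) * (s * u + delta * s ^+ 2 / 2)); last by field; rewrite gt_eqF.
    by rewrite e subrr mul0r addr0 mulr_ge0 ?sqr_ge0// mulr_ge0// ltW.
  rewrite (_ : _ - _ = delta^-1 / 2 * (delta * s - u) ^+ 2 + (1 - delta * delta^-1) * (- s * u + delta * s ^+ 2 / 2)); last by field; rewrite gt_eqF.
  by rewrite e subrr mul0r addr0 mulr_ge0 ?sqr_ge0// mulr_ge0// ltW.
apply: (le_trans (ler_normD _ _)); have := h a p; have := h b q; lra.
Qed.

Section Test.
Variables (v1 v2 F : spacetime R -> C).
Hypotheses (i1r : loc_integrable T (fun z => complex.Re (v1 z))) (i1i : loc_integrable T (fun z => complex.Im (v1 z)))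
  (i2r : loc_integrable T (fun z => complex.Re (v2 z))) (i2i : loc_integrable T (fun z => complex.Im (v2 z))).
Hypotheses (tFr : test (fun z => complex.Re (F z))) (tFi : test (fun z => complex.Im (F z))).

(** Pairing the real and imaginary parts separately and adding up gives the real part of the
  hermitian pairing with the rotated gradient of [F]. *)
Definition cpair : R :=
  gpair T (fun z => complex.Re (v1 z)) (fun z => complex.Re (v2 z)) (fun z => complex.Re (F z)) +
  gpair T (fun z => complex.Im (v1 z)) (fun z => complex.Im (v2 z)) (fun z => complex.Im (F z)).

Definition cpair_density (z : spacetime R) : R := cdot (v1 z) (Dx4 2 F z) - cdot (v2 z) (Dx4 1 F z).

Let int v Q j : loc_integrable T v -> test Q ->
  mu4.-integrable D (EFin \o (fun z => v z * dird (direction R (Some j)) Q z)).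
Proof. by move=> iv tQ; apply: loc_integrable_test => //; exact: smooth_test_dird. Qed.

Lemma cpair_densityE : cpair_density = fun z =>
  (complex.Re (v1 z) * dird (direction R (Some 2)) (fun z => complex.Re (F z)) z -
   complex.Re (v2 z) * dird (direction R (Some 1)) (fun z => complex.Re (F z)) z) +
  (complex.Im (v1 z) * dird (direction R (Some 2)) (fun z => complex.Im (F z)) z -
   complex.Im (v2 z) * dird (direction R (Some 1)) (fun z => complex.Im (F z)) z).
Proof. by apply/funext => z; rewrite /cpair_density /cdot/=; ring. Qed.

Let intB v w Q : loc_integrable T v -> loc_integrable T w -> test Q ->
  mu4.-integrable D (EFin \o (fun z => v z * dird (direction R (Some 2)) Q z - w z * dird (direction R (Some 1)) Q z)).
Proof. by move=> iv iw tQ; apply: (@integrableB _ _ _ mu4 D _ _ _ (int 2 iv tQ) (int 1 iw tQ)). Qed.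

Lemma cpair_integrable : mu4.-integrable D (EFin \o cpair_density).
Proof.
rewrite cpair_densityE.
apply: (@integrableD _ _ _ mu4 D _ _ _ (intB i1r i2r tFr) (intB i1i i2i tFi)); exact: D_m.
Qed.

Lemma cpairE : cpair = \int[mu4]_(z in D) cpair_density z.
Proof.
rewrite cpair_densityE RintegralD//; [|exact: intB|exact: intB].
by rewrite !RintegralB//; exact: int.
Qed.

Lemma cpair_diagonal (c E : R) :
  (forall z, cpair_density z = c * energy F z) -> 0 <= c ->
  measurable_fun [set: mspacetime] (energy F) ->
  (\int[mu4]_(z in D) (energy F z)%:E = E%:E)%E -> cpair = c * E.
Proof.
move=> e c0 mE eE; rewrite cpairE /Rintegral.
under eq_integral do rewrite e EFinM.
rewrite ge0_integralZl//; last 2 first.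
- by apply/measurable_EFinP; exact: measurable_funTS.
- by move=> z _; rewrite lee_fin energy_ge0.
by rewrite eE.
Qed.

(** Young's inequality with weight [delta]. *)
Lemma cpair_le (delta A E : R) : 0 < delta -> cmeasurable v1 -> cmeasurable v2 ->
  measurable_fun [set: mspacetime] (energy F) ->
  (field_energy v1 v2 <= A%:E)%E -> (\int[mu4]_(z in D) (energy F z)%:E <= E%:E)%E ->
  cpair <= (delta * A + delta^-1 * E) / 2.
Proof.
move=> d0 m1 m2 mE hA hE; rewrite cpairE /Rintegral -lee_fin.
have d1 : 0 < delta^-1 by rewrite invr_gt0.
rewrite fineK; last exact: integrable_fin_num cpair_integrable.
apply: (le_trans (lee_abs _)).
have le1 : (`|\int[mu4]_(z in D) (EFin \o cpair_density) z| <= \int[mu4]_(z in D) `|(EFin \o cpair_density) z|)%E.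
  by apply: le_abse_integral; [exact: D_m|exact: measurable_int cpair_integrable].
apply: (le_trans le1).
have mS : measurable_fun D (fun z => (sqn (v1 z) + sqn (v2 z))%:E).
  by apply/measurable_EFinP; apply: measurable_funTS; apply: measurable_funD; exact: measurable_sqn.
have mE' : measurable_fun D (fun z => (energy F z)%:E).
  by apply/measurable_EFinP; exact: measurable_funTS.
have dd : 0 <= delta / 2 by rewrite divr_ge0// ltW.
have dd1 : 0 <= delta^-1 / 2 by rewrite divr_ge0// ltW.
apply: (@le_trans _ _ (\int[mu4]_(z in D) ((delta / 2)%:E * (sqn (v1 z) + sqn (v2 z))%:E + (delta^-1 / 2)%:E * (energy F z)%:E))%E).
  apply: ge0_le_integral => //.
  - by apply: measurableT_comp => //; exact: (measurable_int _ cpair_integrable).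
  - by apply: emeasurable_funD; exact: measurable_funeM.
  move=> z _ /=; rewrite -!EFinM -EFinD lee_fin /cpair_density.
  apply: (le_trans (ler_normB _ _)).
  have := cdot_Young (v1 z) (Dx4 2 F z) d0; have := cdot_Young (v2 z) (Dx4 1 F z) d0.
  rewrite /energy; lra.
rewrite ge0_integralD//; try exact: measurable_funeM; last 2 first.
- by move=> z _; rewrite mule_ge0// lee_fin addr_ge0 ?sqn_ge0.
- by move=> z _; rewrite mule_ge0// lee_fin energy_ge0.
rewrite !ge0_integralZl//; try by move=> z _; rewrite lee_fin ?energy_ge0// addr_ge0 ?sqn_ge0.
apply: (@le_trans _ _ ((delta / 2)%:E * A%:E + (delta^-1 / 2)%:E * E%:E)%E).
  by apply: leeD; apply: lee_wpmul2l => //; rewrite lee_fin.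
by rewrite -!EFinM -EFinD lee_fin le_eqVlt; apply/orP; left; apply/eqP; ring.
Qed.

End Test.
End Pairing.

(** * The forcing *)

Section PacketFamily.
Variables (R : realType) (T lambda omega : R).
Hypotheses (T_gt0 : 0 < T) (lambda_gt0 : 0 < lambda).
Local Notation C := R[i].
Local Notation csm1 := (csm (@line_chart R)).
Local Notation sm1 := (sm (@line_chart R)).
Local Notation mu4 := (leb_spacetime R).
Local Notation D := (period_domain T [set: space3 R]).

Definition detuning (k n : nat) : R := frequency T k%:Z - omega * n.+1%:R.

Lemma detuningE k n : 0 < omega ->
  detuning k n = omega * (2 * pi / T / omega * k%:R - n.+1%:R).
Proof. by move=> om0; rewrite /detuning /frequency; field; rewrite !gt_eqF. Qed.

Lemma detuning_neq0 k n : 0 < omega -> irrational (2 * pi / T / omega) -> detuning k n != 0.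
Proof.
move=> om0 irr; rewrite detuningE//; apply: mulf_neq0; first by rewrite gt_eqF.
rewrite subr_eq0; apply/eqP => e; apply: irr.
case: k e => [|k] e; first by move/eqP: e; rewrite mulr0 eq_sym pnatr_eq0.
exists ((n.+1)%:Q / (k.+1)%:Q) => //.
by rewrite rmorphM/= fmorphV/= !ratr_int -!pmulrn -e mulfK// pnatr_eq0.
Qed.

Variable n_ : nat -> nat.
Hypothesis detuned : forall k, detuning k (n_ k) != 0.

(** The packets of [wave_packet], one for each time frequency, one after the other along the axis. *)
Lemma packet_family : exists (tau : nat -> R) (b : nat -> R -> C) (rho : nat -> R -> R),
  [/\ forall k, tau k <= tau k.+1, forall k, k%:R <= tau k,
      forall k x, (x <= tau k) || (tau k.+1 <= x) -> b k x = 0 &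
      forall k, [/\ csm1 (b k), sm1 (rho k), compact_supp (realfun_C (rho k)),
        (\int[mu4]_(z in D) (energy (pot T k%:Z (n_ k).+1 (b k) (realfun_C (rho k))) z)%:E = T%:E)%E &
        (\int[mu4]_(z in D)
          (energy (corrector T lambda omega k%:Z (n_ k).+1 (b k) (realfun_C (rho k))) z)%:E
           <= (16 * T * detuning k (n_ k) ^+ 2 / lambda ^+ 4)%:E)%E]].
Proof.
have h k := @wave_packet R T lambda omega k%:Z (n_ k) T_gt0 lambda_gt0 (detuned k).
have [M hM] := choice h; have {hM}[rho hM] := choice hM.
pose tau k := \sum_(j < k) M j.
have hb k : exists b, [/\ csm1 b, forall x, (x <= tau k) || (tau k + M k <= x) -> b x = 0,
    (\int[mu4]_(z in D) (energy (pot T k%:Z (n_ k).+1 b (realfun_C (rho k))) z)%:E = T%:E)%E &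
    (\int[mu4]_(z in D)
      (energy (corrector T lambda omega k%:Z (n_ k).+1 b (realfun_C (rho k))) z)%:E
       <= (16 * T * detuning k (n_ k) ^+ 2 / lambda ^+ 4)%:E)%E].
  by have [_ _ _] := hM k; apply.
have {hb}[b hb] := choice hb.
have M1 k : 1 <= M k by have [] := hM k.
exists tau, b, rho; split.
- by move=> k; rewrite /tau big_ord_recr/= lerDl (le_trans ler01).
- move=> k; have -> : k%:R = \sum_(j < k) (1 : R) by rewrite sumr_const card_ord.
  exact: ler_sum.
- by move=> k x; rewrite /tau big_ord_recr/= -/(tau k); have [_ h2 _ _] := hb k; exact: h2.
- by move=> k; have [h1 _ h3 h4] := hb k; have [_ h5 h6 _] := hM k.
Qed.

End PacketFamily.

Section Forcing.
Variables (R : realType) (T lambda omega : R) (n_ : nat -> nat) (c tau : nat -> R).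
Variables (b : nat -> R -> R[i]) (rho : nat -> R -> R).
Hypotheses (T_gt0 : 0 < T) (lambda_gt0 : 0 < lambda).
Hypotheses (c_ge0 : forall k, 0 <= c k) (c_sum : forall N, \sum_(k < N) c k <= 2).
Hypotheses (tau_mono : forall k, tau k <= tau k.+1) (tau_ge : forall k, k%:R <= tau k).
Hypothesis b_supp : forall k x, (x <= tau k) || (tau k.+1 <= x) -> b k x = 0.
Hypotheses (sb : forall k, csm (@line_chart R) (b k)) (srho : forall k, sm (@line_chart R) (rho k)).
Hypothesis rho_supp : forall k, compact_supp (realfun_C (rho k)).
Local Notation C := R[i].
Local Notation mu4 := (leb_spacetime R).
Local Notation D := (period_domain T [set: space3 R]).
Local Notation theta k := (detuning T omega k (n_ k)).
Hypothesis detuned : forall k, theta k != 0.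

Definition packet k := pot T k%:Z (n_ k).+1 (b k) (realfun_C (rho k)).
Definition packet_corrector k := corrector T lambda omega k%:Z (n_ k).+1 (b k) (realfun_C (rho k)).

Hypothesis packet_energy : forall k, (\int[mu4]_(z in D) (energy (packet k) z)%:E = T%:E)%E.
Hypothesis corrector_energy : forall k,
  (\int[mu4]_(z in D) (energy (packet_corrector k) z)%:E
     <= (16 * T * theta k ^+ 2 / lambda ^+ 4)%:E)%E.

Let srhoC k := csm1_realfun_C (srho k).

Lemma csm4_packet k : csm (@spacetime_chart R) (packet k).
Proof. exact: csm4_pot. Qed.

Lemma csm4_packet_corrector k : csm (@spacetime_chart R) (packet_corrector k).
Proof.
apply: csmD; apply: csm4_pot => //; first exact: csm1_corrected_axial.
exact: csm1_corrected_radial.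
Qed.

Lemma time_char0 k : time_char T k 0 = 1.
Proof. by rewrite /time_char /fourier_char mulr0 cos0 sin0. Qed.

Lemma packet_d1_time k t x : Dx4 1 (packet k) (t, x) = fourier_char T k%:Z t * Dx4 1 (packet k) (0, x).
Proof. by rewrite /packet pot_d1// /pot/= time_char0 /time_char; ring. Qed.

Lemma packet_d2_time k t x : Dx4 2 (packet k) (t, x) = fourier_char T k%:Z t * Dx4 2 (packet k) (0, x).
Proof. by rewrite /packet pot_d2// /pot/= time_char0 /time_char; ring. Qed.

(** The rotated gradient of the packet at time [0]; the time dependence is the character [k]. *)
Definition profile (j : 'I_3) k (x : space3 R) : C :=
  if j == 1 then Dx4 2 (packet k) (0, x) else if j == 2 then - Dx4 1 (packet k) (0, x) else 0.

Definition forcing (j : 'I_3) (z : spacetime R) : C := strip_series T (profile j) c z.1 z.2.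

Lemma cmeasurable_profile j k :
  @cmeasurable R _ (measurableTypeR R * measurableTypeR R * measurableTypeR R)%type (profile j k).
Proof.
have md l : @cmeasurable R _ (measurableTypeR R * (measurableTypeR R * measurableTypeR R * measurableTypeR R))%type (Dx4 l (packet k)).
  by apply: csm4_measurable; apply: csm_cdir; [exact: spacetime_chartP|exact: csm4_packet].
have m1 := cmeasurable_slice 0 (md 1); have m2 := cmeasurable_slice 0 (md 2).
rewrite (_ : profile j k = if j == 1 then fun x => Dx4 2 (packet k) (0, x)
  else if j == 2 then fun x => - Dx4 1 (packet k) (0, x) else fun=> 0); last first.
  by apply/funext => x; rewrite /profile; do 2 case: ifP => // _.
case: ifP => _ //; case: ifP => _; last exact: cmeasurable_cst.
have m3 := cmeasurableM (cmeasurable_cst _ (-1)) m1.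
by rewrite /= in m3; move: m3; under eq_fun do rewrite mulN1r.
Qed.

Lemma profile_supp j k x : (x.1.1 <= tau k) || (tau k.+1 <= x.1.1) -> profile j k x = 0.
Proof.
move=> h; have b0 := b_supp h.
have p0 m g : pot T k%:Z m (b k) g (0, x) = 0.
  by rewrite /pot (_ : b k (x0 (0, x)) = 0)// mulr0 mul0r.
rewrite /profile /packet pot_d1// pot_d2// !p0 !mulr0 addr0 oppr0.
by do 2 case: ifP => _ //.
Qed.

Lemma packet_energy_slice k t x : energy (packet k) (t, x) = energy (packet k) (0, x).
Proof.
by rewrite /energy packet_d1_time packet_d2_time !sqnM -/(time_char T k%:Z t) sqn_time_char !mul1r.
Qed.

Lemma profile_energy j k : (sq_integral (profile j k) <= 1%:E)%E.
Proof.
pose h x := (energy (packet k) (0, x))%:E.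
have mE := energy_measurable (csm4_packet k).
have mh : measurable_fun [set: measurableTypeR R * measurableTypeR R * measurableTypeR R] h.
  apply/measurable_EFinP.
  exact: (measurableT_comp mE (@pair1_measurable _ _ (measurableTypeR R) (measurableTypeR R * measurableTypeR R * measurableTypeR R)%type 0)).
have h0 x : (0 <= h x)%E by rewrite lee_fin energy_ge0.
have e : (\int[leb_space R]_x h x = 1)%E.
  have := integral_period T_gt0 mh h0.
  have -> : (\int[mu4]_(z in D) h z.2 = T%:E)%E.
    by rewrite -(packet_energy k); apply: eq_integral => -[t x] _; rewrite packet_energy_slice.
  case: (\int[leb_space R]_x h x)%E => [r| |].
  - rewrite -EFinM => -[] eT; congr EFin.
    by apply: (mulfI (lt0r_neq0 T_gt0)); rewrite mulr1.
  - by rewrite gt0_muley ?lte_fin.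
  - by rewrite gt0_muleNy ?lte_fin.
rewrite -e; apply: ge0_le_integral => //.
- by move=> x _; rewrite lee_fin sqn_ge0.
- by apply/measurable_EFinP; apply: measurable_sqn; exact: cmeasurable_profile.
move=> x _; rewrite lee_fin /profile /energy.
case: ifP => _; first by rewrite lerDr sqn_ge0.
case: ifP => _; last by rewrite sqn0 addr_ge0 ?sqn_ge0.
by rewrite {1}/sqn ReN ImN !sqrrN -/(sqn _) lerDl sqn_ge0.
Qed.

Lemma forcing_A_L2 j : A_L2 T (forcing j).
Proof.
apply: (@strip_series_A_L2 R T T_gt0 (profile j) tau c) => //.
- exact: cmeasurable_profile.
- exact: profile_energy.
- exact: profile_supp.
Qed.

Lemma forcingE j k t x : profile j k x != 0 ->
  forcing j (t, x) = (c k)%:C%C * fourier_char T k%:Z t * profile j k x.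
Proof.
move=> p0; exact: (@strip_seriesE R T (profile j) tau c tau_mono tau_ge (profile_supp j) k t x p0).
Qed.

(** On the slab of the [k]-th packet the forcing is [c k] times the rotated gradient of this packet,
  and off the slab the gradient of the packet vanishes. *)
Lemma forcing_density k z : cpair_density (forcing 1) (forcing 2) (packet k) z = c k * energy (packet k) z.
Proof.
case: z => t x; rewrite /cpair_density /energy.
have h1 : cdot (forcing 1 (t, x)) (Dx4 2 (packet k) (t, x)) = c k * sqn (Dx4 2 (packet k) (t, x)).
  have [p0|p0] := eqVneq (profile 1 k x) 0.
    rewrite packet_d2_time (_ : Dx4 2 (packet k) (0, x) = 0)// mulr0 sqn0 /cdot/=; ring.
  rewrite (forcingE t p0) -mulrA -packet_d2_time /cdot !Re_scale !Im_scale /sqn; ring.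
have h2 : cdot (forcing 2 (t, x)) (Dx4 1 (packet k) (t, x)) = - (c k * sqn (Dx4 1 (packet k) (t, x))).
  have [p0|p0] := eqVneq (profile 2 k x) 0.
    have d0 : Dx4 1 (packet k) (0, x) = 0 by apply: oppr_inj; rewrite oppr0.
    rewrite packet_d1_time d0 mulr0 sqn0 /cdot/=; ring.
  rewrite (forcingE t p0) (_ : profile 2 k x = - Dx4 1 (packet k) (0, x))//.
  by rewrite mulrN -mulrA -packet_d1_time /cdot !ReN !ImN !Re_scale !Im_scale /sqn; ring.
by rewrite h1 h2; ring.
Qed.

(** By duality [c k * T] is the pairing of [a = d_t u + omega R u] with the corrector, whose energy
  is of order [theta ^+ 2]; Young's inequality with weight [`|theta k|] makes the bound linear in
  [`|theta k|]. *)
Lemma solution_bound u p :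
  (forall j, L1loc T (u j)) -> is_solution T lambda omega forcing u p ->
  regularity T (L2_spacetime T) omega u ->
  exists A, forall k, c k * T <= A * `|theta k|.
Proof.
move=> u_loc sol [reg _ _].
have [a ha] : exists a : 'I_3 -> spacetime R -> C, forall j, L2_spacetime T (a j) /\
    eq_distrib T (Dt (regular_distrib T (u j)) + omega%:C%C *: rotation (fun j => regular_distrib T (u j)) j)
      (regular_distrib T (a j)).
  have /choice[a ha] : forall j, exists g, L2_spacetime T g /\
    eq_distrib T (Dt (regular_distrib T (u j)) + omega%:C%C *: rotation (fun j => regular_distrib T (u j)) j)
      (regular_distrib T g) by move=> j; have [g] := reg j; exists g.
  by exists a.
have aL2 j := (ha j).1; have aE j := (ha j).2.
have am j : cmeasurable (a j) by case: (aL2 j).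
have fL2 j := A_L2_sub_L2_spacetime T_gt0 (forcing_A_L2 j).
have afin j : (\int[mu4]_(z in D) (sqn (a j z))%:E < +oo)%E.
  by case: (aL2 j) => _ _; under eq_integral do rewrite -sqn_normc.
have a_norm : (field_energy T (a 1%R) (a 2%R) < +oo)%E.
  rewrite /field_energy; under eq_integral do rewrite EFinD.
  have D_m : measurable (D : set (measurableTypeR R * (measurableTypeR R * measurableTypeR R * measurableTypeR R))%type) by exact: measurableX.
  have ms j : measurable_fun (D : set (measurableTypeR R * (measurableTypeR R * measurableTypeR R * measurableTypeR R))%type) (fun z => (sqn (a j z))%:E).
    by apply/measurable_EFinP; apply: measurable_funTS; exact (measurable_sqn (am j)).
  have nn j z : (0 <= (sqn (a j z))%:E)%E by rewrite lee_fin sqn_ge0.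
  rewrite ge0_integralD//; exact: lte_add_pinfty.
have a_norm0 : (0 <= field_energy T (a 1%R) (a 2%R))%E.
  by apply: integral_ge0 => z _; rewrite lee_fin addr_ge0 ?sqn_ge0.
pose A := fine (field_energy T (a 1%R) (a 2%R)).
have AE : (field_energy T (a 1%R) (a 2%R) <= A%:E)%E by rewrite fineK// ge0_fin_numE.
exists ((A + 16 * T / lambda ^+ 4) / 2) => k.
have bC : compact_supp (b k).
  exists (Num.max `|tau k| `|tau k.+1|) => x; rewrite gt_max => /andP[x1 x2]; apply: b_supp.
  case: (leP x (tau k)) => //= h; rewrite leNgt; apply/negP => h2.
  have := ler_norm (tau k.+1); have := ler_norm (- tau k); rewrite normrN.
  by move: x1 x2; case: (ger0P x) => x0; lra.
have [tSr tSi] := test_pot k%:Z (n_ k).+1 T_gt0 (sb k) (srhoC k) bC (rho_supp k).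
have [tXr tXi] := test_corrector lambda omega k%:Z (n_ k).+1 T_gt0 (sb k) (srhoC k) bC (rho_supp k).
have tr := transport_corrector lambda (detuned k) (sb k) (srhoC k).
have [dr _] := solution_duality T_gt0 u_loc sol aE tSr tXr (fun z => (tr z).1).
have [_ di] := solution_duality T_gt0 u_loc sol aE tSi tXi (fun z => (tr z).2).
have [f1r f1i] := L2_loc_integrable (fL2 1).
have [f2r f2i] := L2_loc_integrable (fL2 2).
have [a1r a1i] := L2_loc_integrable (aL2 1).
have [a2r a2i] := L2_loc_integrable (aL2 2).
have mS := energy_measurable (csm4_packet k).
have mX := energy_measurable (csm4_packet_corrector k).
rewrite -(cpair_diagonal T_gt0 f1r f1i f2r f2i tSr tSi (forcing_density k) (c_ge0 k) mS (packet_energy k)).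
rewrite {1}/cpair dr di -/(cpair T (a 1) (a 2) (packet_corrector k)).
have th : 0 < `|theta k| by rewrite normr_gt0.
apply: (le_trans (cpair_le T_gt0 a1r a1i a2r a2i tXr tXi th (am 1) (am 2) mX AE (corrector_energy k))).
rewrite le_eqVlt; apply/orP; left; apply/eqP.
rewrite -(real_normK (num_real (theta k))); field.
by rewrite !gt_eqF.
Qed.

End Forcing.

(** A forcing in the smaller space without solutions of the lower regularity: it settles both
  parts of the theorem. *)
Lemma unsolvable_forcing (R : realType) (lambda omega T : R) :
  0 < lambda -> 0 < omega -> 0 < T -> irrational (2 * pi / T / omega) ->
  exists f : 'I_3 -> spacetime R -> R[i], (forall j, A_L2 T (f j)) /\
    ~ exists (u : 'I_3 -> spacetime R -> R[i]) (p : spacetime R -> R[i]),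
        [/\ forall j, L1loc T (u j), L1loc T p,
            is_solution T lambda omega f u p &
            regularity T (L2_spacetime T) omega u].
Proof.
move=> lambda_gt0 omega_gt0 T_gt0 irr.
have ratio_gt0 : 0 < 2 * pi / T / omega by rewrite !divr_gt0// mulr_gt0// pi_gt0.
have [n_ [c [c_ge0 c_sum resonant]]] := resonance_sequence ratio_gt0.
have detuned k : detuning T omega k (n_ k) != 0 by exact: detuning_neq0.
have [tau [b [rho [tau_mono tau_ge b_supp packets]]]] := packet_family T_gt0 lambda_gt0 detuned.
have sb k : csm (@line_chart R) (b k) by have [] := packets k.
have srho k : sm (@line_chart R) (rho k) by have [] := packets k.
have rho_supp k : compact_supp (realfun_C (rho k)) by have [] := packets k.
have packet_energy k : (\int[leb_spacetime R]_(z in period_domain T [set: space3 R])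
    (energy (packet T n_ b rho k) z)%:E = T%:E)%E by have [] := packets k.
have corrector_energy k : (\int[leb_spacetime R]_(z in period_domain T [set: space3 R])
    (energy (packet_corrector T lambda omega n_ b rho k) z)%:E
      <= (16 * T * detuning T omega k (n_ k) ^+ 2 / lambda ^+ 4)%:E)%E by have [] := packets k.
exists (forcing T n_ c b rho); split.
  by move=> j; apply: (@forcing_A_L2 R T n_ c tau b rho).
move=> [u [p [u_loc _ sol reg]]].
have [A hA] : exists A, forall k, c k * T <= A * `|detuning T omega k (n_ k)|.
  by apply: (@solution_bound R T lambda omega n_ c tau b rho) u_loc sol reg.
have [k] := resonant (A * omega / T).
rewrite ltNge => /negP; apply.
have := hA k; rewrite detuningE// normrM (gtr0_norm omega_gt0) => h.
rewrite -(ler_pM2r T_gt0) (le_trans h)// le_eqVlt; apply/orP; left; apply/eqP.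
by field; rewrite gt_eqF.
Qed.


Theorem theorem3p5 (R : realType) (lambda omega T : R)
  (lambda_gt0 : 0 < lambda) (omega_gt0 : 0 < omega) (T_gt0 : 0 < T)
  (irrational_ratio : irrational (2 * pi / T / omega)) :
  (exists f : 'I_3 -> spacetime R -> R[i],
    (forall j, A_L2 T (f j)) /\
    ~ exists (u : 'I_3 -> spacetime R -> R[i]) (p : spacetime R -> R[i]),
        [/\ forall j, L1loc T (u j), L1loc T p,
            is_solution T lambda omega f u p &
            regularity T (A_L2 T) omega u])
  /\
  (exists f : 'I_3 -> spacetime R -> R[i],
    (forall j, L2_spacetime T (f j)) /\
    ~ exists (u : 'I_3 -> spacetime R -> R[i]) (p : spacetime R -> R[i]),
        [/\ forall j, L1loc T (u j), L1loc T p,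
            is_solution T lambda omega f u p &
            regularity T (L2_spacetime T) omega u]).
Proof.
have [f [f_A no_solution]] := unsolvable_forcing lambda_gt0 omega_gt0 T_gt0 irrational_ratio.
split; exists f; split => //; last by move=> j; exact: A_L2_sub_L2_spacetime.
move=> [u [p [u_loc p_loc sol [reg1 reg2 reg3]]]]; apply: no_solution; exists u, p.
have sub S : belongs T (A_L2 T) S -> belongs T (L2_spacetime T) S.
  by move=> [g Ag gS]; exists g => //; exact: A_L2_sub_L2_spacetime.
by split => //; split => *; apply: sub.
Qed.
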